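(* Let $0\le j<k\le n-1$, $0<\omega<\pi/2$. (i) Suppose $j+k\le n-2$, and let $F\in C(\widetilde G_{n+1,j+1})$ satisfy $\sup(\cos|\tau_0|)^p|F(\tau_0)|<\infty$ for some $p<j+1$. If $(R_0F)(\zeta_0)=0$ for all $\zeta_0\in\widetilde G_{n+1,k+1}$ with $|\zeta_0|>\omega$, then $F(\tau_0)=0$ for all $\tau_0\in\widetilde G_{n+1,j+1}$ with $|\tau_0|>\omega$. (ii) Suppose $j+k\ge n$, and let $\Phi\in C(\widetilde G_{n+1,k+1})$ satisfy $\sup(\sin|\zeta_0|)^q|\Phi(\zeta_0)|<\infty$ for some $q<n-k$. If $(R_0^*\Phi)(\tau_0)=0$ for all $\tau_0\in\widetilde G_{n+1,j+1}$ with $|\tau_0|<\omega$, then $\Phi(\zeta_0)=0$ for all $\zeta_0\in\widetilde G_{n+1,k+1}$ with $|\zeta_0|<\omega$. Here the suprema are over $\widetilde G_{n+1,j+1}$ and $\widetilde G_{n+1,k+1}$, respectively.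
   Context: $n\ge2$; functions are complex-valued. $G_{n+1,d+1}$ is the Grassmannian of $(d+1)$-dimensional linear subspaces of $\mathbb R^{n+1}$; for $\tau_0\in G_{n+1,d+1}$, $|\tau_0|\in[0,\pi/2]$ is the geodesic distance on the unit sphere $S^n$ between the north pole $(0,\dots,0,1)$ and $S^n\cap\tau_0$. $\widetilde G_{n+1,d+1}=\{\tau_0\in G_{n+1,d+1}:0<|\tau_0|<\pi/2\}$, an open subset of full measure; $C(\cdot)$ denotes continuous functions. The Radon transform of $F$ on $G_{n+1,j+1}$ is $(R_0F)(\zeta_0)=\int_{\tau_0\subset\zeta_0}F(\tau_0)\,d_{\zeta_0}\tau_0$, $\zeta_0\in G_{n+1,k+1}$, with the invariant probability measure on the $(j+1)$-dimensional subspaces of $\zeta_0$; the dual transform of $\Phi$ on $G_{n+1,k+1}$ is $(R_0^*\Phi)(\tau_0)=\int_{\zeta_0\supset\tau_0}\Phi(\zeta_0)\,d_{\tau_0}\zeta_0$, $\tau_0\in G_{n+1,j+1}$, with the invariant probability measure on the $(k+1)$-dimensional subspaces containing $\tau_0$. (For $\zeta_0\in\widetilde G_{n+1,k+1}$, almost all $\tau_0\subset\zeta_0$ lie in $\widetilde G_{n+1,j+1}$; similarly for the dual.) *)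

(* Defs.v *)
From HB Require Import structures.
From mathcomp Require Import all_boot all_order all_algebra.
From mathcomp Require Import all_classical all_reals all_analysis.
From mathcomp Require Import complex.

Set Implicit Arguments.
Unset Strict Implicit.
Unset Printing Implicit Defensive.

Import Order.TTheory GRing.Theory Num.Theory.
Import numFieldNormedType.Exports.

Local Open Scope classical_set_scope.
Local Open Scope ring_scope.
Local Open Scope complex_scope.

Definition dotv {R : realType} {m} (x y : 'rV[R]_m) : R := (x *m y^T) 0 0.

(* All linear subspaces of R^(n+1), of every dimension: the Grassmannians
   G_{n+1,d+1} are subsets of this one type. *)
Definition subspaces (R : realType) (n : nat) := {vspace 'rV[R]_n.+1}.

Definition basis_mx {R : realType} {n} (U : subspaces R n) :
    'M[R]_(\dim U, n.+1) :=
  \matrix_(i < \dim U) tnth (vbasis U) i.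

(* Acts on row vectors, by x |-> x *m orth_proj U; the Gram matrix formula
   B^T (B B^T)^-1 B for a basis matrix B of U. *)
Definition orth_proj {R : realType} {n} (U : subspaces R n) : 'M[R]_n.+1 :=
  let B := basis_mx U in B^T *m invmx (B *m B^T) *m B.

Section orth_proj_correct.
Variables (R : realType) (n : nat) (U : subspaces R n).

Lemma dotv_eq0 m (x : 'rV[R]_m) : (dotv x x == 0) = (x == 0).
Proof.
apply/idP/eqP => [|->]; last by rewrite /dotv mul0mx mxE.
rewrite /dotv mxE psumr_eq0 => [/allP h|i _]; last by rewrite mxE -expr2 sqr_ge0.
apply/rowP => i; have := h i (mem_index_enum i).
by rewrite !mxE -expr2 sqrf_eq0 => /eqP.
Qed.

Lemma basis_mxE (v : 'rV[R]_(\dim U)) :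
  v *m basis_mx U = \sum_i v 0 i *: (vbasis U)`_i.
Proof.
rewrite mulmx_sum_row; apply: eq_bigr => i _.
by rewrite rowK (tnth_nth 0).
Qed.

Lemma gram_unit : basis_mx U *m (basis_mx U)^T \in unitmx.
Proof.
rewrite -row_free_unit -kermx_eq0; apply/eqP/row_matrixP => i; rewrite row0.
set v := row i _.
have /sub_kermxP vG : (v <= kermx (basis_mx U *m (basis_mx U)^T))%MS.
  exact: row_sub.
have /eqP : v *m basis_mx U == 0.
  by rewrite -dotv_eq0 /dotv trmx_mul !mulmxA -(mulmxA v) vG mul0mx mxE.
rewrite basis_mxE => vB0.
have /freeP/(_ _ vB0) v0 := basis_free (vbasisP U).
by apply/rowP => j; rewrite v0 mxE.
Qed.

Lemma orth_proj_id x : x \in U -> x *m orth_proj U = x.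
Proof.
move=> /coord_vbasis ->; rewrite -[X in X *m _]/(\sum_i _).
have -> : \sum_i coord (vbasis U) i x *: (vbasis U)`_i =
    (\row_i coord (vbasis U) i x) *m basis_mx U.
  by rewrite basis_mxE; apply: eq_bigr => i _; rewrite mxE.
by rewrite /orth_proj !mulmxA -(mulmxA _ (basis_mx U)) mulmxK ?gram_unit.
Qed.

Lemma orth_proj_orth x :
  (forall u, u \in U -> dotv x u = 0) -> x *m orth_proj U = 0.
Proof.
move=> xU; rewrite /orth_proj !mulmxA.
suff -> : x *m (basis_mx U)^T = 0 by rewrite !mul0mx.
apply/rowP => i; rewrite mxE [RHS]mxE.
rewrite -[RHS](xU _ (vbasis_mem (mem_tnth i (vbasis U)))) /dotv mxE.
by apply: eq_bigr => l _; rewrite !mxE.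
Qed.

End orth_proj_correct.

(* On each G_{n+1,d+1} the initial topology of U |-> orth_proj U is the usual
   topology of the Grassmannian. *)
HB.instance Definition _ R n := Choice.on (subspaces R n).
HB.instance Definition _ R n := isPointed.Build (subspaces R n) 0%VS.
HB.instance Definition _ R n :=
  Topological.copy (subspaces R n) (initial_topology (@orth_proj R n)).

Definition borel_subspaces (R : realType) (n : nat) :=
  g_sigma_algebraType (@open (subspaces R n)).

Definition Grass (R : realType) (n d : nat) : set (subspaces R n) :=
  [set U | \dim U = d.+1].
Arguments Grass : clear implicits.

Definition north_pole {R : realType} {n} : 'rV[R]_n.+1 := delta_mx 0 ord_max.

Definition sphere (R : realType) (n : nat) : set 'rV[R]_n.+1 :=
  [set x | dotv x x = 1].
Arguments sphere : clear implicits.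

Definition geodist {R : realType} {n} (x y : 'rV[R]_n.+1) : R :=
  acos (dotv x y).

(* |U| *)
Definition pole_dist {R : realType} {n} (U : subspaces R n) : R :=
  inf [set geodist north_pole x | x in sphere R n `&` [set x | x \in U]].

Definition Grass_tilde (R : realType) (n d : nat) : set (subspaces R n) :=
  [set U | Grass R n d U /\ 0 < pole_dist U < pi / 2].
Arguments Grass_tilde : clear implicits.

Definition orthogonal_mx {R : realType} {m} (g : 'M[R]_m) : Prop :=
  g *m g^T = 1%:M.

Definition rotate {R : realType} {n} (g : 'M[R]_n.+1) (U : subspaces R n) :
    subspaces R n :=
  (linfun (mulmxr g) @: U)%VS.

(* S is a set of subspaces on which the stabilizer of U in O(n+1) acts
   transitively (in the uses below: the subspaces of given dimension contained
   in, resp. containing, U), so that this determines mu uniquely. *)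
Definition invariant_probability {R : realType} {n} (U : subspaces R n)
    (S : set (subspaces R n)) (mu : probability (borel_subspaces R n) R) :
    Prop :=
  mu S = 1%E /\
  forall g : 'M[R]_n.+1, orthogonal_mx g -> rotate g U = U ->
    forall A : set (borel_subspaces R n), measurable A ->
      mu (rotate g @^-1` A) = mu A.

Definition subspaces_in {R : realType} {n} (j : nat) (zeta : subspaces R n) :
    set (subspaces R n) :=
  [set tau | Grass R n j tau /\ (tau <= zeta)%VS].

Definition subspaces_above {R : realType} {n} (k : nat) (tau : subspaces R n) :
    set (subspaces R n) :=
  [set zeta | Grass R n k zeta /\ (tau <= zeta)%VS].

Definition cintegral {R : realType} {n}
    (mu : probability (borel_subspaces R n) R) (D : set (subspaces R n))
    (f : subspaces R n -> R[i]) : R[i] :=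
  (\int[mu]_(x in D) complex.Re (f x)) +i* (\int[mu]_(x in D) complex.Im (f x)).

(* mu zeta is the invariant probability measure on the (j+1)-dimensional
   subspaces of zeta. F is only meaningful on Grass_tilde, which has full
   measure in subspaces_in j zeta when zeta is in Grass_tilde R n k, whence the
   restriction of the domain. *)
Definition Radon {R : realType} {n} (j : nat)
    (mu : subspaces R n -> probability (borel_subspaces R n) R)
    (F : subspaces R n -> R[i]) (zeta : subspaces R n) : R[i] :=
  cintegral (mu zeta) (subspaces_in j zeta `&` Grass_tilde R n j) F.

Definition dual_Radon {R : realType} {n} (k : nat)
    (nu : subspaces R n -> probability (borel_subspaces R n) R)
    (Phi : subspaces R n -> R[i]) (tau : subspaces R n) : R[i] :=
  cintegral (nu tau) (subspaces_above k tau `&` Grass_tilde R n k) Phi.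

(* Main.v *)
(* Put a = j + 1 and b = k + 1. Orthogonal complements exchange the two transforms and turn
   (ii) into (i), so let a <= b and a + b <= n. Given tau with |tau| > omega, choose b
   orthonormal vectors orthogonal to tau and to the pole; together with tau they span a
   subspace W of dimension a + b, all of whose subspaces zeta satisfy |zeta| >= |tau|. So F has
   vanishing means on the b-planes in W that are not orthogonal to the pole, and this forces
   F tau = 0, by induction on a, as follows.

   Split off a unit vector v, not orthogonal to the pole, from an orthonormal frame of tau. In a
   (1+b)-plane containing v, let t be the squared length of the projection of v to an a-plane,
   and let w be a unit normal of a b-plane. The weight (w, v)^(2m) can be put into the vanishing
   means of F, and averages to c (1 - t)^m with c > 0; so all moments of t against F vanish.
   The weights t^m concentrate on the a-planes containing v, so the mean of F over these
   vanishes as well. This is the hypothesis for a - 1 in the orthogonal complement of v in W.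

   F may be singular where cos |tau| = 0. There it is cut off, with an error controlled by the
   mean of (cos |tau|)^(-2s), which is finite for 2s < a, whence the condition p < j + 1. *)

Require Import Defs.
From HB Require Import structures.
From mathcomp Require Import all_boot all_order all_algebra.
From mathcomp Require Import all_classical all_reals all_analysis.
From mathcomp Require Import measurable_realfun complex ring lra zify.

Set Implicit Arguments.
Unset Strict Implicit.
Unset Printing Implicit Defensive.

Import Order.TTheory GRing.Theory Num.Theory.
Import numFieldNormedType.Exports.

Local Open Scope classical_set_scope.
Local Open Scope ring_scope.

(** * Matrices with orthonormal rows *)

(** The measures [mu] and [nu] are known only through their invariance, so means are expressed by
    the Haar mean of an orthogonal group: a plane is the row space of a frame, and the mean over the
    planes in the row space of [U] becomes [mean (fun h => f (Y *m h *m U))] with a fixed frame [Y].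
    The Haar mean is needed only for continuous functions, with invariance, positivity and the
    exchange of two means; it is built from finite nets. [Rintegral_fiber] compares it with the
    given measures.

    The obstacle is the singularity: truncations of [F] are continuous, but their means over
    b-planes are merely small. So the first splitting of v is carried out for a sequence of
    truncations, whose moments tend to 0 for each fixed m. As v is not orthogonal to the pole,
    planes that nearly contain v stay away from the singularity and eventually see no truncation.
    The means over planes containing v therefore vanish exactly, and the rest of the induction,
    [means_determine], concerns a single continuous function. *)

Section frobenius.
Variable R : realType.

Definition frob2 {m n} (A : 'M[R]_(m, n)) : R := \tr (A *m A^T).

Lemma frob2E m n (A : 'M[R]_(m, n)) : frob2 A = \sum_i \sum_j A i j ^+ 2.
Proof.
rewrite /frob2 /mxtrace; apply: eq_bigr => i _; rewrite !mxE.
by apply: eq_bigr => j _; rewrite !mxE expr2.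
Qed.

Lemma frob2_ge0 m n (A : 'M[R]_(m, n)) : 0 <= frob2 A.
Proof. by rewrite frob2E; do 2![apply: sumr_ge0 => ? _]; rewrite sqr_ge0. Qed.

Lemma frob2_tr m n (A : 'M[R]_(m, n)) : frob2 A^T = frob2 A.
Proof.
by rewrite !frob2E exchange_big; do 2![apply: eq_bigr => ? _]; rewrite mxE.
Qed.

Lemma frob2N m n (A : 'M[R]_(m, n)) : frob2 (- A) = frob2 A.
Proof. by rewrite !frob2E; do 2![apply: eq_bigr => ? _]; rewrite mxE sqrrN. Qed.

Lemma frob2Z m n c (A : 'M[R]_(m, n)) : frob2 (c *: A) = c ^+ 2 * frob2 A.
Proof.
rewrite !frob2E mulr_sumr; apply: eq_bigr => i _; rewrite mulr_sumr.
by apply: eq_bigr => j _; rewrite mxE exprMn.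
Qed.

Lemma frob2_eq0 m n (A : 'M[R]_(m, n)) : frob2 A = 0 -> A = 0.
Proof.
rewrite frob2E => /eqP; rewrite psumr_eq0 => [/allP A0|i _]; last first.
  by apply: sumr_ge0 => j _; rewrite sqr_ge0.
apply/matrixP => i j; have := A0 i (mem_index_enum i).
rewrite psumr_eq0 => [/allP/(_ j (mem_index_enum j))|k _]; last exact: sqr_ge0.
by rewrite sqrf_eq0 mxE => /eqP.
Qed.

Lemma frob2_0 m n : frob2 (0 : 'M[R]_(m, n)) = 0.
Proof. by rewrite /frob2 mul0mx mxtrace0. Qed.

Lemma frob2D m n (A B : 'M[R]_(m, n)) :
  frob2 (A + B) <= 2 * frob2 A + 2 * frob2 B.
Proof.
rewrite !frob2E !mulr_sumr -big_split; apply: ler_sum => i _ /=.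
rewrite !mulr_sumr -big_split; apply: ler_sum => j _ /=; rewrite mxE.
by have := sqr_ge0 (A i j - B i j); nra.
Qed.

(** Cauchy-Schwarz. The quadratic form [quad] at [c], [a] is the claimed inequality multiplied by
    [a]; the case [a = 0] is separate. *)
Lemma sqr_sum_le (I : finType) (x y : I -> R) :
  (\sum_i x i * y i) ^+ 2 <= (\sum_i x i ^+ 2) * (\sum_i y i ^+ 2).
Proof.
set a := \sum_i x i ^+ 2; set b := \sum_i y i ^+ 2; set c := \sum_i _ * _.
have a0 : 0 <= a by apply: sumr_ge0 => i _; exact: sqr_ge0.
have quad (s t : R) : 0 <= s ^+ 2 * a - 2 * (s * t) * c + t ^+ 2 * b.
  rewrite [leRHS](_ : _ = \sum_i (s * x i - t * y i) ^+ 2).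
    by apply: sumr_ge0 => i _; exact: sqr_ge0.
  rewrite !mulr_sumr -sumrN -!big_split; apply: eq_bigr => i _ /=; ring.
have [a_eq0|/eqP an0] := eqVneq a 0.
  have x0 i : x i = 0.
    move/eqP: a_eq0; rewrite psumr_eq0 => [/allP/(_ i (mem_index_enum i))|? _].
      by rewrite sqrf_eq0 => /eqP.
    exact: sqr_ge0.
  by rewrite /c big1 ?a_eq0 ?mul0r ?expr0n// => i _; rewrite x0 mul0r.
have a_gt0 : 0 < a by rewrite lt_neqAle eq_sym a0 andbT; apply/eqP.
have : 0 <= a * (a * b - c ^+ 2).
  by have := quad c a; rewrite (_ : _ + _ = a * (a * b - c ^+ 2)) //; ring.
by rewrite pmulr_rge0// subr_ge0.
Qed.

Lemma frob2M m n p (A : 'M[R]_(m, n)) (B : 'M[R]_(n, p)) :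
  frob2 (A *m B) <= frob2 A * frob2 B.
Proof.
rewrite -(frob2_tr B) !frob2E mulr_suml; apply: ler_sum => i _.
rewrite mulr_sumr; apply: ler_sum => j _; rewrite mxE.
under [X in _ <= _ * X]eq_bigr do rewrite mxE.
exact: sqr_sum_le.
Qed.

Lemma sqr_entry_le m n (A : 'M[R]_(m, n)) i j : A i j ^+ 2 <= frob2 A.
Proof.
rewrite frob2E (bigD1 i)//= (bigD1 j)//= -addrA lerDl addr_ge0//.
  by apply: sumr_ge0 => ? _; exact: sqr_ge0.
by do 2![apply: sumr_ge0 => ? _]; exact: sqr_ge0.
Qed.

(** Orthonormal frames of [m] row vectors; for square matrices, the orthogonal group. *)
Definition stiefel {m n} (X : 'M[R]_(m, n)) : Prop := X *m X^T = 1%:M.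

Lemma stiefel_trl n (g : 'M[R]_n) : stiefel g -> g^T *m g = 1%:M.
Proof. exact: mulmx1C. Qed.

Lemma stiefel_tr n (g : 'M[R]_n) : stiefel g -> stiefel g^T.
Proof. by move=> /stiefel_trl; rewrite /stiefel trmxK. Qed.

Lemma stiefelM m n p (X : 'M[R]_(m, n)) (Y : 'M[R]_(n, p)) :
  stiefel X -> stiefel Y -> stiefel (X *m Y).
Proof.
by rewrite /stiefel => X1 Y1; rewrite trmx_mul mulmxA -(mulmxA X) Y1 mulmx1.
Qed.

Lemma stiefel1 n : stiefel (1%:M : 'M[R]_n).
Proof. by rewrite /stiefel trmx1 mulmx1. Qed.

Lemma frob2_stiefelr m n p (A : 'M[R]_(m, n)) (X : 'M[R]_(n, p)) :
  stiefel X -> frob2 (A *m X) = frob2 A.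
Proof. by move=> X1; rewrite /frob2 trmx_mul mulmxA -(mulmxA A) X1 mulmx1. Qed.

Lemma frob2_orthl m n (g : 'M[R]_m) (A : 'M[R]_(m, n)) :
  stiefel g -> frob2 (g *m A) = frob2 A.
Proof.
move=> g1; rewrite -frob2_tr trmx_mul frob2_stiefelr ?frob2_tr//.
exact: stiefel_tr.
Qed.

Lemma frob2_stiefel m n (X : 'M[R]_(m, n)) : stiefel X -> frob2 X = m%:R.
Proof. by rewrite /frob2 => ->; rewrite mxtrace1. Qed.

Lemma frob2_subC m n (A B : 'M[R]_(m, n)) : frob2 (A - B) = frob2 (B - A).
Proof. by rewrite -frob2N opprB. Qed.

Lemma frob2_tri m n (B A C : 'M[R]_(m, n)) :
  frob2 (A - C) <= 2 * frob2 (A - B) + 2 * frob2 (B - C).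
Proof. by rewrite -(subrKA B A (- C)) frob2D. Qed.

Lemma frob2_subMl m n p (A : 'M[R]_(m, n)) (B C : 'M[R]_(n, p)) :
  frob2 (A *m B - A *m C) <= frob2 A * frob2 (B - C).
Proof. by rewrite -mulmxBr frob2M. Qed.

Lemma frob2_subMr m n p (A : 'M[R]_(n, p)) (B C : 'M[R]_(m, n)) :
  frob2 (B *m A - C *m A) <= frob2 (B - C) * frob2 A.
Proof. by rewrite -mulmxBl frob2M. Qed.

Lemma stiefel_limit m n (X : 'M[R]_(m, n)) :
  (forall r, 0 < r -> exists2 Y, stiefel Y & frob2 (X - Y) < r) -> stiefel X.
Proof.
move=> h; apply/eqP; rewrite -subr_eq0; apply/eqP/frob2_eq0/eqP.
rewrite eq_le frob2_ge0 andbT; apply/ler_addgt0Pr => e e0; rewrite add0r.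
pose K := 2 * frob2 X + 2 * m%:R + 1.
have K0 : 0 < K by rewrite ltr_wpDl// addr_ge0// mulr_ge0// frob2_ge0.
have [|Y Y1 XY] := h (e / K); first by rewrite divr_gt0.
have -> : X *m X^T - 1%:M = X *m (X - Y)^T + (X - Y) *m Y^T.
  by rewrite -Y1 linearB/= mulmxBr mulmxBl addrA subrK.
apply: le_trans (frob2D _ _) _.
have := frob2M X (X - Y)^T; have := frob2M (X - Y) Y^T.
rewrite !frob2_tr (frob2_stiefel Y1) => h1 h2.
move: XY; rewrite ltr_pdivlMr// /K => XY.
by have := frob2_ge0 (X - Y); nra.
Qed.

End frobenius.

(** * Comparing sums through superlevel counts *)

Section counting.
Variable R : realType.
Implicit Types u w : seq R.

Lemma exists_max u : u != [::] -> exists2 x, x \in u & forall y, y \in u -> y <= x.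
Proof.
elim: u => // a [|b u] IH _; first by exists a => [|y]; rewrite inE // => /eqP ->.
have [//|x xu xmax] := IH.
have [ax|xa] := leP a x.
  by exists x => [|y]; rewrite inE ?xu ?orbT// => /orP[/eqP ->|/xmax].
exists a => [|y]; rewrite inE ?eqxx// => /orP[/eqP -> //|/xmax yx].
exact: le_trans yx (ltW xa).
Qed.

(** Remove the largest entry of each sequence: the counts force the two maxima to be ordered, and
    after the removal nothing remains in [u] above its old maximum, so the hypothesis survives. *)
Lemma le_sum_count u w : size u = size w ->
  (forall c, (count (>= c) u <= count (>= c) w)%N) ->
  \sum_(x <- u) x <= \sum_(x <- w) x.
Proof.
elim: {u}(size u) {-2}u (erefl (size u)) w => [|n IH] u un w uw cnt.
  by move: un uw => /size0nil -> /esym /size0nil ->.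
have [|x xu xmax] := @exists_max u; first by case: u un {uw cnt}.
have [|y yw ymax] := @exists_max w; first by case: w uw {cnt}; rewrite un.
have xy : x <= y.
  have : (0 < count (>= x) w)%N.
    by apply: leq_trans (cnt x); rewrite -has_count; apply/hasP; exists x => /=.
  rewrite -has_count => /hasP[z zw /= xz].
  exact: le_trans xz (ymax _ zw).
rewrite (big_rem x)//= [leRHS](big_rem y)//=; apply: lerD => //.
apply: IH; first by rewrite size_rem// un.
  by rewrite !size_rem// uw.
move=> c; have [cx|xc] := leP c x.
  have := cnt c; rewrite (permP (perm_to_rem xu)) (permP (perm_to_rem yw)) /=.
  by rewrite cx (le_trans cx xy).
rewrite (_ : count _ _ = 0)%N//; apply/eqP; rewrite -leqn0 leqNgt -has_count.
apply/hasPn => z /mem_rem /xmax zx /=; rewrite -ltNge.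
exact: le_lt_trans xc.
Qed.

End counting.

(** * The Haar mean on the orthogonal group *)

Section nets.
Variables (R : realType) (q : nat).
Implicit Types (X Y : seq 'M[R]_q) (psi : 'M[R]_q -> R).

(** [frob2] is a squared norm, so [d] is the square of a radius. Two points within [d] of a third
    one are within [4 * d] of each other by [frob2_tri]; hence the factors 4 below. *)
Definition is_net d X :=
  (forall x, x \in X -> stiefel x) /\
  forall g, stiefel g -> exists2 x, x \in X & frob2 (g - x) < d.

(* Minimality gives Hall's condition between two nets of the same size: a part of the
   minimal one has at least as many neighbours in the other. Comparing superlevel sets, the
   two averages nearly agree; translates of a minimal net being minimal, the limit of the
   averages over finer and finer minimal nets is the Haar mean. *)
Definition min_net d X := is_net d X /\ forall Y, is_net d Y -> (size X <= size Y)%N.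

Definition osc_le d eta psi := forall g h, stiefel g -> stiefel h ->
  frob2 (g - h) < d -> `|psi g - psi h| <= eta.

Definition ucont psi := forall eta, 0 < eta -> exists2 d, 0 < d & osc_le d eta psi.

(** Entries of orthogonal matrices lie in [-1, 1]. This interval is cut into cells of length 1 /
    [K], and one orthogonal matrix is kept for each occupied cell; two matrices in the same cell are
    at squared distance at most q ^ 2 / K ^ 2 < d. On empty cells [rep] takes the identity, so that
    it is always orthogonal. *)
Lemma net_exists d : 0 < d -> exists X, is_net d X.
Proof.
move=> d0; pose K := (Num.truncn ((q * q)%:R / d)).+1.
have K0 : 0 < K%:R :> R by rewrite ltr0n.
have dK : (q * q)%:R < d * K%:R ^+ 2.
  have : (q * q)%:R / d < K%:R by rewrite truncnS_gt.
  rewrite ltr_pdivrMr// mulrC => /lt_le_trans; apply; rewrite ler_pM2l//.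
  by rewrite expr2 ler_peMl// ler1n.
pose cell (g : 'M[R]_q) : 'M['I_(2 * K).+1]_q :=
  \matrix_(i, j) inord (Num.truncn ((g i j + 1) * K%:R)).
pose rep c := if pselect (exists g, stiefel g /\ cell g = c) is left e
  then projT1 (cid e) else 1%:M.
have repO c : stiefel (rep c).
  rewrite /rep; case: pselect => [e|_]; last exact: stiefel1.
  by case: (cid e) => g [].
exists [seq rep c | c : 'M['I_(2 * K).+1]_q]; split => [x /mapP[c _ ->] //|g g1].
exists (rep (cell g)); first by apply/map_f; rewrite mem_enum.
have : cell (rep (cell g)) = cell g.
  rewrite /rep; case: pselect => [e|/(_ (ex_intro _ g (conj g1 erefl)))//].
  by case: (cid e) => h [].
have h1 := repO (cell g); move: (rep (cell g)) h1 => h h1 hg.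
rewrite frob2E; suff close i j : (g - h) i j ^+ 2 <= (K%:R ^+ 2)^-1.
  apply: (@le_lt_trans _ _ (\sum_(i < q) \sum_(j < q) (K%:R ^+ 2)^-1)).
    by do 2![apply: ler_sum => ? _].
  rewrite !sumr_const !card_ord -mulrnA -[_ *+ _]mulr_natl ltr_pdivrMr//.
  by rewrite exprn_gt0.
have bnd (k : 'M[R]_q) : stiefel k -> -1 <= k i j <= 1.
  move=> k1; have : k i j ^+ 2 <= 1.
    have -> : 1 = (k *m k^T) i i by rewrite k1 mxE eqxx.
    rewrite mxE (bigD1 j)//= mxE -expr2 lerDl sumr_ge0// => l _.
    by rewrite mxE -expr2 sqr_ge0.
  by move=> kij; apply/andP; split; nra.
have cl k : stiefel k -> [/\ 0 <= (k i j + 1) * K%:R, (Num.truncn ((k i j + 1) * K%:R) < (2 * K).+1)%N & cell k i j = Num.truncn ((k i j + 1) * K%:R) :> nat].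
  move=> /bnd /andP[k1 k2]; have k0 : 0 <= (k i j + 1) * K%:R by rewrite mulr_ge0// -lerBlDr sub0r.
  have kl : (Num.truncn ((k i j + 1) * K%:R) < (2 * K).+1)%N.
    by rewrite ltnS -(ler_nat R) (@le_trans _ _ ((k i j + 1) * K%:R)) ?truncn_le// natrM ler_wpM2r//; lra.
  by split => //; rewrite mxE inordK.
have [g0 _ gE] := cl g g1; have [h0 _ hE] := cl h h1.
move: hE; rewrite hg gE => tE.
have /andP[] := truncn_itv g0; have /andP[] := truncn_itv h0; rewrite -tE -natr1.
move: (Num.truncn _)%:R => t; rewrite !mxE => a1 a2 a3 a4.
rewrite -[leRHS]mul1r ler_pdivlMr ?exprn_gt0// -exprMn.
by rewrite mulrBl; nra.
Qed.

Lemma min_net_exists d : 0 < d -> exists X, min_net d X.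
Proof.
move=> /net_exists[X0 netX0].
have ex : exists n, `[< exists2 X, is_net d X & size X = n >].
  by exists (size X0); apply/asboolP; exists X0.
case: (ex_minnP ex) => n /asboolP[X netX Xn] nmin; exists X; split => // Y netY.
by rewrite Xn nmin//; apply/asboolP; exists Y.
Qed.

Definition net n : seq 'M[R]_q := xget [::] [set X | min_net n.+1%:R^-1 X].

Lemma netP n : min_net n.+1%:R^-1 (net n).
Proof. by apply: (@xgetPex _ _ [set X | min_net n.+1%:R^-1 X]); exact: min_net_exists. Qed.

Definition avg X psi := (size X)%:R^-1 * \sum_(x <- X) psi x.

Lemma net_size_gt0 d X : is_net d X -> 0 < (size X)%:R :> R.
Proof.
move=> [_ /(_ _ (stiefel1 _ _))[x xX _]]; rewrite ltr0n.
by case: X xX.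
Qed.

Lemma avg_cmp X Y psi d eta : min_net d X -> is_net d Y -> size Y = size X ->
  osc_le (4 * d) eta psi -> avg X psi <= avg Y psi + eta.
Proof.
move=> [netX Xmin] netY YX osc.
have nX := net_size_gt0 netX; have X0 := lt0r_neq0 nX.
suff : \sum_(x <- X) psi x <= \sum_(y <- Y) (psi y + eta).
  rewrite big_split/= /avg YX big_const_seq count_predT iter_addr_0 YX => h.
  rewrite -(ler_pM2l nX) mulrDr !mulVKf//.
  by rewrite mulr_natl.
rewrite -(big_map psi xpredT id) -(big_map (fun y => psi y + eta) xpredT id).
apply: le_sum_count; first by rewrite !size_map.
move=> c; rewrite !count_map.
set I := count _ X; set J := count _ Y.
(* In [X], the points where [psi] is at least [c] are exchanged for the points of [Y] where
   [psi + eta] is. The result is still a net, so minimality of [X] bounds the number of points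
   removed by the number of points added. *)
pose Z := [seq x <- X | ~~ (c <= psi x)] ++ [seq y <- Y | c <= psi y + eta].
have netZ : is_net d Z.
  split=> [z|g g1].
    rewrite mem_cat !mem_filter => /orP[/andP[_]|/andP[_]]; first exact: netX.1.
    exact: netY.1.
  have [x xX gx] := netX.2 g g1; have [cx|cx] := boolP (c <= psi x); last first.
    by exists x => //; rewrite mem_cat mem_filter cx xX.
  have [y yY gy] := netY.2 g g1; exists y => //.
  rewrite mem_cat [X in _ || X]mem_filter yY andbT; apply/orP; right.
  have x1 := netX.1 x xX; have y1 := netY.1 y yY.
  have : `|psi x - psi y| <= eta.
    apply: osc => //; have := frob2_tri g x y; rewrite (frob2_subC x g).
    by move: gx gy; lra.
  by rewrite ler_norml => /andP[_]; move: cx; lra.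
have := Xmin _ netZ; rewrite size_cat !size_filter -(count_predC (fun x => c <= psi x) X).
by rewrite addnC leq_add2l.
Qed.

Lemma net_mull d X g : stiefel g -> is_net d X -> is_net d [seq g *m x | x <- X].
Proof.
move=> g1 [X1 netX]; split=> [_ /mapP[x /X1 x1 ->]|h h1]; first exact: stiefelM.
have [x xX hx] := netX (g^T *m h) (stiefelM (stiefel_tr g1) h1).
exists (g *m x); first exact: map_f.
by rewrite -(frob2_orthl _ (stiefel_tr g1)) mulmxBr (mulmxA _ g) stiefel_trl// mul1mx.
Qed.

Lemma net_mulr d X g : stiefel g -> is_net d X -> is_net d [seq x *m g | x <- X].
Proof.
move=> g1 [X1 netX]; split=> [_ /mapP[x /X1 x1 ->]|h h1]; first exact: stiefelM.
have [x xX hx] := netX (h *m g^T) (stiefelM h1 (stiefel_tr g1)).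
exists (x *m g); first exact: map_f.
by rewrite -(frob2_stiefelr _ (stiefel_tr g1)) mulmxBl -(mulmxA _ g) g1 mulmx1.
Qed.

(** Both [X] and its image are minimal nets of the same size, so [avg_cmp] applies in either
    direction. *)
Lemma avg_inv X psi d eta (phi : 'M[R]_q -> 'M[R]_q) : min_net d X ->
  is_net d [seq phi x | x <- X] -> osc_le (4 * d) eta psi ->
  `|avg X (psi \o phi) - avg X psi| <= eta.
Proof.
move=> Xmin netp osc; have sz : size [seq phi x | x <- X] = size X by rewrite size_map.
have -> : avg X (psi \o phi) = avg [seq phi x | x <- X] psi.
  by rewrite /avg size_map big_map.
have := avg_cmp Xmin netp sz osc.
have minp : min_net d [seq phi x | x <- X].
  by split=> // Y; rewrite sz; exact: Xmin.2.
have := avg_cmp minp Xmin.1 (esym sz) osc.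
by rewrite ler_norml; lra.
Qed.

Lemma eq_avg X psi phi : (forall x, x \in X -> psi x = phi x) -> avg X psi = avg X phi.
Proof. by move=> e; rewrite /avg; congr (_ * _); apply: eq_big_seq. Qed.

Lemma avg_le X psi phi : (forall x, x \in X -> psi x <= phi x) -> avg X psi <= avg X phi.
Proof.
move=> e; rewrite /avg; apply: ler_wpM2l; first by rewrite invr_ge0.
by rewrite big_seq [leRHS]big_seq; apply: ler_sum.
Qed.

Lemma avg_cst d X c : is_net d X -> avg X (fun=> c) = c.
Proof.
move=> /net_size_gt0 /lt0r_neq0 X0.
by rewrite /avg big_const_seq count_predT iter_addr_0 -[c *+ _]mulr_natl mulKf.
Qed.

Lemma avgD X psi phi : avg X (fun x => psi x + phi x) = avg X psi + avg X phi.
Proof. by rewrite /avg big_split mulrDr. Qed.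

Lemma avgZ X c psi : avg X (fun x => c * psi x) = c * avg X psi.
Proof. by rewrite /avg -mulr_sumr mulrCA. Qed.

Lemma avg_norm X psi : `|avg X psi| <= avg X (fun x => `|psi x|).
Proof.
rewrite /avg normrM ger0_norm ?invr_ge0//; apply: ler_wpM2l; first by rewrite invr_ge0.
exact: ler_norm_sum.
Qed.

Lemma avg_close d X psi c eta : is_net d X ->
  (forall x, x \in X -> `|psi x - c| <= eta) -> `|avg X psi - c| <= eta.
Proof.
move=> netX h; have -> : avg X psi - c = avg X (fun x => psi x - c).
  by rewrite avgD (avg_cst _ netX).
by apply: le_trans (avg_norm _ _) _; rewrite -[leRHS](avg_cst _ netX); exact: avg_le.
Qed.

Lemma avg_exchange X Y (f : 'M[R]_q -> 'M[R]_q -> R) :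
  avg X (fun x => avg Y (f x)) = avg Y (fun y => avg X (f ^~ y)).
Proof.
rewrite /avg -!mulr_sumr mulrCA; congr (_ * (_ * _)); exact: exchange_big.
Qed.

(** Both averages are compared with the average of [psi] over the products [x *m y]: for fixed [x]
    these run through a left translate of [Y], for fixed [y] through a right translate of [X]. *)
Lemma avg_cauchy X Y d d' psi eta eta' : min_net d X -> min_net d' Y ->
  osc_le (4 * d) eta psi -> osc_le (4 * d') eta' psi ->
  `|avg X psi - avg Y psi| <= eta + eta'.
Proof.
move=> Xm Ym oX oY; set c := avg X (fun x => avg Y (fun y => psi (x *m y))).
have c1 : `|c - avg Y psi| <= eta'.
  apply: (avg_close Xm.1) => x xX; apply: (@avg_inv _ _ _ _ (mulmx x) Ym) => //.
  by apply: net_mull Ym.1; exact: Xm.1.1.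
have c2 : `|c - avg X psi| <= eta.
  rewrite /c avg_exchange.
  apply: (avg_close Ym.1) => x xX; apply: (@avg_inv _ _ _ _ (mulmxr x) Xm) => //.
  by apply: net_mulr Xm.1; exact: Ym.1.1.
by move: c1 c2; rewrite !ler_norml; lra.
Qed.

(* Junk unless psi is uniformly continuous on the orthogonal group. *)
Definition mean psi : R := lim (avg (net n) psi @[n --> \oo]).

Lemma net_osc psi eta d : 0 < d -> osc_le d eta psi ->
  \forall n \near \oo, osc_le (4 * n.+1%:R^-1) eta psi.
Proof.
move=> d0 osc.
have : \forall n \near \oo, n.+1%:R^-1 < d / 4 :> R.
  near=> n; rewrite invf_plt ?posrE ?divr_gt0//.
  apply: (@le_lt_trans _ _ n%:R); last by rewrite ltr_nat.
  by near: n; exact: nbhs_infty_ger.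
apply: filterS => n nd g h g1 h1 gh; apply: osc => //.
by apply: lt_trans gh _; rewrite mulrC -ltr_pdivlMr.
Unshelve. all: by end_near. Qed.

Lemma mean_cvg psi : ucont psi -> avg (net n) psi @[n --> \oo] --> mean psi.
Proof.
move=> uc; apply/cvg_ex => /=.
suff : cauchy (avg (net n) psi @[n --> \oo]) by move=> /cauchy_cvgP/cvg_ex.
apply: cauchy_exP => e e0; have e4 : 0 < e / 4 by rewrite divr_gt0.
have [d d0 osc] := uc _ e4; have [N _ oN] := net_osc d0 osc.
exists (avg (net N) psi); exists N => // n /= Nn; rewrite /ball/=.
apply: le_lt_trans (avg_cauchy (netP N) (netP n) (oN _ (leqnn _)) (oN _ Nn)) _.
by lra.
Qed.

(** One finite net serves all functions with the same modulus of continuity. This uniformity is what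
    allows a mean inside another mean, or inside an integral, to be replaced by a finite average. *)
Lemma mean_net d eta : 0 < d -> exists2 X, is_net d X &
  forall psi, ucont psi -> osc_le d eta psi -> `|avg X psi - mean psi| <= 2 * eta.
Proof.
move=> d0.
have [N Nd] : exists N, 4 * N.+1%:R^-1 < d.
  exists (Num.truncn (4 / d)); rewrite ltr_pdivrMr ?ltr0n// mulrC -ltr_pdivrMr//.
  by rewrite truncnS_gt.
exists (net N) => [|psi uc osc].
  have [h1 h2] := (netP N).1; split => // g /h2[x xX gx]; exists x => //.
  apply: lt_trans gx _; apply: le_lt_trans Nd.
  by rewrite ler_peMl// ler1n.
have osc' n : (N <= n)%N -> osc_le (4 * n.+1%:R^-1) eta psi.
  move=> Nn g h g1 h1 gh; apply: osc => //; apply: lt_le_trans gh _.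
  apply: le_trans (ltW Nd); rewrite ler_pM2l// lef_pV2 ?posrE//.
  by rewrite ler_nat.
have := mean_cvg uc; move/(cvgB (cvg_cst (avg (net N) psi)))/cvg_norm.
move=> /cvgr_to_le; apply; exists N => // n /= Nn.
have := avg_cauchy (netP N) (netP n) (osc' _ (leqnn _)) (osc' _ Nn).
by rewrite mulr2n mulrDl mul1r.
Qed.
End nets.

(** * Uniformly continuous functions on the orthogonal group *)

Section ucont.
Variables (R : realType).

Section closure.
Variable q : nat.
Implicit Types psi phi : 'M[R]_q -> R.

Lemma eq_ucont psi phi : (forall g, stiefel g -> psi g = phi g) -> ucont psi -> ucont phi.
Proof.
move=> e uc eta /uc[d d0 osc]; exists d => // g h g1 h1 gh.
by rewrite -!e//; exact: osc.
Qed.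

Lemma ucont_cst c : ucont (fun _ : 'M[R]_q => c).
Proof. by move=> eta eta0; exists 1 => // g h _ _ _; rewrite subrr normr0 ltW. Qed.

Lemma ucontD psi phi : ucont psi -> ucont phi -> ucont (fun g => psi g + phi g).
Proof.
move=> uc1 uc2 eta eta0; have e2 : 0 < eta / 2 by rewrite divr_gt0.
have [d1 d10 o1] := uc1 _ e2; have [d2 d20 o2] := uc2 _ e2.
exists (Num.min d1 d2) => [|g h g1 h1]; first by rewrite lt_min d10.
rewrite lt_min => /andP[gh1 gh2].
have := o1 g h g1 h1 gh1; have := o2 g h g1 h1 gh2.
by rewrite !ler_norml; lra.
Qed.

Lemma ucont_bounded psi : ucont psi ->
  exists2 M, 0 < M & forall g, stiefel g -> `|psi g| <= M.
Proof.
move=> /(_ _ ltr01)[d d0 osc]; have [X [X1 netX]] := net_exists q d0.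
exists (1 + \sum_(x <- X) `|psi x|) => [|g g1].
  by rewrite ltr_wpDr// sumr_ge0.
have [x xX gx] := netX g g1; have := osc g x g1 (X1 _ xX) gx.
have : `|psi x| <= \sum_(x <- X) `|psi x|.
  by rewrite (big_rem x)//= lerDl sumr_ge0.
have := ler_normD (psi g - psi x) (psi x); rewrite subrK; lra.
Qed.

Lemma ucontM psi phi : ucont psi -> ucont phi -> ucont (fun g => psi g * phi g).
Proof.
move=> uc1 uc2 eta eta0.
have [M M0 bM] := ucont_bounded uc1; have [K K0 bK] := ucont_bounded uc2.
have e1 : 0 < eta / (2 * K) by rewrite divr_gt0// mulr_gt0.
have e2 : 0 < eta / (2 * M) by rewrite divr_gt0// mulr_gt0.
have [d1 d10 o1] := uc1 _ e1; have [d2 d20 o2] := uc2 _ e2.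
exists (Num.min d1 d2) => [|g h g1 h1]; first by rewrite lt_min d10.
rewrite lt_min => /andP[gh1 gh2].
have := o1 g h g1 h1 gh1; have := o2 g h g1 h1 gh2 => b2 b1.
have -> : psi g * phi g - psi h * phi h =
  (psi g - psi h) * phi g + psi h * (phi g - phi h) by ring.
apply: le_trans (ler_normD _ _) _; rewrite !normrM.
have -> : eta = eta / (2 * K) * K + M * (eta / (2 * M)).
  by field; rewrite !gt_eqF.
by apply: lerD; apply: ler_pM => //; [exact: bK | exact: bM].
Qed.

Lemma ucontZ c psi : ucont psi -> ucont (fun g => c * psi g).
Proof. by move=> uc; apply: ucontM => //; exact: ucont_cst. Qed.

Lemma ucontN psi : ucont psi -> ucont (fun g => - psi g).
Proof.
move=> /(ucontZ (-1)); apply: eq_ucont => g _; exact: mulN1r.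
Qed.

Lemma ucontB psi phi : ucont psi -> ucont phi -> ucont (fun g => psi g - phi g).
Proof. by move=> uc1 uc2; apply: ucontD => //; exact: ucontN. Qed.

Lemma ucontX psi n : ucont psi -> ucont (fun g => psi g ^+ n).
Proof.
move=> uc; elim: n => [|n IH].
  by apply: (eq_ucont _ (ucont_cst 1)) => g _; rewrite expr0.
by apply: (eq_ucont _ (ucontM uc IH)) => g _; rewrite exprS.
Qed.

Lemma ucont_sum (I : eqType) (r : seq I) (F : I -> 'M[R]_q -> R) :
  (forall i, i \in r -> ucont (F i)) -> ucont (fun g => \sum_(i <- r) F i g).
Proof.
elim: r => [|i r IH] uc.
  by apply: (eq_ucont _ (ucont_cst 0)) => g _; rewrite big_nil.
have uci : ucont (F i) by apply: uc; rewrite mem_head.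
have ucr : ucont (fun g => \sum_(i <- r) F i g).
  by apply: IH => j jr; apply: uc; rewrite inE jr orbT.
by apply: (eq_ucont _ (ucontD uci ucr)) => g _; rewrite big_cons.
Qed.

Lemma ucont_comp (D : set R) (F : R -> R) psi : ucont psi ->
  (forall g, stiefel g -> D (psi g)) ->
  (forall eta, 0 < eta -> exists2 d, 0 < d &
     forall x y, D x -> D y -> `|x - y| <= d -> `|F x - F y| <= eta) ->
  ucont (fun g => F (psi g)).
Proof.
move=> uc Dpsi ucF eta /ucF[d d0 Fd]; have [d' d'0 osc] := uc _ d0.
by exists d' => // g h g1 h1 gh; apply: Fd; [exact: Dpsi | exact: Dpsi | exact: osc].
Qed.

Lemma ucont_norm psi : ucont psi -> ucont (fun g => `|psi g|).
Proof.
move=> uc; apply: (@ucont_comp setT) => // eta eta0; exists eta => // x y _ _.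
exact: le_trans (ler_dist_dist _ _).
Qed.

Lemma ucont_entry m n (A : 'M[R]_(m, q)) (B : 'M[R]_(q, n)) i j :
  ucont (fun g => (A *m g *m B) i j).
Proof.
move=> eta eta0; pose K := frob2 A * frob2 B + 1.
have K0 : 0 < K by rewrite ltr_wpDl// mulr_ge0// frob2_ge0.
exists (eta ^+ 2 / K) => [|g h g1 h1]; first by rewrite divr_gt0// exprn_gt0.
rewrite ltr_pdivlMr// => gh.
have : (A *m g *m B - A *m h *m B) i j ^+ 2 <= eta ^+ 2.
  apply: le_trans (sqr_entry_le _ _ _) _; apply: le_trans (frob2_subMr _ _ _) _.
  apply: le_trans (ler_wpM2r (frob2_ge0 _) (frob2_subMl _ _ _)) _.
  rewrite mulrAC mulrC; apply: le_trans (ltW gh); rewrite ler_wpM2l ?frob2_ge0//.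
  by rewrite /K lerDl.
rewrite !mxE -[X in X <= _]real_normK ?num_real// ler_pXn2r// nnegrE ?normr_ge0// ltW//.
Qed.

Lemma ucont_frob2 m n (A : 'M[R]_(m, q)) (B : 'M[R]_(q, n)) :
  ucont (fun g => frob2 (A *m g *m B)).
Proof.
apply: (@eq_ucont (fun g => \sum_i \sum_j (A *m g *m B) i j ^+ 2)).
  by move=> g _; rewrite frob2E.
by do 2![apply: ucont_sum => ? _]; apply: ucontX; exact: ucont_entry.
Qed.

End closure.

Lemma ucont_pre p q (P : 'M[R]_p -> 'M[R]_q) K psi : ucont psi ->
  (forall g, stiefel g -> stiefel (P g)) ->
  (forall g h, stiefel g -> stiefel h -> frob2 (P g - P h) <= K * frob2 (g - h)) ->
  ucont (fun g => psi (P g)).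
Proof.
move=> uc P1 PK eta /uc[d d0 osc]; pose K' := `|K| + 1.
have K0 : 0 < K' by rewrite ltr_wpDl.
exists (d / K') => [|g h g1 h1 gh]; first by rewrite divr_gt0.
apply: osc; [exact: P1 | exact: P1|]; apply: le_lt_trans (PK g h g1 h1) _.
move: gh; rewrite ltr_pdivlMr// => /(le_lt_trans _); apply.
rewrite mulrC ler_wpM2l ?frob2_ge0// /K'; have := ler_norm K; lra.
Qed.

Lemma ucont_mull q (k : 'M[R]_q) psi : stiefel k -> ucont psi ->
  ucont (fun g => psi (k *m g)).
Proof.
move=> k1 uc; apply: (@ucont_pre _ _ (fun g => k *m g) 1 psi uc) => [g g1|g h _ _].
  exact: stiefelM.
by rewrite -mulmxBr frob2_orthl ?mul1r.
Qed.

Lemma ucont_mulr q (k : 'M[R]_q) psi : stiefel k -> ucont psi ->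
  ucont (fun g => psi (g *m k)).
Proof.
move=> k1 uc; apply: (@ucont_pre _ _ (fun g => g *m k) 1 psi uc) => [g g1|g h _ _].
  exact: stiefelM.
by rewrite -mulmxBl frob2_stiefelr ?mul1r.
Qed.

End ucont.

(** * Linearity, positivity and invariance of the Haar mean *)

Section mean.
Variables (R : realType) (q : nat).
Implicit Types psi phi : 'M[R]_q -> R.

Lemma net_stiefel n x : x \in net R q n -> stiefel x.
Proof. exact: (netP R q n).1.1. Qed.

Lemma eq_mean psi phi : (forall g, stiefel g -> psi g = phi g) -> mean psi = mean phi.
Proof.
move=> e; rewrite /mean.
suff -> : (fun n => avg (net R q n) psi) = (fun n => avg (net R q n) phi) by [].
by apply/funext => n; apply: eq_avg => x /net_stiefel /e.
Qed.

Lemma mean_uniq psi c : ucont psi -> avg (net R q n) psi @[n --> \oo] --> c -> mean psi = c.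
Proof. by move=> /mean_cvg h1 h2; exact: cvg_unique h1 h2. Qed.

Lemma meanD psi phi : ucont psi -> ucont phi ->
  mean (fun g => psi g + phi g) = mean psi + mean phi.
Proof.
move=> uc1 uc2; apply: mean_uniq; first exact: ucontD.
under eq_fun do rewrite avgD.
by apply: cvgD; exact: mean_cvg.
Qed.

Lemma meanZ c psi : ucont psi -> mean (fun g => c * psi g) = c * mean psi.
Proof.
move=> uc; apply: mean_uniq; first exact: ucontZ.
under eq_fun do rewrite avgZ.
by apply: cvgMr; exact: mean_cvg.
Qed.

Lemma meanN psi : ucont psi -> mean (fun g => - psi g) = - mean psi.
Proof. by move=> uc; under eq_fun do rewrite -mulN1r; rewrite meanZ// mulN1r. Qed.

Lemma meanB psi phi : ucont psi -> ucont phi ->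
  mean (fun g => psi g - phi g) = mean psi - mean phi.
Proof. by move=> uc1 uc2; rewrite meanD ?meanN//; exact: ucontN. Qed.

Lemma mean_cst c : mean (fun _ : 'M[R]_q => c) = c.
Proof.
apply: mean_uniq; first exact: ucont_cst.
under eq_fun do rewrite (avg_cst _ (netP _ _ _).1).
exact: cvg_cst.
Qed.

Lemma mean_le psi phi : ucont psi -> ucont phi ->
  (forall g, stiefel g -> psi g <= phi g) -> mean psi <= mean phi.
Proof.
move=> uc1 uc2 h; apply: ler_cvg_to (mean_cvg uc1) (mean_cvg uc2) _.
by apply: nearW => n; apply: avg_le => x /net_stiefel /h.
Qed.

Lemma mean_ge0 psi : ucont psi -> (forall g, stiefel g -> 0 <= psi g) -> 0 <= mean psi.
Proof. by move=> uc h; rewrite -(mean_cst 0); apply: mean_le => //; exact: ucont_cst. Qed.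

Lemma mean_norm psi : ucont psi -> `|mean psi| <= mean (fun g => `|psi g|).
Proof.
move=> uc; rewrite ler_norml -meanN; last exact: ucont_norm.
apply/andP; split; apply: mean_le => //; rewrite ?ucontN//; try exact: ucont_norm.
- by apply: ucontN; exact: ucont_norm.
- by move=> g _; rewrite lerNl -normrN ler_norm.
- by move=> g _; rewrite ler_norm.
Qed.

Lemma mean_norm_le psi c : ucont psi -> (forall g, stiefel g -> `|psi g| <= c) ->
  `|mean psi| <= c.
Proof.
move=> uc h; apply: le_trans (mean_norm uc) _; rewrite -[leRHS]mean_cst.
by apply: mean_le => //; [exact: ucont_norm | exact: ucont_cst].
Qed.

Lemma mean_dist_le psi phi c : ucont psi -> ucont phi ->
  (forall g, stiefel g -> `|psi g - phi g| <= c) -> `|mean psi - mean phi| <= c.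
Proof. by move=> u1 u2 h; rewrite -meanB//; apply: mean_norm_le => //; exact: ucontB. Qed.

Lemma mean_sum (I : eqType) (r : seq I) (F : I -> 'M[R]_q -> R) :
  (forall i, i \in r -> ucont (F i)) ->
  mean (fun g => \sum_(i <- r) F i g) = \sum_(i <- r) mean (F i).
Proof.
elim: r => [|i r IH] uc.
  by under eq_fun do rewrite big_nil; rewrite mean_cst big_nil.
have ucr j : j \in r -> ucont (F j) by move=> jr; apply: uc; rewrite inE jr orbT.
under eq_fun do rewrite big_cons; rewrite meanD ?big_cons ?IH//.
  by apply: uc; rewrite mem_head.
exact: ucont_sum.
Qed.

Lemma mean_inv psi (P : 'M[R]_q -> 'M[R]_q) : ucont psi -> ucont (psi \o P) ->
  (forall d X, is_net d X -> is_net d [seq P x | x <- X]) ->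
  mean (psi \o P) = mean psi.
Proof.
move=> uc uc' netP'; apply/eqP; rewrite -subr_eq0 -normr_le0.
apply/ler_addgt0Pl => e e0; rewrite addr0; have [d d0 osc] := uc _ e0.
have [N _ oN] := net_osc d0 osc.
apply: (cvgr_to_le (cvg_norm (cvgB (mean_cvg uc') (mean_cvg uc)))).
exists N => // n /= Nn; apply: avg_inv (netP _ _ _) _ (oN _ Nn).
by apply: netP'; exact: (netP _ _ _).1.
Qed.

Lemma mean_mull k psi : stiefel k -> ucont psi -> mean (fun g => psi (k *m g)) = mean psi.
Proof.
move=> k1 uc; apply: (@mean_inv psi (fun g => k *m g)) => //; first exact: ucont_mull.
by move=> d X; exact: net_mull.
Qed.

Lemma mean_mulr k psi : stiefel k -> ucont psi -> mean (fun g => psi (g *m k)) = mean psi.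
Proof.
move=> k1 uc; apply: (@mean_inv psi (fun g => g *m k)) => //; first exact: ucont_mulr.
by move=> d X; exact: net_mulr.
Qed.

(** Near [g0] the function exceeds half of [psi g0]. Finitely many translates of this neighbourhood
    cover the group, so the sum of the corresponding translates of [psi] is bounded below, while all
    of them have the same mean. *)
Lemma mean_gt0 psi g0 : ucont psi -> (forall g, stiefel g -> 0 <= psi g) ->
  stiefel g0 -> 0 < psi g0 -> 0 < mean psi.
Proof.
move=> uc psi0 g01 p0; have e0 : 0 < psi g0 / 2 by rewrite divr_gt0.
have [d d0 osc] := uc _ e0; have [X [X1 netX]] := net_exists q d0.
have u1 x g : x \in X -> stiefel g -> stiefel (g0 *m x^T *m g).
  by move=> /X1 x1 g1; do !apply: stiefelM => //; exact: stiefel_tr.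
have ucx x : x \in X -> ucont (fun g => psi (g0 *m x^T *m g)).
  move=> xX; apply: ucont_mull => //; rewrite -(mulmx1 (_ *m _)).
  exact: u1 xX (stiefel1 _ _).
have : psi g0 / 2 <= mean (fun g => \sum_(x <- X) psi (g0 *m x^T *m g)).
  rewrite -[leLHS](mean_cst (psi g0 / 2)); apply: mean_le; first exact: ucont_cst.
    exact: ucont_sum.
  move=> g g1; have [x xX gx] := netX g g1.
  rewrite (big_rem x)//=.
  have : `|psi (g0 *m x^T *m g) - psi g0| <= psi g0 / 2.
    apply: osc => //; first exact: u1.
    rewrite -{2}(mulmx1 g0) -mulmxA -mulmxBr frob2_orthl//.
    by rewrite -(stiefel_trl (X1 _ xX)) -mulmxBr frob2_orthl//; exact/stiefel_tr/X1.
  have : 0 <= \sum_(y <- rem x X) psi (g0 *m y^T *m g).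
    by rewrite big_seq; apply: sumr_ge0 => y /mem_rem yX; apply/psi0/u1.
  by rewrite ler_norml; lra.
rewrite mean_sum// => h; rewrite ltNge; apply/negP => m0.
suff : \sum_(x <- X) mean (fun g => psi (g0 *m x^T *m g)) <= 0 by lra.
rewrite big_seq; apply: sumr_le0 => x xX; rewrite mean_mull//.
by rewrite -(mulmx1 (_ *m _)); exact: u1 xX (stiefel1 _ _).
Qed.

End mean.

(** * Iterated means and their exchange *)

Section exchange.
Variables (R : realType) (p q : nat).
Implicit Types f : 'M[R]_p -> 'M[R]_q -> R.

(** This amounts to joint uniform continuity, stated one variable at a time, as it is checked and
    used. *)
Definition jucont f := forall eta, 0 < eta -> exists2 d, 0 < d &
  (forall g, stiefel g -> osc_le d eta (f g)) /\
  (forall h, stiefel h -> osc_le d eta (f ^~ h)).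

Lemma jucont1 f g : jucont f -> stiefel g -> ucont (f g).
Proof. by move=> juc g1 eta /juc[d d0 [u1 _]]; exists d => //; exact: u1. Qed.

Lemma jucont2 f h : jucont f -> stiefel h -> ucont (f ^~ h).
Proof. by move=> juc g1 eta /juc[d d0 [_ u1]]; exists d => //; exact: u1. Qed.

Lemma jucont_bounded f : jucont f ->
  exists2 M, 0 < M & forall g h, stiefel g -> stiefel h -> `|f g h| <= M.
Proof.
move=> juc; have [d d0 [u1 u2]] := juc _ ltr01.
have [M M0 bM] := ucont_bounded (jucont1 juc (stiefel1 _ _)).
have [X [X1 netX]] := net_exists p d0.
have bX : forall s : seq 'M[R]_p, {subset s <= X} -> exists2 K, 0 < K &
    forall x h, x \in s -> stiefel h -> `|f x h| <= K.
  elim=> [|x s IH] sX; first by exists 1.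
  have [y ys|K K0 bK] := IH; first by apply: sX; rewrite inE ys orbT.
  have [L L0 bL] := ucont_bounded (jucont1 juc (X1 _ (sX x (mem_head _ _)))).
  exists (K + L) => [|y h]; first by rewrite addr_gt0.
  rewrite inE => /orP[/eqP -> h1|ys h1]; first by have := bL h h1; lra.
  by have := bK _ _ ys h1; lra.
have [//|K K0 bK] := bX X; exists (K + 1) => [|g h g1 h1]; first by rewrite addr_gt0.
have [x xX gx] := netX g g1; have := bK x h xX h1; have := u2 h h1 g x g1 (X1 _ xX) gx.
by have := ler_normD (f g h - f x h) (f x h); rewrite subrK; lra.
Qed.

Lemma jucontM f f' : jucont f -> jucont f' -> jucont (fun g h => f g h * f' g h).
Proof.
move=> uc1 uc2 eta eta0.
have [M M0 bM] := jucont_bounded uc1; have [K K0 bK] := jucont_bounded uc2.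
have e1 : 0 < eta / (2 * K) by rewrite divr_gt0// mulr_gt0.
have e2 : 0 < eta / (2 * M) by rewrite divr_gt0// mulr_gt0.
have [d1 d10 [u1 v1]] := uc1 _ e1; have [d2 d20 [u2 v2]] := uc2 _ e2.
have key (a b c d : R) : `|b| <= K -> `|c| <= M -> `|a - c| <= eta / (2 * K) ->
    `|b - d| <= eta / (2 * M) -> `|a * b - c * d| <= eta.
  move=> bb cc ac bd; have -> : a * b - c * d = (a - c) * b + c * (b - d) by ring.
  apply: le_trans (ler_normD _ _) _; rewrite !normrM.
  have -> : eta = eta / (2 * K) * K + M * (eta / (2 * M)).
    by field; rewrite !gt_eqF.
  by apply: lerD; apply: ler_pM.
exists (Num.min d1 d2); first by rewrite lt_min d10.
split=> [g g1 h h' h1 h1'|h h1 g g' g1 g1']; rewrite lt_min => /andP[gh1 gh2];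
  apply: key; by [exact: bM | exact: bK | exact: u1 | exact: u2 | exact: v1 | exact: v2].
Qed.

Lemma jucont_l (psi : 'M[R]_p -> R) : ucont psi -> jucont (fun g _ => psi g).
Proof.
move=> uc eta eta0; have [d d0 osc] := uc _ eta0; exists d => //; split => // g g1 h h' _ _ _.
by rewrite subrr normr0 ltW.
Qed.

Lemma jucont_pre r (P : 'M[R]_p -> 'M[R]_q -> 'M[R]_r) K psi : ucont psi ->
  (forall g h, stiefel g -> stiefel h -> stiefel (P g h)) ->
  (forall g h h', stiefel g -> stiefel h -> stiefel h' ->
    frob2 (P g h - P g h') <= K * frob2 (h - h')) ->
  (forall g g' h, stiefel g -> stiefel g' -> stiefel h ->
    frob2 (P g h - P g' h) <= K * frob2 (g - g')) ->
  jucont (fun g h => psi (P g h)).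
Proof.
move=> uc P1 PK1 PK2 eta /uc[d d0 osc]; pose K' := `|K| + 1.
have K0 : 0 < K' by rewrite ltr_wpDl.
have key x : 0 <= x -> x < d / K' -> K * x < d.
  move=> x0; rewrite ltr_pdivlMr// => /(le_lt_trans _); apply.
  by rewrite mulrC ler_wpM2l// /K'; have := ler_norm K; lra.
exists (d / K') => [|]; first by rewrite divr_gt0.
split=> [g g1 h h' h1 h1' /(key _ (frob2_ge0 _)) hh|h h1 g g' g1 g1' /(key _ (frob2_ge0 _)) gg];
  apply: osc; try exact: P1.
  by apply: le_lt_trans hh; exact: PK1.
by apply: le_lt_trans gg; exact: PK2.
Qed.

Lemma ucont_mean f : jucont f -> ucont (fun g => mean (f g)).
Proof.
move=> juc eta eta0; have [d d0 [u1 u2]] := juc _ eta0; exists d => // g g' g1 g1' gg.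
apply: mean_dist_le; [exact: jucont1|exact: jucont1|] => h h1.
exact: (u2 h h1 g g').
Qed.

End exchange.

Lemma jucontC (R : realType) p q (f : 'M[R]_p -> 'M[R]_q -> R) :
  jucont f -> jucont (fun h g => f g h).
Proof. by move=> juc eta /juc[d d0 [u1 u2]]; exists d. Qed.

(** The inner mean is replaced by the average over a finite net that is good for all [g] at once; a
    finite sum commutes with the outer mean by linearity. *)
Lemma mean_exchange (R : realType) p q (f : 'M[R]_p -> 'M[R]_q -> R) : jucont f ->
  mean (fun g => mean (f g)) = mean (fun h => mean (f ^~ h)).
Proof.
move=> juc; apply/eqP; rewrite -subr_eq0 -normr_le0.
apply/ler_addgt0Pl => e e0; rewrite addr0; have e4 : 0 < e / 4 by rewrite divr_gt0.
have [d d0 [u1 u2]] := juc _ e4; have [X netX qX] := mean_net q (e / 4) d0.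
have juc' := jucontC juc.
have ucX x : x \in X -> ucont (f ^~ x) by move=> xX; apply: jucont2 => //; exact: netX.1.
have mavg : mean (fun g => avg X (f g)) = avg X (fun h => mean (f ^~ h)).
  by rewrite /avg meanZ ?mean_sum//; exact: ucont_sum.
have ucavg : ucont (fun g => avg X (f g)) by apply: ucontZ; exact: ucont_sum.
have h1 : `|mean (fun g => avg X (f g)) - mean (fun g => mean (f g))| <= 2 * (e / 4).
  apply: mean_dist_le => // [|g g1]; first exact: ucont_mean.
  by apply: qX; [exact: jucont1 | exact: u1].
have h2 : `|avg X (fun h => mean (f ^~ h)) - mean (fun h => mean (f ^~ h))| <= 2 * (e / 4).
  apply: qX => [|h h' h1' h1'' hh]; first exact: (ucont_mean juc').
  apply: mean_dist_le; [exact: jucont2|exact: jucont2|] => g g1.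
  exact: (u1 g g1 h h').
by move: h1 h2; rewrite mavg !ler_norml; lra.
Qed.

(** * Completing and rotating orthonormal frames *)

Section stiefel_algebra.
Variable R : realType.

Lemma stiefel_col m r q (X : 'M[R]_(m, q)) (Y : 'M[R]_(r, q)) :
  stiefel (col_mx X Y) <-> [/\ stiefel X, stiefel Y & Y *m X^T = 0].
Proof.
rewrite /stiefel tr_col_mx mul_col_row (@scalar_mx_block _ m r); split.
  by move=> /eq_block_mx[-> _ -> ->].
move=> [-> -> YX]; have XY : X *m Y^T = 0 by rewrite -[LHS]trmxK trmx_mul trmxK YX trmx0.
by rewrite XY YX.
Qed.

Lemma stiefel_row1 q (x : 'M[R]_(1, q)) : stiefel x <-> frob2 x = 1.
Proof.
rewrite /stiefel /frob2; split=> [->|]; first by rewrite mxtrace1.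
rewrite /mxtrace big_ord1 => h; apply/matrixP => i j.
by rewrite !ord1 h mxE.
Qed.

Lemma stiefel_normalize q (x : 'M[R]_(1, q)) : x != 0 ->
  stiefel ((Num.sqrt (frob2 x))^-1 *: x).
Proof.
move=> x0; have f0 : 0 < frob2 x.
  by rewrite lt_neqAle frob2_ge0 andbT eq_sym; apply/eqP => /frob2_eq0/eqP; exact/negP.
by apply/stiefel_row1; rewrite frob2Z exprVn sqr_sqrtr ?frob2_ge0// mulVf// gt_eqF.
Qed.

Lemma stiefel_rank m q (X : 'M[R]_(m, q)) : stiefel X -> \rank X = m.
Proof.
move=> X1; apply/eqP; rewrite -[_ == _]/(row_free X); apply/row_freeP.
by exists X^T.
Qed.

Lemma stiefel_leq m q (X : 'M[R]_(m, q)) : stiefel X -> (m <= q)%N.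
Proof. by move=> /stiefel_rank <-; exact: rank_leq_col. Qed.

(** One unit vector at a time: as long as the frame has fewer vectors than the rank of [B], the map
    from the row space of [B] to the inner products with the frame has a kernel, and a kernel vector
    is normalized and added. *)
Lemma stiefel_extend m r p q (X : 'M[R]_(m, q)) (B : 'M[R]_(p, q)) :
  stiefel X -> (X <= B)%MS -> (m + r <= \rank B)%N ->
  exists Y : 'M[R]_(r, q), [/\ stiefel Y, Y *m X^T = 0 & (Y <= B)%MS].
Proof.
move=> X1 XB; elim: r => [|r IH] mr.
  exists 0; split; rewrite ?mul0mx ?sub0mx//; by apply/matrixP => -[].
have [|Y [Y1 YX YB]] := IH; first by apply: leq_trans mr; rewrite leq_add2l.
pose A := col_mx X Y; pose C := row_base B *m A^T.
have : kermx C != 0.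
  rewrite -mxrank_eq0 mxrank_ker -lt0n subn_gt0.
  apply: leq_ltn_trans (rank_leq_col _) _.
  by move: mr; rewrite addnS.
move=> /rowV0Pn[v /sub_kermxP vC v0]; pose y := v *m row_base B.
have y0 : y != 0.
  apply: contra v0 => /eqP y0; have /row_freeP[D BD] := row_base_free B.
  by rewrite -(mulmx1 v) -BD mulmxA -/y y0 mul0mx.
have : y *m A^T = 0 by rewrite /y -mulmxA.
rewrite tr_col_mx mul_mx_row -row_mx0 => /eq_row_mx[yX yY].
have u1 := stiefel_normalize y0; move: (_^-1) u1 => c u1.
have v1 : stiefel (col_mx (c *: y) Y).
  apply/stiefel_col; split => //; rewrite -[LHS]trmxK trmx_mul trmxK -scalemxAl yY.
  by rewrite scaler0 trmx0.
have v2 : col_mx (c *: y) Y *m X^T = 0.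
  by rewrite mul_col_mx YX -scalemxAl yX scaler0 col_mx0.
have v3 : (col_mx (c *: y) Y <= B)%MS.
  by rewrite col_mx_sub YB andbT scalemx_sub// mulmx_sub// eq_row_base.
by exists (col_mx (c *: y) Y).
Qed.

Lemma stiefel_complement m r q (X : 'M[R]_(m, q)) : stiefel X -> (m + r <= q)%N ->
  exists2 Y : 'M[R]_(r, q), stiefel Y & Y *m X^T = 0.
Proof.
move=> X1 mr; have [||Y [Y1 YX _]] := @stiefel_extend m r q q X (1%:M) X1.
- exact: submx1.
- by rewrite mxrank1.
- by exists Y.
Qed.

Lemma stiefel_exists r q : (r <= q)%N -> exists Y : 'M[R]_(r, q), stiefel Y.
Proof.
move=> rq; have [||Y Y1 _] := @stiefel_complement 0 r q (0 : 'M[R]_(0, q)) => //.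
  by apply/matrixP => -[].
by exists Y.
Qed.

Lemma stiefel_resolution m r q (X : 'M[R]_(m, q)) (Y : 'M[R]_(r, q)) :
  stiefel X -> stiefel Y -> Y *m X^T = 0 -> q = (m + r)%N -> X^T *m X + Y^T *m Y = 1%:M.
Proof.
move=> X1 Y1 YX qE; subst q.
have A1 : stiefel (col_mx X Y) by apply/stiefel_col.
by have := stiefel_trl A1; rewrite tr_col_mx mul_row_col.
Qed.

(** Complete both frames to orthonormal bases and send one basis to the other. *)
Lemma stiefel_trans m q (X X' : 'M[R]_(m, q)) : stiefel X -> stiefel X' ->
  exists2 g : 'M[R]_q, stiefel g & X *m g = X'.
Proof.
move=> X1 X1'; have mq := stiefel_leq X1.
have [|Y Y1 YX] := @stiefel_complement m (q - m) q X X1; first by rewrite subnKC.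
have [|Y' Y1' YX'] := @stiefel_complement m (q - m) q X' X1'; first by rewrite subnKC.
have tr0 r s (A : 'M[R]_(r, q)) (B : 'M[R]_(s, q)) : A *m B^T = 0 -> B *m A^T = 0.
  by move=> AB; rewrite -[LHS]trmxK trmx_mul trmxK AB trmx0.
exists (X^T *m X' + Y^T *m Y').
  rewrite /stiefel linearD/= !trmx_mul !trmxK mulmxDl !mulmxDr.
  have -> : X^T *m X' *m (X'^T *m X) = X^T *m X.
    by rewrite mulmxA -(mulmxA X^T) X1' mulmx1.
  have -> : Y^T *m Y' *m (Y'^T *m Y) = Y^T *m Y.
    by rewrite mulmxA -(mulmxA Y^T) Y1' mulmx1.
  have -> : X^T *m X' *m (Y'^T *m Y) = 0.
    by rewrite mulmxA -(mulmxA X^T) (tr0 _ _ _ _ YX') mulmx0 mul0mx.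
  have -> : Y^T *m Y' *m (X'^T *m X) = 0.
    by rewrite mulmxA -(mulmxA Y^T) YX' mulmx0 mul0mx.
  by rewrite addr0 add0r; apply: stiefel_resolution => //; rewrite subnKC.
by rewrite mulmxDr !mulmxA X1 mul1mx (tr0 _ _ _ _ YX) mul0mx addr0.
Qed.

(* Acts as h on the row space of U and trivially on its orthogonal complement. *)
Definition ext {b q} (U : 'M[R]_(b, q)) (h : 'M[R]_b) : 'M[R]_q :=
  U^T *m h *m U + (1%:M - U^T *m U).

Lemma mul_ext b q (U : 'M[R]_(b, q)) h : stiefel U -> U *m ext U h = h *m U.
Proof.
move=> U1; rewrite /ext mulmxDr mulmxBr !mulmxA U1 !mul1mx mulmx1 subrr addr0.
by [].
Qed.

Lemma mul_ext0 b q m (U : 'M[R]_(b, q)) h (W : 'M[R]_(m, q)) :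
  W *m U^T = 0 -> W *m ext U h = W.
Proof. by move=> WU; rewrite /ext mulmxDr mulmxBr !mulmxA WU !mul0mx add0r subr0 mulmx1. Qed.

Lemma tr_ext b q (U : 'M[R]_(b, q)) h : (ext U h)^T = ext U h^T.
Proof.
by rewrite /ext linearD linearB/= !trmx_mul trmxK mulmxA trmx1.
Qed.

Lemma ext_mul0 b q m (U : 'M[R]_(b, q)) h (W : 'M[R]_(m, q)) :
  W *m U^T = 0 -> ext U h *m W^T = W^T.
Proof. by move=> WU; rewrite -[LHS]trmxK trmx_mul trmxK tr_ext mul_ext0. Qed.

Lemma stiefel_ext b q (U : 'M[R]_(b, q)) h : stiefel U -> stiefel h -> stiefel (ext U h).
Proof.
move=> U1 h1; rewrite /stiefel tr_ext {1}/ext mulmxDl mulmxBl mul1mx.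
rewrite -!(mulmxA _ U) !mul_ext// mulmxA -(mulmxA _ h) h1 mulmx1 /ext.
by rewrite mulmxA [U^T *m h^T *m U + _]addrC addrK addrC subrK.
Qed.

Lemma frob2_ext b q (U : 'M[R]_(b, q)) h h' :
  frob2 (ext U h - ext U h') <= frob2 U ^+ 2 * frob2 (h - h').
Proof.
rewrite /ext opprD addrACA subrr addr0 -mulmxBl -mulmxBr.
apply: le_trans (frob2M _ _) _.
have -> : frob2 U ^+ 2 * frob2 (h - h') = frob2 U^T * frob2 (h - h') * frob2 U.
  by rewrite frob2_tr; ring.
by rewrite ler_wpM2r ?frob2_ge0 ?frob2M.
Qed.

(** Pythagoras, for the projections of the columns of [A] to two complementary subspaces. *)
Lemma frob2_resolution m r q p (X : 'M[R]_(m, q)) (Y : 'M[R]_(r, q)) (A : 'M[R]_(q, p)) :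
  X^T *m X + Y^T *m Y = 1%:M -> frob2 (X *m A) + frob2 (Y *m A) = frob2 A.
Proof.
move=> XY; rewrite -!(frob2_tr (_ *m A)) -(frob2_tr A) /frob2 -linearD/=; congr (\tr _).
rewrite !trmx_mul !trmxK !mulmxA -mulmxDl -!(mulmxA A^T) -mulmxDr XY.
by rewrite mulmx1.
Qed.

Lemma frob2_stiefel_le m q p (X : 'M[R]_(m, q)) (A : 'M[R]_(q, p)) :
  stiefel X -> frob2 (X *m A) <= frob2 A.
Proof.
move=> X1; have mq := stiefel_leq X1.
have [|Y Y1 YX] := @stiefel_complement m (q - m) q X X1; first by rewrite subnKC.
have XY : X^T *m X + Y^T *m Y = 1%:M by apply: stiefel_resolution => //; rewrite subnKC.
by rewrite -(frob2_resolution A XY) lerDl frob2_ge0.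
Qed.

(** Equality in Bessel's inequality: the part of [e] orthogonal to the frame has length 0. *)
Lemma stiefel_proj_id m q (X : 'M[R]_(m, q)) (e : 'M[R]_(1, q)) :
  stiefel X -> stiefel e -> frob2 (X *m e^T) = 1 -> e *m X^T *m X = e.
Proof.
move=> X1 e1 Xe; have mq := stiefel_leq X1.
have [|Y Y1 YX] := @stiefel_complement m (q - m) q X X1; first by rewrite subnKC.
have XY : X^T *m X + Y^T *m Y = 1%:M by apply: stiefel_resolution => //; rewrite subnKC.
have := frob2_resolution e^T XY; rewrite Xe frob2_tr.
move: (e1) => /stiefel_row1 -> /(canRL (addKr _)); rewrite addNr => /frob2_eq0 Ye.
have eY : e *m Y^T = 0 by rewrite -[LHS]trmxK trmx_mul trmxK Ye trmx0.
by rewrite -[RHS]mulmx1 -XY mulmxDr !mulmxA eY mul0mx addr0.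
Qed.

(** By [stiefel_proj_id] the vector [e] lies in the span of [X], with coordinates [e *m X^T]. A
    rotation that takes the first unit coordinate vector to these coordinates makes [e] the first
    vector of the frame. *)
Lemma stiefel_contains m q (X : 'M[R]_(1 + m, q)) (e : 'M[R]_(1, q)) :
  stiefel X -> stiefel e -> frob2 (X *m e^T) = 1 ->
  exists k : 'M[R]_(1 + m), exists Y : 'M[R]_(m, q),
    [/\ stiefel k, stiefel (col_mx e Y) & X = k *m col_mx e Y].
Proof.
move=> X1 e1 Xe; have y1 : stiefel (e *m X^T).
  by apply/stiefel_row1; rewrite -frob2_tr trmx_mul trmxK.
have d1 : stiefel (delta_mx 0 0 : 'M[R]_(1, 1 + m)).
  by rewrite /stiefel trmx_delta mul_delta_mx; apply/matrixP => i j; rewrite !ord1 !mxE.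
have [k k1 ke] := stiefel_trans d1 y1.
have uk : usubmx k = e *m X^T.
  rewrite -ke -rowE; apply/rowP => i; rewrite !mxE; congr (k _ _).
  by apply/val_inj.
have kX : k *m X = col_mx e (dsubmx k *m X).
  by rewrite -{1}(vsubmxK k) mul_col_mx uk stiefel_proj_id.
exists k^T, (dsubmx k *m X); rewrite -kX; split.
- exact: stiefel_tr.
- exact: stiefelM.
- by rewrite mulmxA stiefel_trl// mul1mx.
Qed.

(** A column is its length times a rotated fixed unit vector. In a mean over rotations the factor
    [k] disappears by invariance, so that only the length matters. *)
Lemma stiefel_polar m (z : 'M[R]_(1, m)) (x : 'M[R]_(m, 1)) : stiefel z ->
  exists k : 'M[R]_m, stiefel k /\ x = Num.sqrt (frob2 x) *: (k *m z^T).
Proof.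
move=> z1; have [->|x0] := eqVneq x 0.
  by exists 1%:M; rewrite frob2_0 sqrtr0 scale0r; split => //; exact: stiefel1.
have xT0 : x^T != 0 by rewrite -(inj_eq (@trmx_inj _ _ _)) trmxK trmx0.
have u1 := stiefel_normalize xT0; have [k k1 kx] := stiefel_trans z1 u1.
exists k^T; split; first exact: stiefel_tr.
rewrite -trmx_mul kx linearZ/= trmxK frob2_tr scalerA divff ?scale1r//.
rewrite sqrtr_eq0 -ltNge lt_neqAle frob2_ge0 andbT eq_sym.
by apply/eqP => /frob2_eq0/eqP; exact/negP.
Qed.

End stiefel_algebra.

(** * Compactness of the orthogonal group *)

Section compactness.
Variables (R : realType) (q : nat).

(** A cluster point of the sets [P d] as [d] decreases to 0. Matrices are flattened by [mxvec] into
    a compact cube, and [stiefel_limit] shows that the cluster point is again orthogonal. *)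
Lemma orth_cluster (P : R -> 'M[R]_q -> Prop) :
  (forall d d' g, 0 < d -> d <= d' -> P d g -> P d' g) ->
  (forall d, 0 < d -> exists2 g, stiefel g & P d g) ->
  exists2 g, stiefel g & forall d r, 0 < d -> 0 < r ->
    exists h, [/\ stiefel h, P d h & frob2 (h - g) < r].
Proof.
move=> Pmono Pex.
pose A (i : 'I_(q * q)) : set R := `[(-1), 1]%classic.
have cK : compact [set v : 'rV[R]_(q * q) | forall i, A i (v ord0 i)].
  by apply: rV_compact => i; exact: segment_compact.
pose S d := [set v : 'rV[R]_(q * q) | stiefel (vec_mx v) /\ P d (vec_mx v)].
pose F : set_system 'rV[R]_(q * q) := filter_from [set d : R | 0 < d] S.
have PF : ProperFilter F.
  apply: filter_from_proper.
    apply: filter_from_filter; first by exists 1 => /=.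
    move=> d d' /= d0 d'0; exists (Num.min d d') => /=; first by rewrite lt_min d0.
    move=> v [v1 Pv]; split; split => //; apply: Pmono Pv => //; rewrite ?ge_min ?lexx ?orbT//.
      by rewrite lt_min d0.
    by rewrite lt_min d0.
  move=> d /= d0; have [g g1 Pg] := Pex d d0.
  by exists (mxvec g); rewrite /S/= mxvecK.
have [|v [_ clv]] := cK F PF.
  exists 1 => //= v [v1 _] i; rewrite /A/= in_itv/= -ler_norml.
  have : v ord0 i ^+ 2 <= 1.
    case/mxvec_indexP: i => i j.
    have -> : v ord0 (mxvec_index i j) = vec_mx v i j by rewrite mxE.
    move: (vec_mx v) v1 => g v1.
    have -> : 1 = (g *m g^T) i i :> R by rewrite v1 mxE eqxx.
    rewrite [leRHS]mxE (bigD1 j)//= !mxE -expr2 lerDl sumr_ge0// => l _.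
    by rewrite !mxE -expr2 sqr_ge0.
  by move=> vi; rewrite ler_norml; apply/andP; split; nra.
have near d r : 0 < d -> 0 < r ->
    exists h, [/\ stiefel h, P d h & frob2 (h - vec_mx v) < r].
  move=> d0 r0; pose K := (q * q)%:R + 1 : R.
  have K0 : 0 < K by rewrite ltr_wpDl.
  pose e := Num.min 1 (r / K); have e0 : 0 < e by rewrite lt_min ltr01 divr_gt0.
  have [||w [[w1 Pw] vw]] := clv (S d) (ball v e).
  - by exists d.
  - exact: nbhsx_ballx.
  exists (vec_mx w); split => //; rewrite -linearB/=.
  apply: (@le_lt_trans _ _ (\sum_(i < q) \sum_(j < q) r / K)).
    rewrite frob2E; apply: ler_sum => i _; apply: ler_sum => j _.
    rewrite !mxE.
    have : `|v ord0 (mxvec_index i j) - w ord0 (mxvec_index i j)| < e.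
      by have [_ /(_ ord0 (mxvec_index i j))] := vw.
    rewrite /e lt_min => /andP[]; rewrite -normrN opprB -[X in X <= _]real_normK ?num_real//.
    by have := normr_ge0 (w ord0 (mxvec_index i j) - v ord0 (mxvec_index i j)); nra.
  rewrite !sumr_const !card_ord -mulrnA -[_ *+ _]mulr_natl mulrCA gtr_pMr//.
  by rewrite ltr_pdivrMr// mul1r /K ltrDl.
exists (vec_mx v); last by [].
apply: stiefel_limit => r r0; have [h [h1 _ hr]] := near 1 r ltr01 r0.
by exists h; rewrite // frob2_subC.
Qed.

(** Heine-Cantor: pairs violating uniform continuity at every scale would cluster at a point where
    continuity fails. *)
Lemma ucont_of_cont (psi : 'M[R]_q -> R) :
  (forall g eta, stiefel g -> 0 < eta -> exists2 d, 0 < d &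
     forall h, stiefel h -> frob2 (h - g) < d -> `|psi h - psi g| <= eta) ->
  ucont psi.
Proof.
move=> pc eta eta0; apply: contrapT => nex.
pose P d g := exists h, [/\ stiefel h, frob2 (g - h) < d & eta < `|psi g - psi h|].
have [||g g1 clg] := @orth_cluster P.
- by move=> d d' g d0 dd' [h [h1 gh e]]; exists h; split => //; exact: lt_le_trans dd'.
- move=> d d0; apply: contrapT => nex2; apply: nex; exists d => // g h g1 h1 gh.
  by rewrite leNgt; apply/negP => e; apply: nex2; exists g => //; exists h.
- have e2 : 0 < eta / 2 by rewrite divr_gt0.
  have [d d0 osc] := pc g _ g1 e2.
  have d4 : 0 < d / 4 by rewrite divr_gt0.
  have [h [h1 [k [k1 hk e]] hg]] := clg _ _ d4 d4.
  have kg : frob2 (k - g) < d.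
    apply: le_lt_trans (frob2_tri h k g) _; rewrite (frob2_subC k h).
    by move: hk hg; lra.
  have hg' : frob2 (h - g) < d by move: hg; lra.
  have := osc h h1 hg'; have := osc k k1 kg => b1 b2.
  have := ler_normB (psi h - psi g) (psi k - psi g).
  by rewrite opprB addrA subrK; move: e; lra.
Qed.

(** Points with [phi] close to 1 and [psi] far from [c] would cluster at a point with [phi] equal to
    1, where [psi] is [c]. It is applied to the squared length [t] as [phi]. *)
Lemma ucont_local (psi phi : 'M[R]_q -> R) c e : ucont psi -> ucont phi -> 0 < e ->
  (forall g, stiefel g -> phi g = 1 -> psi g = c) ->
  (forall g, stiefel g -> phi g <= 1) ->
  exists2 d, 0 < d & forall g, stiefel g -> 1 - d <= phi g -> `|psi g - c| <= e.
Proof.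
move=> uc1 uc2 e0 h1 h2; apply: contrapT => nex.
pose P d g := 1 - d <= phi g /\ e < `|psi g - c|.
have [||g g1 clg] := @orth_cluster P.
- by move=> d d' g d0 dd' [a b]; split => //; lra.
- move=> d d0; apply: contrapT => nex2; apply: nex; exists d => // g g1 gh.
  by rewrite leNgt; apply/negP => b; apply: nex2; exists g.
have phi1 : phi g = 1.
  apply/eqP; rewrite eq_le h2//=; apply/ler_addgt0Pl => r r0.
  have r2 : 0 < r / 2 by rewrite divr_gt0.
  have [d d0 osc] := uc2 _ r2; have [h [h1' [a _] hg]] := clg _ _ r2 d0.
  by have := osc h g h1' g1 hg; rewrite ler_norml; lra.
have [d d0 osc] := uc1 _ e0; have [h [h1' [_ a] hg]] := clg _ _ ltr01 d0.
by have := osc h g h1' g1 hg; rewrite (h1 g g1 phi1); lra.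
Qed.

End compactness.

(** * Functions of frames with vanishing means *)

Section rank_one.
Variable R : realType.

(** Continuity on the Stiefel manifold, tested by pulling back along orbits of the orthogonal
    group. *)
Definition stcont {p q} (f : 'M[R]_(p, q) -> R) :=
  forall X, stiefel X -> ucont (fun g : 'M[R]_q => f (X *m g)).

Lemma ucont_ext b q (U : 'M[R]_(b, q)) (psi : 'M[R]_q -> R) : stiefel U -> ucont psi ->
  ucont (fun h => psi (ext U h)).
Proof.
move=> U1 uc; apply: (ucont_pre uc) => [g|g h _ _]; first exact: stiefel_ext.
exact: frob2_ext.
Qed.

Lemma jucont_ext_mul b q (U : 'M[R]_(b, q)) (psi : 'M[R]_q -> R) : stiefel U -> ucont psi ->
  jucont (fun g h => psi (ext U h *m g)).
Proof.
move=> U1 uc; apply: (@jucont_pre _ _ _ _ (fun g h => ext U h *m g) (frob2 U ^+ 2 + 1)) => //.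
- by move=> g h g1 h1; apply: stiefelM => //; exact: stiefel_ext.
- move=> g h h' g1 h1 h1'; rewrite -mulmxBl frob2_stiefelr//.
  by apply: le_trans (frob2_ext _ _ _) _; rewrite ler_wpM2r ?frob2_ge0// lerDl.
- move=> g g' h g1 g1' h1; rewrite -mulmxBr frob2_orthl; last exact: stiefel_ext.
  by rewrite ler_peMl ?frob2_ge0// lerDr exprn_ge0// frob2_ge0.
Qed.

Lemma jucont_mul_ext b q (U : 'M[R]_(b, q)) (psi : 'M[R]_q -> R) : stiefel U -> ucont psi ->
  jucont (fun g h => psi (g *m ext U h)).
Proof.
move=> U1 uc; apply: (@jucont_pre _ _ _ _ (fun g h => g *m ext U h) (frob2 U ^+ 2 + 1)) => //.
- by move=> g h g1 h1; apply: stiefelM => //; exact: stiefel_ext.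
- move=> g h h' g1 h1 h1'; rewrite -mulmxBr frob2_orthl//.
  by apply: le_trans (frob2_ext _ _ _) _; rewrite ler_wpM2r ?frob2_ge0// lerDl.
- move=> g g' h g1 g1' h1; rewrite -mulmxBl frob2_stiefelr; last exact: stiefel_ext.
  by rewrite ler_peMl ?frob2_ge0// lerDr exprn_ge0// frob2_ge0.
Qed.

(** * Moments of the projected length *)

Section moments.
Variables (p b q : nat) (Y : 'M[R]_(p, b)) (U : 'M[R]_(b, q)) (e w : 'M[R]_(1, q)).
Hypotheses (pb : (p <= b)%N) (qE : q = (1 + b)%N).
Hypotheses (Y1 : stiefel Y) (U1 : stiefel U) (e1 : stiefel e) (w1 : stiefel w).
Hypothesis wU : w *m U^T = 0.

Let X := Y *m U.
Let X1 : stiefel X. Proof. exact: stiefelM. Qed.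
(** Here [g] moves the b-plane spanned by [U] and the plane of [X] inside it. [t g] is the squared
    length of the projection of [e] to the moved plane of [X], and [a g] is the component of [e]
    along the unit normal [w *m g] of the moved b-plane. *)
Let t (g : 'M[R]_q) : R := frob2 (X *m g *m e^T).
Let a (g : 'M[R]_q) : R := (w *m g *m e^T) 0 0.

Let t_le1 g : stiefel g -> t g <= 1.
Proof.
move=> g1; rewrite /t -mulmxA; apply: le_trans (frob2_stiefel_le _ X1) _.
by rewrite frob2_orthl// frob2_tr (stiefel_row1 e).1.
Qed.

Let a_le1 g : stiefel g -> `|a g| <= 1.
Proof.
move=> g1; have : a g ^+ 2 <= 1.
  apply: le_trans (sqr_entry_le _ _ _) _.
  rewrite -mulmxA; apply: le_trans (frob2_stiefel_le _ w1) _.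
  by rewrite frob2_orthl// frob2_tr (stiefel_row1 e).1.
by rewrite ler_norml => h; apply/andP; split; nra.
Qed.

Let uc_t : ucont t. Proof. exact: ucont_frob2. Qed.
Let uc_a : ucont a. Proof. exact: ucont_entry. Qed.

(* The weight a only depends on the component of e^T normal to U, so it is unchanged by the
   rotations ext U h over which the inner mean is taken. *)
Lemma weighted_mean_le f m : stcont f ->
  `|mean (fun g => a g ^+ m * f (X *m g))| <=
  mean (fun g => `|mean (fun h => f (Y *m h *m U *m g))|).
Proof.
move=> fc; have ucf := fc X X1.
have juc : jucont (fun (g : 'M[R]_q) (h : 'M[R]_b) => a g ^+ m * f (X *m (ext U h *m g))).
  apply: jucontM; first by apply: (jucont_l _ (ucontX _ uc_a)).
  exact: (jucont_ext_mul U1 ucf).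
have eqf g h : f (X *m (ext U h *m g)) = f (Y *m h *m U *m g).
  by rewrite mulmxA /X -(mulmxA Y) mul_ext// !mulmxA.
have -> : mean (fun g => a g ^+ m * f (X *m g)) =
    mean (fun g => a g ^+ m * mean (fun h => f (X *m (ext U h *m g)))).
  transitivity (mean (fun g => mean (fun h => a g ^+ m * f (X *m (ext U h *m g))))).
    rewrite mean_exchange// -[LHS](mean_cst b); apply: eq_mean => h h1.
    have := mean_mull (stiefel_ext U1 h1) (ucontM (ucontX m uc_a) ucf).
    move=> <-; apply: eq_mean => g g1; congr (_ ^+ _ * _).
    by rewrite /a mulmxA mul_ext0.
  apply: eq_mean => g g1; rewrite meanZ//.
  exact: (jucont1 (jucont_ext_mul U1 ucf)).
have uc2 : ucont (fun g => mean (fun h => f (X *m (ext U h *m g)))).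
  exact: (ucont_mean (jucont_ext_mul U1 ucf)).
have uc3 := ucontM (ucontX m uc_a) uc2.
apply: le_trans (mean_norm uc3) _.
rewrite (_ : (fun g => `|mean (fun h => f (Y *m h *m U *m g))|) =
  (fun g => `|mean (fun h => f (X *m (ext U h *m g)))|)); last first.
  apply/funext => g; congr (`|mean _|).
  by apply/funext => h; rewrite eqf.
apply: mean_le; [exact: ucont_norm | exact: ucont_norm |] => g g1.
by rewrite normrM ler_piMl// normrX exprn_ile1// a_le1.
Qed.

(* Averages the weight over the rotations fixing the frame X. *)
Lemma weighted_mean_eq m : exists2 c, 0 < c & forall f, stcont f ->
  mean (fun g => a g ^+ (2 * m) * f (X *m g)) = c * mean (fun g => (1 - t g) ^+ m * f (X *m g)).
Proof.
have pq : (p + (q - p))%N = q.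
  by rewrite subnKC// qE; apply: leq_trans pb _; rewrite leq_addl.
have [|Z Z1 ZX] := @stiefel_complement _ p (q - p) q X X1; first by rewrite pq.
have XZ := stiefel_resolution X1 Z1 ZX (esym pq).
have wX : w *m X^T = 0 by rewrite /X trmx_mul mulmxA wU mul0mx.
have wZ : w *m Z^T *m Z = w.
  by rewrite -[RHS]mulmx1 -XZ mulmxDr !mulmxA wX !mul0mx add0r.
set z := w *m Z^T.
have z1 : stiefel z by rewrite /stiefel /z trmx_mul trmxK mulmxA wZ.
pose s (k : 'M[R]_(q - p)) := (z *m k *m z^T) 0 0.
have uc_s : ucont s by exact: ucont_entry.
exists (mean (fun k => s k ^+ (2 * m))).
  apply: (@mean_gt0 _ _ _ 1%:M); first exact: ucontX.
  - by move=> k _; rewrite exprM exprn_ge0// sqr_ge0.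
  - exact: stiefel1.
  - by rewrite /s mulmx1 z1 mxE eqxx expr1n.
move=> f fc; have ucf := fc X X1.
have jb : jucont (fun (g : 'M[R]_q) (k : 'M[R]_(q - p)) => a (ext Z k *m g) ^+ (2 * m)).
  exact: (@jucont_ext_mul _ _ Z (fun g => a g ^+ (2 * m)) Z1 (ucontX _ uc_a)).
have juc : jucont (fun (g : 'M[R]_q) (k : 'M[R]_(q - p)) =>
    f (X *m g) * a (ext Z k *m g) ^+ (2 * m)).
  apply: jucontM => //; exact: (jucont_l _ ucf).
transitivity (mean (fun g => f (X *m g) * mean (fun k => a (ext Z k *m g) ^+ (2 * m)))).
  transitivity (mean (fun g => mean (fun k => f (X *m g) * a (ext Z k *m g) ^+ (2 * m)))).
    rewrite mean_exchange// -[LHS](mean_cst (q - p)); apply: eq_mean => k k1.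
    have := mean_mull (stiefel_ext Z1 k1) (ucontM (ucontX (2 * m) uc_a) ucf).
    move=> <-; apply: eq_mean => g g1; rewrite mulrC; congr (f _ * _).
    rewrite mulmxA mul_ext0//.
    by rewrite -[LHS]trmxK trmx_mul trmxK ZX trmx0.
  apply: eq_mean => g g1; rewrite meanZ//; exact: (jucont1 jb).
rewrite -meanZ; last first.
  apply: ucontM => //; apply: ucontX; apply: ucontB => //; exact: ucont_cst.
apply: eq_mean => g g1; rewrite mulrC mulrA; congr (_ * _).
(* The part of [e] orthogonal to the moved plane has squared length 1 - [t g]. Its direction is
   absorbed into the rotation [k0], which leaves the factor (1 - t) ^ m and a constant independent
   of [g]. *)
have [k0 [k01 zE]] := stiefel_polar (Z *m g *m e^T) z1.
have fz : frob2 (Z *m g *m e^T) = 1 - t g.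
  have := frob2_resolution (g *m e^T) XZ.
  by rewrite frob2_orthl// frob2_tr (stiefel_row1 e).1// !mulmxA -/(t g); lra.
have fz0 : 0 <= 1 - t g by rewrite -fz frob2_ge0.
transitivity (mean (fun k => (1 - t g) ^+ m * s (k *m k0) ^+ (2 * m))).
  apply: eq_mean => k k1; rewrite /a /s.
  have -> : w *m (ext Z k *m g) *m e^T = z *m k *m (Z *m g *m e^T).
    by rewrite -{1}wZ -/z !mulmxA -(mulmxA z Z) mul_ext// !mulmxA.
  rewrite zE -scalemxAr mxE exprMn fz.
  by rewrite exprM sqr_sqrtr// !mulmxA.
rewrite meanZ; last first.
  exact: (@ucont_mulr _ _ k0 (fun k => s k ^+ (2 * m)) k01 (ucontX _ uc_s)).
rewrite mulrC; congr (_ * _).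
exact: (mean_mulr k01 (ucontX (2 * m) uc_s)).
Qed.

(** The identity t ^ (m+1) (1-t) ^ r = t ^ m (1-t) ^ r - t ^ m (1-t) ^ (r+1) passes from all powers
    of 1 - t to all powers of t. The constant depends on [m] but not on [f], so for fixed [m] a
    truncation parameter can be sent to infinity. *)
Lemma moment_bound m : exists2 C, 0 <= C & forall f, stcont f ->
  `|mean (fun g => t g ^+ m * f (X *m g))| <=
  C * mean (fun g => `|mean (fun h => f (Y *m h *m U *m g))|).
Proof.
have uc1t : ucont (fun g => 1 - t g) by apply: ucontB => //; exact: ucont_cst.
suff key : forall r, exists2 C, 0 <= C & forall f, stcont f ->
  `|mean (fun g => t g ^+ m * (1 - t g) ^+ r * f (X *m g))| <=
  C * mean (fun g => `|mean (fun h => f (Y *m h *m U *m g))|).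
  have [C C0 h] := key 0%N; exists C => // f /h.
  by under eq_fun do rewrite expr0 mulr1.
elim: m => [|m IH] r.
  have [c c0 cE] := weighted_mean_eq r; exists c^-1; first by rewrite invr_ge0 ltW.
  move=> f fc; rewrite mulrC ler_pdivlMr//.
  under eq_fun do rewrite expr0 mul1r.
  have := weighted_mean_le (2 * r) fc; rewrite cE// normrM gtr0_norm// mulrC.
  by [].
have [C C0 hC] := IH r; have [D D0 hD] := IH r.+1.
exists (C + D) => [|f fc]; first exact: addr_ge0.
have ucf := fc X X1.
have uc n n' : ucont (fun g => t g ^+ n * (1 - t g) ^+ n' * f (X *m g)).
  by apply: ucontM => //; apply: ucontM; exact: ucontX.
have -> : mean (fun g => t g ^+ m.+1 * (1 - t g) ^+ r * f (X *m g)) =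
  mean (fun g => t g ^+ m * (1 - t g) ^+ r * f (X *m g)) -
  mean (fun g => t g ^+ m * (1 - t g) ^+ r.+1 * f (X *m g)).
  by rewrite -meanB//; apply: eq_mean => g _; rewrite !exprS; ring.
apply: le_trans (ler_normB _ _) _; rewrite mulrDl; apply: lerD; [exact: hC|exact: hD].
Qed.

End moments.

Lemma expr_dominated (x y A D : R) : 0 <= x -> x < y -> 0 < A ->
  (forall m : nat, A * y ^+ m <= D * x ^+ m) -> False.
Proof.
move=> x0 xy A0 h; have y0 : 0 < y by exact: le_lt_trans xy.
have r1 : `|x / y| < 1.
  rewrite ger0_norm; last by rewrite divr_ge0// ltW.
  by rewrite ltr_pdivrMr// mul1r.
have c0 : D * (x / y) ^+ m @[m --> \oo] --> D * 0 by apply: cvgMr; exact: cvg_expr.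
rewrite mulr0 in c0.
have : A <= 0.
  apply: (cvgr_to_ge c0); apply: nearW => m /=.
  by rewrite expr_div_n mulrA ler_pdivlMr ?exprn_gt0.
by rewrite leNgt A0.
Qed.

(* As m grows, the weight t ^ m concentrates on the frames whose span contains e, where
   moment_bound forces the mean J to vanish. The family f, rather than a single function, is
   there for the truncations of a singular function. *)
Section concentration.
Variables (p b q : nat) (Y : 'M[R]_(1 + p, b)) (U : 'M[R]_(b, q)).
Variables (e : 'M[R]_(1, q)) (E : 'M[R]_(b, q)) (Y' : 'M[R]_(p, b)).
Hypotheses (pb : (1 + p <= b)%N) (qE : q = (1 + b)%N).
Hypotheses (Y1 : stiefel Y) (U1 : stiefel U) (e1 : stiefel e).
Hypotheses (E1 : stiefel E) (Ee : E *m e^T = 0) (Y'1 : stiefel Y').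
Variables (f : nat -> 'M[R]_(1 + p, q) -> R) (l0 : nat) (C d0 : R).
Hypothesis fc : forall l, stcont (f l).
Hypothesis finv : forall l k X, stiefel k -> stiefel X -> f l (k *m X) = f l X.
Hypothesis small : forall eps, 0 < eps -> exists L, forall l, (L <= l)%N ->
  mean (fun g => `|mean (fun h => f l (Y *m h *m U *m g))|) <= eps.
Hypothesis bounded : forall l, mean (fun g : 'M[R]_q => `|f l (Y *m U *m g)|) <= C.
Hypothesis d0_gt0 : 0 < d0.
Hypothesis stationary : forall l X, (l0 <= l)%N -> stiefel X ->
  1 - d0 <= frob2 (X *m e^T) -> f l X = f l0 X.

Let X := Y *m U.
Let X1 : stiefel X. Proof. exact: stiefelM. Qed.
Let t (g : 'M[R]_q) : R := frob2 (X *m g *m e^T).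
Let uc_t : ucont t. Proof. exact: ucont_frob2. Qed.
Let eE : e *m E^T = 0. Proof. by rewrite -[LHS]trmxK trmx_mul trmxK Ee trmx0. Qed.

Let t_le1 g : stiefel g -> t g <= 1.
Proof.
move=> g1; rewrite /t -mulmxA; apply: le_trans (frob2_stiefel_le _ X1) _.
by rewrite frob2_orthl// frob2_tr (stiefel_row1 e).1.
Qed.

Let J := mean (fun k => f l0 (col_mx e (Y' *m k *m E))).

(** The average over rotations that fix [e]. They do not change [t], so [fb l] has the same moments
    as [f l] ([mean_fb]), and where [t] is 1 it takes the constant value [J] ([fbJ]). *)
Let fb l (g : 'M[R]_q) := mean (fun k => f l (X *m (g *m ext E k))).

Let col1 (A : 'M[R]_(p, b)) : stiefel A -> stiefel (col_mx e (A *m E)).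
Proof.
move=> A1; apply/stiefel_col; split => //; first exact: stiefelM.
by rewrite -mulmxA Ee mulmx0.
Qed.

(** If [t g] is 1, the plane contains [e], and up to a change of frame it is [e] together with a
    frame orthogonal to [e]; the rotations [ext E k] carry that frame to all others. *)
Let fbJ g : stiefel g -> t g = 1 -> fb l0 g = J.
Proof.
move=> g1 tg; have Xg1 : stiefel (X *m g) by exact: stiefelM.
have [k [A [k1 cA1 XgE]]] := stiefel_contains Xg1 e1 tg.
have [_ A1 Ae] := (stiefel_col e A).1 cA1.
have res := stiefel_resolution e1 E1 Ee qE.
have AE : A *m E^T *m E = A.
  by rewrite -[RHS]mulmx1 -res mulmxDr !mulmxA Ae mul0mx add0r.
have AE1 : stiefel (A *m E^T) by rewrite /stiefel trmx_mul trmxK mulmxA AE.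
have [k' k'1 Yk] := stiefel_trans Y'1 AE1.
transitivity (mean (fun h => f l0 (col_mx e (Y' *m (k' *m h) *m E)))).
  apply: eq_mean => h h1; rewrite mulmxA XgE -mulmxA finv//; last first.
    by apply: stiefelM => //; exact: stiefel_ext.
  congr (f l0 _); rewrite mul_col_mx mul_ext0//; congr col_mx.
  by rewrite -{1}AE -mulmxA mul_ext// mulmxA -Yk !mulmxA.
apply: (mean_mull k'1 (psi := fun h => f l0 (col_mx e (Y' *m h *m E)))).
apply: (eq_ucont _ (ucont_ext E1 (fc l0 (col1 Y'1)))) => h h1.
by rewrite mul_col_mx mul_ext0// -mulmxA mul_ext// mulmxA.
Qed.

Let mean_fb l m : mean (fun g => t g ^+ m * fb l g) = mean (fun g => t g ^+ m * f l (X *m g)).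
Proof.
have ucf := fc l X1; have juc := jucont_mul_ext E1 ucf.
transitivity (mean (fun g => mean (fun k => t g ^+ m * f l (X *m (g *m ext E k))))).
  by apply: eq_mean => g g1; rewrite meanZ//; exact: (jucont1 juc).
have juc' : jucont (fun g k => t g ^+ m * f l (X *m (g *m ext E k))).
  by apply: jucontM => //; exact: (jucont_l _ (ucontX m uc_t)).
rewrite (mean_exchange juc') -[RHS](mean_cst b); apply: eq_mean => k k1.
have := mean_mulr (stiefel_ext E1 k1) (ucontM (ucontX m uc_t) ucf).
move=> <-; apply: eq_mean => g g1; congr (_ ^+ _ * _).
by rewrite /t -!mulmxA ext_mul0.
Qed.

(** If [J] were positive, then for each [m], letting [l] tend to infinity first, the mean of [t ^ m]
    would be at most a constant times (1 - dd) ^ m. But [t] comes arbitrarily close to 1 on sets of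
    positive mean, so [t ^ m] decays more slowly. *)
Lemma concentration_le0 : J <= 0.
Proof.
rewrite leNgt; apply/negP => J0.
have juc l := jucont_mul_ext E1 (fc l X1).
have uc_fb l : ucont (fb l) by exact: (ucont_mean (juc l)).
have J2 : 0 < J / 2 by rewrite divr_gt0.
have [d d_gt0 dJ] := ucont_local (uc_fb l0) uc_t J2 fbJ t_le1.
(* The bound [d] keeps [fb l0] within J / 2 of [J], [d0] makes the family stationary, and 1 keeps 1
   - [dd] nonnegative. *)
pose dd := Num.min 1 (Num.min d d0).
have dd0 : 0 < dd by rewrite !lt_min ltr01 d_gt0 d0_gt0.
have dd1 : dd <= 1 by rewrite ge_min lexx.
have ddd : dd <= d by rewrite !ge_min lexx orbT.
have ddd0 : dd <= d0 by rewrite !ge_min lexx !orbT.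
pose A l g := mean (fun k => `|f l (X *m (g *m ext E k))|).
have jucA l : jucont (fun g k => `|f l (X *m (g *m ext E k))|).
  exact: (jucont_mul_ext E1 (ucont_norm (fc l X1))).
have ucA l : ucont (A l) by exact: (ucont_mean (jucA l)).
have A0 l g : stiefel g -> 0 <= A l g.
  by move=> g1; apply: mean_ge0 => //; exact: (jucont1 (jucA l)).
have fbA l g : stiefel g -> `|fb l g| <= A l g.
  by move=> g1; apply: mean_norm; exact: (jucont1 (juc l)).
have meanA l : mean (A l) <= C.
  apply: le_trans (bounded l); rewrite (mean_exchange (jucA l)).
  rewrite -[leRHS](mean_cst b); apply: mean_le.
  - exact: (ucont_mean (jucontC (jucA l))).
  - exact: ucont_cst.
  - move=> k k1; rewrite (mean_mulr (stiefel_ext E1 k1) (ucont_norm (fc l X1)))//.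
have tm0 g : 0 <= t g by exact: frob2_ge0.
(* Where [t] is at least 1 - [dd], the family is stationary and [fb l] is at least J / 2. Elsewhere
   [t ^ m] is at most (1 - dd) ^ m, and [fb l] is dominated by [A l], whose mean is bounded
   uniformly in [l]. *)
have pw l g m : (l0 <= l)%N -> stiefel g ->
    J / 2 * t g ^+ m - (J / 2 + A l g) * (1 - dd) ^+ m <= t g ^+ m * fb l g.
  move=> ll g1; have Alg := A0 l g g1.
  have [tg|tg] := leP (1 - dd) (t g).
    have -> : fb l g = fb l0 g.
      apply: eq_mean => k k1; apply: stationary => //.
        by do !apply: stiefelM => //; exact: stiefel_ext.
      move: tg; rewrite /t -!mulmxA ext_mul0// => tg; apply: le_trans tg.
      by rewrite lerB.
    have : `|fb l0 g - J| <= J / 2 by apply: dJ => //; apply: le_trans tg; rewrite lerB.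
    rewrite ler_norml => /andP[h _].
    have : 0 <= (1 - dd) ^+ m by rewrite exprn_ge0// subr_ge0.
    have : 0 <= t g ^+ m by rewrite exprn_ge0.
    by nra.
  have : t g ^+ m <= (1 - dd) ^+ m by rewrite lerXn2r// ?nnegrE ?subr_ge0// ltW.
  have : 0 <= t g ^+ m by rewrite exprn_ge0.
  have := fbA l g g1; rewrite ler_norml => /andP[h _].
  by nra.
have main m : J / 2 * mean (fun g => t g ^+ m) <= (J / 2 + C) * (1 - dd) ^+ m.
  apply/ler_addgt0Pr => eps eps0.
  have wU : exists w : 'M[R]_(1, q), stiefel w /\ w *m U^T = 0.
    have [|w w1 wU] := @stiefel_complement _ b 1 q U U1; first by rewrite qE addnC.
    by exists w.
  have [w [w1 wU0]] := wU.
  have [D D0 hD] := moment_bound pb qE Y1 U1 e1 w1 wU0 m.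
  have D1 : 0 < D + 1 by rewrite ltr_wpDl.
  have [|L hL] := small (eps := eps / (D + 1)); first by rewrite divr_gt0.
  pose l := maxn L l0.
  have := hL l (leq_maxl _ _); have := hD _ (fc l).
  rewrite -/X -/t -mean_fb => b1 b2.
  have b3 : mean (fun g => t g ^+ m * fb l g) <= eps.
    apply: le_trans (ler_norm _) _; apply: le_trans b1 _.
    apply: le_trans (ler_wpM2l D0 b2) _.
    rewrite mulrCA ler_piMr//; first exact: ltW.
    by rewrite ler_pdivrMr// mul1r lerDl.
  have uc1 : ucont (fun g => J / 2 * t g ^+ m) by apply: ucontZ; exact: ucontX.
  have uc2 : ucont (fun g => (J / 2 + A l g) * (1 - dd) ^+ m).
    by apply: ucontM; [apply: ucontD => //|]; exact: ucont_cst.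
  have : mean (fun g => J / 2 * t g ^+ m - (J / 2 + A l g) * (1 - dd) ^+ m) <=
         mean (fun g => t g ^+ m * fb l g).
    apply: mean_le; [exact: ucontB | by apply: ucontM => //; exact: ucontX |].
    by move=> g; apply: pw; exact: leq_maxr.
  rewrite meanB// meanZ; last exact: ucontX.
  under [X in _ - mean X <= _]eq_fun do rewrite mulrC.
  rewrite meanZ; last by apply: ucontD => //; exact: ucont_cst.
  rewrite meanD//; last exact: ucont_cst.
  rewrite mean_cst => b4; have := meanA l.
  have : 0 <= (1 - dd) ^+ m by rewrite exprn_ge0// subr_ge0.
  by nra.
(* A level strictly between 1 - [dd] and 1. [B] is the positive part of t - y: at most 1, of
   positive mean because [t] is 1 at [g0], and [y ^ m * B] lies below [t ^ m]. *)
pose y := 1 - dd / 2.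
have y0 : 0 <= y by rewrite /y; lra.
pose B (g : 'M[R]_q) := 2^-1 * (`|t g - y| + (t g - y)).
have ucty : ucont (fun g => t g - y) by apply: ucontB => //; exact: ucont_cst.
have ucB : ucont B by apply: ucontZ; apply: ucontD => //; exact: ucont_norm.
have B0 g : 0 <= B g.
  by rewrite /B; have [h|h] := ler0P (t g - y); lra.
have [g0 g01 Xg0] := stiefel_trans X1 (col1 Y'1).
have tg0 : t g0 = 1.
  rewrite /t Xg0 mul_col_mx -mulmxA Ee mulmx0 frob2E big_split_ord/= [X in _ + X]big1.
    rewrite big_ord1 big_ord1 addr0 col_mxEu (_ : e *m e^T = 1%:M) //.
    by rewrite mxE eqxx expr1n.
  by move=> i _; rewrite big1// => j _; rewrite col_mxEd mxE expr0n.
have mB : 0 < mean B.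
  apply: (mean_gt0 (g0 := g0)) => //.
  rewrite /B tg0 ger0_norm /y; lra.
apply: (@expr_dominated (1 - dd) y (J / 2 * mean B) (J / 2 + C)).
- by rewrite subr_ge0.
- by rewrite /y; lra.
- by rewrite mulr_gt0.
move=> m; apply: le_trans (main m); rewrite -mulrA; apply: ler_wpM2l; first exact: ltW.
rewrite mulrC -meanZ//.
apply: mean_le; [exact: ucontZ | exact: ucontX |] => g g1.
have yt := t_le1 g1.
rewrite /B; have [h|h] := ler0P (t g - y).
  by rewrite addNr mulr0 mulr0 exprn_ge0.
have : y ^+ m <= t g ^+ m by rewrite lerXn2r// ?nnegrE//; lra.
have : 0 <= y ^+ m by rewrite exprn_ge0.
by nra.
Qed.

End concentration.

Lemma concentration_eq0 p b q (Y : 'M[R]_(1 + p, b)) (U e E : 'M[R]_(_, q)) (Y' : 'M[R]_(p, b))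
    (f : nat -> 'M[R]_(1 + p, q) -> R) l0 C d0 :
  (1 + p <= b)%N -> q = (1 + b)%N -> stiefel Y -> stiefel U -> stiefel e ->
  stiefel E -> E *m e^T = 0 -> stiefel Y' ->
  (forall l, stcont (f l)) ->
  (forall l k X, stiefel k -> stiefel X -> f l (k *m X) = f l X) ->
  (forall eps, 0 < eps -> exists L, forall l, (L <= l)%N ->
    mean (fun g => `|mean (fun h => f l (Y *m h *m U *m g))|) <= eps) ->
  (forall l, mean (fun g : 'M[R]_q => `|f l (Y *m U *m g)|) <= C) ->
  0 < d0 ->
  (forall l X, (l0 <= l)%N -> stiefel X -> 1 - d0 <= frob2 (X *m e^T) -> f l X = f l0 X) ->
  mean (fun k => f l0 (col_mx e (Y' *m k *m E))) = 0.
Proof.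
move=> pb qE Y1 U1 e1 E1 Ee Y'1 fc finv small bnd d0_gt0 stat; apply/eqP.
rewrite eq_le (concentration_le0 pb qE Y1 U1 e1 E1 Ee Y'1 fc finv small bnd d0_gt0 stat)/=.
have X1 : stiefel (col_mx e (Y' *m E)).
  apply/stiefel_col; split; rewrite //; first exact: stiefelM.
  by rewrite -mulmxA Ee mulmx0.
have ucJ : ucont (fun k => f l0 (col_mx e (Y' *m k *m E))).
  apply: (eq_ucont _ (ucont_ext E1 (fc l0 _ X1))) => h h1.
  rewrite mul_col_mx -mulmxA mul_ext// mulmxA mul_ext0//.
  by rewrite -[LHS]trmxK trmx_mul trmxK Ee trmx0.
rewrite -oppr_le0 -meanN//.
have ucU l g : stiefel g -> ucont (fun h => f l (Y *m h *m U *m g)).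
  move=> g1; have YU1 : stiefel (Y *m U) by exact: stiefelM.
  have := ucont_ext U1 (ucont_mulr g1 (fc l _ YU1)).
  apply: eq_ucont => h h1.
  by rewrite mulmxA -(mulmxA Y) mul_ext// !mulmxA.
apply: (concentration_le0 (f := fun l X => - f l X) pb qE Y1 U1 e1 E1 Ee Y'1 _ _ _ _ d0_gt0).
- by move=> l X X1'; apply: ucontN; exact: fc.
- by move=> l k X k1 X1'; rewrite finv.
- move=> eps /small[L hL]; exists L => l /hL; congr (_ <= _); apply: eq_mean => g g1.
  by rewrite meanN ?normrN//; exact: ucU.
- by move=> l; apply: le_trans (bnd l); under eq_fun do rewrite normrN.
- by move=> l X ll X1' h; rewrite stat.
Qed.

Lemma stcont_mulr p q Q (f : 'M[R]_(p, Q) -> R) (W : 'M[R]_(q, Q)) : stiefel W ->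
  stcont f -> stcont (fun X => f (X *m W)).
Proof.
move=> W1 fc X X1; apply: (eq_ucont _ (ucont_ext W1 (fc _ (stiefelM X1 W1)))) => g g1.
by rewrite -mulmxA mul_ext// mulmxA.
Qed.

(** The concentration takes place in the (1 + b)-dimensional space spanned by [v] and [V]; [e] and
    [E] are [v] and [V] in its coordinates. *)
Lemma slice_mean_eq0 p b Q (Y : 'M[R]_(1 + p, b)) (U : 'M[R]_(b, 1 + b)) (v : 'M[R]_(1, Q))
    (f : nat -> 'M[R]_(1 + p, Q) -> R) l0 d0 (Y' : 'M[R]_(p, b)) (V : 'M[R]_(b, Q)) :
  (1 + p <= b)%N -> stiefel Y -> stiefel U -> stiefel v ->
  (forall l, stcont (f l)) ->
  (forall l k X, stiefel k -> stiefel X -> f l (k *m X) = f l X) ->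
  (forall W : 'M[R]_(1 + b, Q), stiefel W -> forall eps, 0 < eps ->
    exists L, forall l, (L <= l)%N ->
    mean (fun g => `|mean (fun h => f l (Y *m h *m U *m g *m W))|) <= eps) ->
  (forall W : 'M[R]_(1 + b, Q), stiefel W -> exists C, forall l,
    mean (fun g => `|f l (Y *m U *m g *m W)|) <= C) ->
  0 < d0 ->
  (forall l X, (l0 <= l)%N -> stiefel X -> 1 - d0 <= frob2 (X *m v^T) -> f l X = f l0 X) ->
  stiefel Y' -> stiefel V -> V *m v^T = 0 ->
  mean (fun k => f l0 (col_mx v (Y' *m k *m V))) = 0.
Proof.
move=> pb Y1 U1 v1 fc finv small bnd d0_gt0 stat Y'1 V1 Vv.
pose W := col_mx v V; have W1 : stiefel W by apply/stiefel_col.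
have [C hC] := bnd W W1.
pose e : 'M[R]_(1, 1 + b) := row_mx 1%:M 0.
pose E : 'M[R]_(b, 1 + b) := row_mx 0 1%:M.
have e1 : stiefel e by rewrite /stiefel tr_row_mx mul_row_col trmx1 mulmx1 trmx0 mulmx0 addr0.
have E1 : stiefel E by rewrite /stiefel tr_row_mx mul_row_col trmx1 mulmx1 trmx0 mulmx0 add0r.
have Ee : E *m e^T = 0 by rewrite tr_row_mx mul_row_col mul0mx trmx0 mulmx0 addr0.
have eW : e *m W = v by rewrite mul_row_col mul1mx mul0mx addr0.
have EW : E *m W = V by rewrite mul_row_col mul1mx mul0mx add0r.
have := @concentration_eq0 p b (1 + b) Y U e E Y' (fun l X => f l (X *m W)) l0 C d0 pb erefl
  Y1 U1 e1 E1 Ee Y'1.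
have -> : (fun k => f l0 (col_mx e (Y' *m k *m E) *m W)) =
    (fun k => f l0 (col_mx v (Y' *m k *m V))).
  by apply/funext => k; rewrite mul_col_mx eW -mulmxA EW.
apply => //.
- by move=> l; exact: stcont_mulr.
- by move=> l k X k1 X1; rewrite -mulmxA finv//; exact: stiefelM.
- by move=> eps; exact: small.
- move=> l X ll X1 h; apply: stat => //; first exact: stiefelM.
  rewrite (_ : X *m W *m v^T = X *m e^T)//.
  rewrite -mulmxA; congr (_ *m _); rewrite mul_col_mx v1 Vv.
  by rewrite tr_row_mx trmx1 trmx0.
Qed.

(** Injectivity of the transform from p-planes to b-planes, for continuous functions in dimension p
    + b. Invariance under changes of the frame makes [f] a function of planes. *)
Definition means_determine p b := forall f : 'M[R]_(p, p + b) -> R, stcont f ->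
  (forall k X, stiefel k -> stiefel X -> f (k *m X) = f X) ->
  (forall (Y : 'M[R]_(p, b)) (U : 'M[R]_(b, p + b)), stiefel Y -> stiefel U ->
    mean (fun h => f (Y *m h *m U)) = 0) ->
  forall X, stiefel X -> f X = 0.

(** As a function of frames orthogonal to [v], the function [f l0] of [v] and the frame has
    vanishing means by [slice_mean_eq0], so the induction hypothesis applies in the complement of
    [v]. The step serves twice: with a constant family for the induction, and with truncations for a
    singular function. *)
Lemma means_determine_step p b (Y : 'M[R]_(1 + p, b)) (U : 'M[R]_(b, 1 + b))
    (f : nat -> 'M[R]_(1 + p, 1 + (p + b)) -> R) l0 d0 (v : 'M[R]_(1, 1 + (p + b)))
    (X' : 'M[R]_(p, 1 + (p + b))) :
  means_determine p b -> (1 + p <= b)%N -> stiefel Y -> stiefel U -> stiefel (col_mx v X') ->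
  (forall l, stcont (f l)) ->
  (forall l k X, stiefel k -> stiefel X -> f l (k *m X) = f l X) ->
  (forall W : 'M[R]_(1 + b, 1 + (p + b)), stiefel W -> forall eps, 0 < eps ->
    exists L, forall l, (L <= l)%N ->
    mean (fun g => `|mean (fun h => f l (Y *m h *m U *m g *m W))|) <= eps) ->
  (forall W : 'M[R]_(1 + b, 1 + (p + b)), stiefel W -> exists C, forall l,
    mean (fun g => `|f l (Y *m U *m g *m W)|) <= C) ->
  0 < d0 ->
  (forall l X, (l0 <= l)%N -> stiefel X -> 1 - d0 <= frob2 (X *m v^T) -> f l X = f l0 X) ->
  f l0 (col_mx v X') = 0.
Proof.
move=> IH pb Y1 U1 X1 fc finv small bnd d0_gt0 stat.
have [v1 X'1 X'v] := (stiefel_col v X').1 X1.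
have [|E E1 Ev] := @stiefel_complement _ 1 (p + b) (1 + (p + b)) v v1; first by [].
have res := stiefel_resolution v1 E1 Ev erefl.
have XEE : X' *m E^T *m E = X'.
  by rewrite -[RHS]mulmx1 -res mulmxDr !mulmxA X'v mul0mx add0r.
have XE1 : stiefel (X' *m E^T) by rewrite /stiefel trmx_mul trmxK mulmxA XEE.
have colE (Z : 'M[R]_(p, p + b)) : stiefel Z -> stiefel (col_mx v (Z *m E)).
  move=> Z1; apply/stiefel_col; split => //; first exact: stiefelM.
  by rewrite -mulmxA Ev mulmx0.
have vE : v *m E^T = 0 by rewrite -[LHS]trmxK trmx_mul trmxK Ev trmx0.
rewrite -XEE; apply: (IH (fun Z => f l0 (col_mx v (Z *m E)))) => //.
- move=> Z Z1; apply: (eq_ucont _ (ucont_ext E1 (fc l0 _ (colE Z Z1)))) => g g1.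
  by rewrite mul_col_mx mul_ext0// -mulmxA mul_ext// mulmxA.
- move=> k Z k1 Z1; rewrite -[RHS](finv l0 (block_mx 1%:M 0 0 k) (col_mx v (Z *m E))).
  + by rewrite mul_block_col mul1mx !mul0mx addr0 add0r mulmxA.
  + by rewrite /stiefel tr_block_mx mulmx_block trmx1 !trmx0 !mulmx0 !mul0mx mulmx1 k1
      !addr0 add0r -scalar_mx_block.
  + exact: colE.
- move=> Y' U' Y'1 U'1.
  have := @slice_mean_eq0 p b _ Y U v f l0 d0 Y' (U' *m E) pb Y1 U1 v1 fc finv small bnd d0_gt0 stat Y'1.
  have -> : (fun k => f l0 (col_mx v (Y' *m k *m (U' *m E)))) =
            (fun k => f l0 (col_mx v (Y' *m k *m U' *m E))).
    by apply/funext => k; rewrite !mulmxA.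
  apply; first exact: stiefelM.
  by rewrite -mulmxA Ev mulmx0.
Qed.

Lemma means_determineP p b : (p <= b)%N -> means_determine p b.
Proof.
elim: p => [|p IH] pb f fc finv f0 X X1.
  (* For [p] equal to 0 there is only the empty frame, and the mean is the value there. *)
  have := f0 0 1%:M; rewrite /stiefel trmx1 mulmx1 => <- //; last by apply/matrixP => -[].
  rewrite -[LHS](mean_cst b); apply: eq_mean => h _; congr f.
  by apply/matrixP => -[].
have [v [X' XE]] : exists v X', X = col_mx v X' :> 'M[R]_(1 + p, p.+1 + b).
  exists (usubmx (X : 'M[R]_(1 + p, p.+1 + b))), (dsubmx (X : 'M[R]_(1 + p, p.+1 + b))).
  by rewrite vsubmxK.
have vX1 : stiefel (col_mx v X') by rewrite -XE.
have [Y Y1] := @stiefel_exists R p.+1 b pb.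
have [U U1] := @stiefel_exists R b (1 + b) (leq_addl _ _).
rewrite XE; apply: (means_determine_step (f := fun=> f) (l0 := 0) (IH (ltnW pb)) pb Y1 U1 vX1) => //.
- move=> W W1 eps eps0; exists 0 => l _.
  have -> : mean (fun g => `|mean (fun h => f (Y *m h *m U *m g *m W))|) = 0.
    rewrite -[RHS](mean_cst (1 + b)); apply: eq_mean => g g1.
    rewrite (_ : (fun h => _) = (fun h => f (Y *m h *m (U *m g *m W)))) ?f0 ?normr0//.
      by do !apply: stiefelM.
    by apply/funext => h; rewrite !mulmxA.
  exact: ltW.
- by move=> W W1; eexists => l; exact: lexx.
Qed.

End rank_one.

(** * Negative moments *)

Section negative_moments.
Variable R : realType.

Lemma ucont_comp_cont q (F : R -> R) (psi : 'M[R]_q -> R) : ucont psi ->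
  (forall g, stiefel g -> {for psi g, continuous F}) -> ucont (fun g => F (psi g)).
Proof.
move=> uc Fc; apply: ucont_of_cont => g eta g1 eta0.
have /cvgr_dist_le/(_ _ eta0) := Fc g g1.
case=> r /= r0 hr; have r2 : 0 < r / 2 by rewrite divr_gt0.
have [d d0 osc] := uc _ r2.
exists d => // h h1 hg; rewrite distrC; apply: hr => /=.
have := osc h g h1 g1 hg; rewrite distrC; move: r0; lra.
Qed.

Lemma powR_continuous (s x : R) : 0 < x -> {for x, continuous (fun y : R => y `^ s)}.
Proof.
move=> x0; apply/differentiable_continuous/derivable1_diffP.
by apply: derivable_powR; rewrite in_itv/= x0.
Qed.

Lemma powR_shift_continuous (s d x : R) : 0 < d -> 0 <= x ->
  {for x, continuous (fun y : R => (y + d) `^ s)}.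
Proof.
move=> d0 x0; apply: (@continuous_comp _ _ _ (fun y : R => y + d) (fun y => y `^ s)).
  by apply: cvgD; [exact: cvg_id | exact: cvg_cst].
by apply: powR_continuous; rewrite ltr_wpDl.
Qed.

Definition rot (a : R) : 'M[R]_(1 + 1) :=
  block_mx (cos a)%:M (sin a)%:M (- sin a)%:M (cos a)%:M.

Lemma stiefel_rot a : stiefel (rot a).
Proof.
rewrite /stiefel /rot tr_block_mx mulmx_block !tr_scalar_mx -!scalar_mxM -!raddfD/=.
rewrite (@scalar_mx_block _ 1 1).
have c2s2 := cos2Dsin2 a; congr block_mx.
- by rewrite -!expr2 c2s2.
- by rewrite (_ : _ + _ = 0) ?raddf0//; ring.
- by rewrite (_ : _ + _ = 0) ?raddf0//; ring.
- by rewrite mulrNN -!expr2 addrC c2s2.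
Qed.

Lemma rot_near0 r : 0 < r -> exists2 a0, 0 < a0 &
  forall a, 0 <= a < a0 -> frob2 (rot a - 1%:M) < r.
Proof.
move=> r0; have r4 : 0 < r / 4 by rewrite divr_gt0.
have /cvgr_dist_lt/(_ _ r4) := @continuous_cos R 0.
rewrite cos0; case=> a0 /= a00 h; exists a0 => // a /andP[a1 a2].
have : `|1 - cos a| < r / 4 by apply: h => /=; rewrite sub0r normrN ger0_norm.
have -> : rot a - 1%:M = block_mx (cos a - 1)%:M (sin a)%:M (- sin a)%:M (cos a - 1)%:M.
  rewrite /rot (@scalar_mx_block _ 1 1) opp_block_mx add_block_mx !oppr0 !addr0.
  by rewrite !raddfB.
have fs (c : R) : frob2 (c%:M : 'M[R]_1) = c ^+ 2.
  by rewrite frob2E !big_ord1 mxE eqxx.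
have -> (b c e f : 'M[R]_1) : frob2 (block_mx b c e f) = frob2 b + frob2 c + frob2 e + frob2 f.
  rewrite /frob2 tr_block_mx mulmx_block mxtrace_block !mxtraceD; ring.
rewrite !fs sqrrN => h1.
have := cos2Dsin2 a; move: h1; rewrite ltr_norml => /andP[h1 h2]; nra.
Qed.

Lemma derive_rotation (A B a : R) :
  is_derive a (1 : R) (fun z : R => cos z * A + sin z * B) (- sin a * A + cos a * B).
Proof.
have := is_deriveD (is_deriveZ A (is_derive_cos a)) (is_deriveZ B (is_derive_sin a)).
rewrite (_ : A \*: cos + B \*: sin = (fun z : R => cos z * A + sin z * B)); last first.
  by apply/funext => z /=; congr (_ + _); rewrite mulrC.
by move=> h; apply: is_derive_eq; congr (_ + _); rewrite mulrC.
Qed.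

Lemma derive_product_powR (f g h : R -> R) (s df dg dh a : R) : 0 < h a ->
  is_derive a (1 : R) f df -> is_derive a (1 : R) g dg -> is_derive a (1 : R) h dh ->
  is_derive a (1 : R) (fun z => f z * g z * h z `^ s)
    (f a * g a * (s * h a `^ (s - 1) * dh) + h a `^ s * (f a * dg + g a * df)).
Proof.
move=> h0 fd gd hd.
have dc := @is_derive1_comp R (fun y => y `^ s) h a _ _ (@is_derive1_powR R s (h a) h0) hd.
exact: (is_deriveM (is_deriveM fd gd) dc).
Qed.

(** [A' a] and [B' a] are the two coordinates of a vector in the plane of rotation after turning by
    [a]. Of the squares that make up [t] only that of [A] changes, so [t' a] is the value of t + d
    after the rotation. *)
Lemma rotated_derive (s d A B t a : R) : 0 < d -> A ^+ 2 <= t ->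
  let A' a := cos a * A + sin a * B in
  let B' a := - sin a * A + cos a * B in
  let t' a := t - A ^+ 2 + A' a ^+ 2 + d in
  is_derive a (1 : R) (fun a => A' a * B' a * t' a `^ (- s))
   ((B' a ^+ 2 - A' a ^+ 2) * t' a `^ (- s) - 2 * s * (A' a ^+ 2 * B' a ^+ 2) * t' a `^ (- s - 1)).
Proof.
move=> d0 tA A' B' t'.
have t0 : 0 < t' a.
  by rewrite /t' ltr_wpDl// addr_ge0 ?sqr_ge0// subr_ge0.
have dA : is_derive a (1 : R) A' (B' a) by exact: derive_rotation.
have dB : is_derive a (1 : R) B' (- A' a).
  have := derive_rotation B (- A) a; congr is_derive.
    by apply/funext => z; rewrite /B' mulrN mulNr addrC.
  by rewrite /A' opprD mulNr mulrN addrC.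
have dt : is_derive a (1 : R) t' (A' a * B' a + A' a * B' a).
  have := is_deriveD (is_deriveD (is_derive_cst (t - A ^+ 2) a 1) (is_deriveM dA dA))
    (is_derive_cst d a 1).
  rewrite add0r addr0; congr is_derive.
have := derive_product_powR (- s) t0 dA dB dt.
move: (A' a) (B' a) (t' a `^ _) (t' a `^ _) => x y z w {dA dB dt t0}.
by congr is_derive; ring.
Qed.

(** By invariance the increments of [Psi] along [E] have mean 0, and by the mean value theorem the
    difference quotients for small [a] are uniformly close to [D]. *)
Lemma mean_derive_eq0 q (E : R -> 'M[R]_q) (Psi D : 'M[R]_q -> R) :
  (forall a, stiefel (E a)) -> E 0 = 1%:M ->
  (forall r, 0 < r -> exists2 a0, 0 < a0 & forall a, 0 <= a < a0 -> frob2 (E a - 1%:M) < r) ->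
  ucont Psi -> ucont D ->
  (forall g a, stiefel g -> is_derive a (1 : R) (fun z => Psi (E z *m g)) (D (E a *m g))) ->
  mean D = 0.
Proof.
move=> E1 E0 Enear ucPsi ucD dPsi.
apply/eqP; rewrite -normr_le0; apply/ler_addgt0Pl => eps eps0; rewrite addr0.
have [r r0 osc] := ucD _ eps0; have [a0 a00 ha] := Enear _ r0.
pose a := a0 / 2; have a_gt0 : 0 < a by rewrite divr_gt0.
have aa0 : a < a0 by rewrite /a ltr_pdivrMr// ltr_pMr// ltr1n.
have key g : stiefel g -> `|(Psi (E a *m g) - Psi g) - a * D g| <= a * eps.
  move=> g1; have [|c cI] := @MVT R (fun z => Psi (E z *m g)) _ 0 a a_gt0 (fun z _ => dPsi g z g1).
    apply: derivable_within_continuous => z _.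
    by have dz := dPsi g z g1; exact: ex_derive.
  rewrite E0 mul1mx subr0 => ->.
  rewrite mulrC -mulrBr normrM gtr0_norm// ler_pM2l//; apply: osc => //.
    exact: stiefelM.
  rewrite -[X in _ - X](mul1mx g) -mulmxBl frob2_stiefelr//; apply: ha.
  by move: cI; rewrite in_itv/= => /andP[c0 ca]; rewrite ltW//= (lt_trans ca).
have ucPe := ucont_mull (E1 a) ucPsi.
have ucaD : ucont (fun g => a * D g) by exact: ucontZ.
have := mean_norm_le (ucontB (ucontB ucPe ucPsi) ucaD) key.
rewrite meanB//; last exact: ucontB.
rewrite meanB// mean_mull// subrr sub0r normrN meanZ// normrM gtr0_norm//.
by rewrite ler_pM2l.
Qed.

Section rotation.
Variables (p m q : nat) (X : 'M[R]_(p, q)) (Z : 'M[R]_(m, q)) (x : 'M[R]_(q, 1)).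
Hypotheses (X1 : stiefel X) (Z1 : stiefel Z) (ZX : Z *m X^T = 0).
Variables (i : 'I_p) (j : 'I_m) (s d : R).
Hypothesis d0 : 0 < d.

Let XZ : X *m Z^T = 0. Proof. by rewrite -[LHS]trmxK trmx_mul trmxK ZX trmx0. Qed.

(** The plane of rotation: [ext V (rot a)] turns row [i] of [X] towards row [j] of [Z] and fixes the
    orthogonal complement of both. *)
Let V : 'M[R]_(1 + 1, q) := col_mx (row i X) (row j Z).
Let A (g : 'M[R]_q) := (X *m g *m x) i 0.
Let B (g : 'M[R]_q) := (Z *m g *m x) j 0.
Let t (g : 'M[R]_q) := frob2 (X *m g *m x).

Let mul_row_tr k l r (C : 'M[R]_(k, q)) (D : 'M[R]_(l, q)) : C *m (row r D)^T = col r (C *m D^T).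
Proof. by apply/colP => a; rewrite !mxE; apply: eq_bigr => b _; rewrite !mxE. Qed.

Let V1 : stiefel V.
Proof.
apply/stiefel_col; split; rewrite /stiefel mul_row_tr -row_mul.
- by rewrite X1; apply/matrixP => a b; rewrite !ord1 !mxE !eqxx.
- by rewrite Z1; apply/matrixP => a b; rewrite !ord1 !mxE !eqxx.
- by rewrite ZX; apply/matrixP => a b; rewrite !mxE.
Qed.

Let extE h : ext V h = 1%:M + V^T *m (h *m V - V).
Proof. by rewrite /ext mulmxBr mulmxA addrCA. Qed.

Let XV : X *m V^T = row_mx (delta_mx i 0) 0.
Proof.
rewrite tr_col_mx mul_mx_row !mul_row_tr X1 XZ; congr row_mx.
  by apply/matrixP => a b; rewrite !mxE ord1 andbT.
by apply/matrixP => a b; rewrite !mxE.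
Qed.

Let ZV : Z *m V^T = row_mx 0 (delta_mx j 0).
Proof.
rewrite tr_col_mx mul_mx_row !mul_row_tr Z1 ZX; congr row_mx.
  by apply/matrixP => a b; rewrite !mxE.
by apply/matrixP => a b; rewrite !mxE ord1 andbT.
Qed.

Let rotV a : rot a *m V - V =
  col_mx ((cos a - 1) *: row i X + sin a *: row j Z)
         (- sin a *: row i X + (cos a - 1) *: row j Z).
Proof.
rewrite mul_block_col !mul_scalar_mx opp_col_mx add_col_mx; congr col_mx.
  by rewrite scalerBl scale1r addrAC.
by rewrite scalerBl scale1r addrA.
Qed.

Let Xext a i' g : (X *m (ext V (rot a) *m g) *m x) i' 0 =
  (X *m g *m x) i' 0 + (i' == i)%:R * ((cos a - 1) * A g + sin a * B g).
Proof.
rewrite mulmxA extE mulmxDr mulmx1 mulmxA XV rotV mul_row_col mul0mx addr0.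
rewrite !mulmxDl mxE; congr (_ + _).
rewrite -!mulmxA mxE big_ord1 mxE ord1 andbT; congr (_ * _).
rewrite !mulmxDl -!scalemxAl !mxE; congr (_ * _ + _ * _).
  by rewrite /A -mulmxA mxE; apply: eq_bigr => b _; rewrite !mxE.
by rewrite /B -mulmxA mxE; apply: eq_bigr => b _; rewrite !mxE.
Qed.

Let Zext a g : (Z *m (ext V (rot a) *m g) *m x) j 0 =
  (Z *m g *m x) j 0 + (- sin a * A g + (cos a - 1) * B g).
Proof.
rewrite mulmxA extE mulmxDr mulmx1 mulmxA ZV rotV mul_row_col mul0mx add0r.
rewrite !mulmxDl mxE; congr (_ + _).
rewrite -!mulmxA mxE big_ord1 mxE !eqxx mul1r.
rewrite !mulmxDl -!scalemxAl !mxE; congr (_ * _ + _ * _).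
  by rewrite /A -mulmxA mxE; apply: eq_bigr => b _; rewrite !mxE.
by rewrite /B -mulmxA mxE; apply: eq_bigr => b _; rewrite !mxE.
Qed.

Let A_ext a g : A (ext V (rot a) *m g) = cos a * A g + sin a * B g.
Proof. by rewrite /A Xext eqxx mul1r /A; ring. Qed.

Let B_ext a g : B (ext V (rot a) *m g) = - sin a * A g + cos a * B g.
Proof. by rewrite /B Zext /A /B; ring. Qed.

Let t_ext a g : t (ext V (rot a) *m g) = t g - A g ^+ 2 + (cos a * A g + sin a * B g) ^+ 2.
Proof.
rewrite -A_ext /t !frob2E (bigD1 i)//= [in RHS](bigD1 i)//= !big_ord1 -/(A _) -/(A g).
rewrite addrC [_ ^+ 2 + _]addrC addrK; congr (_ + _); apply: eq_bigr => i' i'i.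
by rewrite !big_ord1 Xext (negbTE i'i) mul0r addr0.
Qed.

Let tA g : A g ^+ 2 <= t g.
Proof. exact: sqr_entry_le. Qed.

Let ucA : ucont A. Proof. exact: ucont_entry. Qed.
Let ucB : ucont B. Proof. exact: ucont_entry. Qed.
Let uct : ucont t. Proof. exact: ucont_frob2. Qed.

Let ucP r : ucont (fun g => (t g + d) `^ r).
Proof.
apply: (ucont_comp_cont (F := fun y => (y + d) `^ r) uct) => g g1.
by apply: powR_shift_continuous => //; exact: frob2_ge0.
Qed.

(** Test function for an integration by parts on the group, with [D] as its derivative. The product
    of a coordinate inside the span of [X] and one outside is chosen so that the sum of the
    derivatives over [i] and [j] depends on [t] alone. *)
Let Psi g := A g * B g * (t g + d) `^ (- s).
Let D g := (B g ^+ 2 - A g ^+ 2) * (t g + d) `^ (- s) -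
           2 * s * (A g ^+ 2 * B g ^+ 2) * (t g + d) `^ (- s - 1).

Let ucPsi : ucont Psi. Proof. by apply: ucontM => //; exact: ucontM. Qed.

Let ucD : ucont D.
Proof.
apply: ucontB; apply: ucontM => //.
  by apply: ucontB; exact: ucontX.
by apply: ucontZ; apply: ucontM; exact: ucontX.
Qed.

Lemma rotation_mean_eq0 : mean D = 0.
Proof.
apply: (@mean_derive_eq0 _ (fun a => ext V (rot a)) Psi D).
- by move=> a; apply: stiefel_ext; [exact: V1 | exact: stiefel_rot].
- rewrite /rot cos0 sin0 oppr0 !raddf0 -scalar_mx_block.
  by rewrite /ext mulmx1 addrC subrK.
- move=> r r0; pose K := frob2 V ^+ 2 + 1.
  have K0 : 0 < K by rewrite ltr_wpDl// exprn_ge0// frob2_ge0.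
  have [|a0 a00 ha] := rot_near0 (r := r / K); first by rewrite divr_gt0.
  exists a0 => // a /ha ar.
  have <- : ext V 1%:M = 1%:M by rewrite /ext mulmx1 addrC subrK.
  apply: le_lt_trans (frob2_ext _ _ _) _.
  move: ar; rewrite ltr_pdivlMr; last exact: K0.
  move=> /(le_lt_trans _); apply; rewrite mulrC; apply: ler_wpM2l; first exact: frob2_ge0.
  by rewrite /K lerDl.
- exact: ucPsi.
- exact: ucD.
move=> g a _; rewrite /D A_ext B_ext t_ext.
have -> : (fun z => Psi (ext V (rot z) *m g)) =
    fun z => (cos z * A g + sin z * B g) * (- sin z * A g + cos z * B g) *
      (t g - A g ^+ 2 + (cos z * A g + sin z * B g) ^+ 2 + d) `^ (- s).
  by apply/funext => z; rewrite /Psi A_ext B_ext t_ext.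
exact: rotated_derive d0 (tA g).
Qed.

End rotation.
Lemma ler_powRN (s x y : R) : 0 <= s -> 0 < x -> x <= y -> y `^ (- s) <= x `^ (- s).
Proof.
move=> s0 x0 xy; have y0 := lt_le_trans x0 xy.
by rewrite !powRN lef_pV2 ?posrE ?powR_gt0// ge0_ler_powR// ?nnegrE ?ltW.
Qed.

Lemma ucont_powR p q r (X : 'M[R]_(p, q)) (x : 'M[R]_(q, r)) (s d : R) : 0 < d ->
  ucont (fun g => (frob2 (X *m g *m x) + d) `^ s).
Proof.
move=> d0; apply: (ucont_comp_cont (F := fun y => (y + d) `^ s) (ucont_frob2 X x)) => g g1.
by apply: powR_shift_continuous => //; exact: frob2_ge0.
Qed.

(* D i j is the derivative of an integrand along the rotations mixing the i-th row of X with
   the j-th row of its complement Z, hence has mean 0; summed over i and j it dominates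
   eta * (t + d) ^ (- s) up to a constant, precisely because 2 s < p. *)
Lemma negative_moment p q (X : 'M[R]_(p, q)) s : stiefel X -> 0 < s -> 2 * s < p%:R ->
  exists2 K, 0 < K & forall (x : 'M[R]_(q, 1)) d, frob2 x = 1 -> 0 < d ->
    mean (fun g => (frob2 (X *m g *m x) + d) `^ (- s)) <= K.
Proof.
move=> X1 s0 sp; have pq := stiefel_leq X1.
have p0 : 0 < p%:R :> R by apply: lt_trans sp; rewrite mulr_gt0.
have q0 : 0 < q%:R :> R by rewrite ltr0n (leq_trans _ pq)// -(ltr0n R).
have [|Z Z1 ZX] := @stiefel_complement _ p (q - p) q X X1; first by rewrite subnKC.
have res := stiefel_resolution X1 Z1 ZX (esym (subnKC pq)).
(* Half of the gap in 2 s < p. Where q t exceeds [eta], the power (t + d) ^ (- s) is at most (eta /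
   q) ^ (- s), which gives [C]. Neither depends on [d], so [d] can later tend to 0. *)
pose eta := (p%:R - 2 * s) / 2; have eta0 : 0 < eta by rewrite divr_gt0// subr_gt0.
pose C := q%:R * (eta / q%:R) `^ (- s).
have C0 : 0 < C by rewrite mulr_gt0// powR_gt0// divr_gt0.
exists (C / eta) => [|x d x1 d0]; first by rewrite divr_gt0.
pose t g := frob2 (X *m g *m x).
have uct : ucont t by exact: ucont_frob2.
have t01 g : stiefel g -> 0 <= t g <= 1.
  move=> g1; rewrite frob2_ge0/= /t -mulmxA.
  by apply: le_trans (frob2_stiefel_le _ X1) _; rewrite frob2_orthl// x1.
have tz g : stiefel g -> frob2 (Z *m g *m x) = 1 - t g.
  move=> g1; have := frob2_resolution (g *m x) res.
  by rewrite frob2_orthl// x1 !mulmxA -/(t g) => <-; ring.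
pose P r (g : 'M[R]_q) := (t g + d) `^ r.
have ucP r : ucont (P r) by exact: ucont_powR.
pose D i j g := ((Z *m g *m x) j 0 ^+ 2 - (X *m g *m x) i 0 ^+ 2) * P (- s) g -
  2 * s * ((X *m g *m x) i 0 ^+ 2 * (Z *m g *m x) j 0 ^+ 2) * P (- s - 1) g.
have ucA i : ucont (fun g => (X *m g *m x) i 0 ^+ 2) by apply/ucontX/ucont_entry.
have ucB j : ucont (fun g => (Z *m g *m x) j 0 ^+ 2) by apply/ucontX/ucont_entry.
have ucD i j : ucont (D i j).
  apply: ucontB; apply: ucontM => //; first exact: ucontB.
  by apply: ucontZ; apply: ucontM.
have sumD : mean (fun g => \sum_i \sum_j D i j g) = 0.
  rewrite mean_sum => [|i _]; last by apply: ucont_sum.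
  rewrite big1// => i _; rewrite mean_sum => [|//].
  by rewrite big1// => j _; exact: (rotation_mean_eq0 x X1 Z1 ZX i j s d0).
have ucS : ucont (fun g => \sum_i \sum_j D i j g) by do 2!apply: ucont_sum => ? _.
have sumE g : stiefel g -> \sum_i \sum_j D i j g =
    (p%:R - q%:R * t g) * P (- s) g - 2 * s * (t g * (1 - t g)) * P (- s - 1) g.
  move=> g1; have fE r (M : 'M[R]_(r, q)) :
      \sum_i (M *m g *m x) i 0 ^+ 2 = frob2 (M *m g *m x).
    by rewrite frob2E; apply: eq_bigr => i _; rewrite big_ord1.
  transitivity (\sum_i ((frob2 (Z *m g *m x) - (q - p)%:R * (X *m g *m x) i 0 ^+ 2) * P (- s) g -
      2 * s * ((X *m g *m x) i 0 ^+ 2 * frob2 (Z *m g *m x)) * P (- s - 1) g)).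
    apply: eq_bigr => i _; rewrite /D sumrB -mulr_suml sumrB fE sumr_const card_ord.
    by rewrite -mulr_suml -mulr_sumr -mulr_sumr fE [(q - p)%:R * _]mulr_natl.
  rewrite sumrB -mulr_suml sumrB sumr_const card_ord -mulr_sumr fE.
  rewrite -mulr_suml -mulr_sumr -mulr_suml fE tz// -/(t g).
  have -> : q%:R = p%:R + (q - p)%:R :> R by rewrite -natrD subnKC.
  by rewrite -[_ *+ p]mulr_natl; ring.
have pw g : stiefel g -> eta * P (- s) g - C <= \sum_i \sum_j D i j g.
  move=> g1; rewrite sumE//; have /andP[t0 t1] := t01 g g1.
  have td0 : 0 < t g + d by rewrite ltr_wpDl.
  have PE : P (- s) g = (t g + d) * P (- s - 1) g.
    rewrite /P -{2}(powRr1 (ltW td0)) -powRD ?(gt_eqF td0) ?implybT//.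
    by congr (_ `^ _); ring.
  have P10 : 0 <= P (- s - 1) g by exact: powR_ge0.
  have P0 : 0 <= P (- s) g by exact: powR_ge0.
  have b1 : t g * (1 - t g) * P (- s - 1) g <= P (- s) g.
    by rewrite PE ler_wpM2r//; nra.
  have b2 : q%:R * t g * P (- s) g <= eta * P (- s) g + C.
    have [h|h] := leP (q%:R * t g) eta.
      by apply: ler_wpDr; [exact: ltW | exact: ler_wpM2r].
    apply: ler_wpDl; first by rewrite mulr_ge0// ltW.
    rewrite /C -mulrA; apply: ler_wpM2l; first exact: ltW.
    apply: (@le_trans _ _ (P (- s) g)); first by rewrite ler_piMl.
    apply: ler_powRN; [exact: ltW | by rewrite divr_gt0 |].
    by rewrite ler_pdivrMr// mulrC; apply: (le_trans (ltW h)); rewrite ler_wpM2l ?ltW// ltrDl.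
  have b3 : 2 * s * (t g * (1 - t g) * P (- s - 1) g) <= 2 * s * P (- s) g.
    by rewrite ler_wpM2l// mulr_ge0// ltW.
  have etaE : 2 * eta = p%:R - 2 * s by rewrite /eta; field.
  have -> : (p%:R - q%:R * t g) * P (- s) g = p%:R * P (- s) g - q%:R * t g * P (- s) g.
    by ring.
  have -> : 2 * s * (t g * (1 - t g)) * P (- s - 1) g = 2 * s * (t g * (1 - t g) * P (- s - 1) g).
    by ring.
  have -> : p%:R = 2 * eta + 2 * s by rewrite etaE; ring.
  by move: b2 b3; lra.
have ucl : ucont (fun g => eta * P (- s) g - C).
  by apply: ucontB; [exact: ucontZ | exact: ucont_cst].
have := mean_le ucl ucS pw.
rewrite sumD meanB ?mean_cst ?meanZ//; [|exact: ucontZ|exact: ucont_cst].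
by rewrite subr_le0 ler_pdivlMr// mulrC.
Qed.

(** By homogeneity: normalize [x] and divide [d] by [frob2 x]. *)
Lemma negative_moment_scaled p q (X : 'M[R]_(p, q)) s : stiefel X -> 0 < s -> 2 * s < p%:R ->
  exists2 K, 0 < K & forall (x : 'M[R]_(q, 1)) d, 0 < frob2 x -> 0 < d ->
    mean (fun g => (frob2 (X *m g *m x) + d) `^ (- s)) <= K * frob2 x `^ (- s).
Proof.
move=> X1 s0 sp; have [K K0 hK] := negative_moment X1 s0 sp; exists K => // x d x0 d0.
pose r := Num.sqrt (frob2 x).
have r2 : r ^+ 2 = frob2 x by rewrite sqr_sqrtr// ltW.
have r0 : r != 0 by rewrite -sqrf_eq0 r2 gt_eqF.
have u1 : frob2 (r^-1 *: x) = 1 by rewrite frob2Z exprVn r2 mulVf// gt_eqF.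
have := hK _ (d / frob2 x) u1 (divr_gt0 d0 x0).
rewrite -(ler_pM2r (powR_gt0 (- s) x0)) mulrC -meanZ; last by apply: ucont_powR; exact: divr_gt0.
congr (_ <= _); apply: eq_mean => g g1.
rewrite -powRM; [congr (_ `^ _) | exact: ltW | by rewrite addr_ge0 ?frob2_ge0// divr_ge0// ltW].
rewrite -scalemxAr frob2Z exprVn r2 mulrDr mulVKf ?gt_eqF// mulrC divfK ?gt_eqF//.
Qed.

End negative_moments.

(** * Subspaces as row spaces *)

Lemma acos_in (R : realType) (x : R) : -1 <= x <= 1 -> acos x \in `[0, pi]%R.
Proof. by move=> xI; rewrite in_itv/= acos_ge0// acos_lepi. Qed.

Lemma ler_acos (R : realType) (x y : R) :
  -1 <= x <= 1 -> -1 <= y <= 1 -> (acos y <= acos x) = (x <= y).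
Proof.
move=> xI yI; rewrite !leNgt -(ltr_cos (acos_in xI) (acos_in yI)).
by rewrite !acosK ?in_itv.
Qed.

Section row_spaces.
Variables (R : realType) (n : nat).
Implicit Types (U V T : subspaces R n) (g : 'M[R]_n.+1).

Definition rsp m (X : 'M[R]_(m, n.+1)) : subspaces R n := limg (linfun (mulmxr X)).

Lemma mem_rspP m (X : 'M[R]_(m, n.+1)) v : reflect (exists w, v = w *m X) (v \in rsp X).
Proof.
apply: (iffP memv_imgP) => [[w _ ->]|[w ->]]; exists w => //; rewrite ?lfunE ?memvf//.
Qed.

Lemma mem_rotateP g U v : reflect (exists2 u, u \in U & v = u *m g) (v \in rotate g U).
Proof.
by apply: (iffP memv_imgP) => [[w wU ->]|[w wU ->]]; exists w; rewrite ?lfunE.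
Qed.

Lemma rotate_rsp m (X : 'M[R]_(m, n.+1)) g : rotate g (rsp X) = rsp (X *m g).
Proof.
apply/vspaceP => v; apply/mem_rotateP/mem_rspP.
  by move=> [u /mem_rspP[w ->] ->]; exists w; rewrite mulmxA.
by move=> [w ->]; exists (w *m X); rewrite ?mulmxA//; apply/mem_rspP; exists w.
Qed.

Lemma rsp_mull m p (A : 'M[R]_(m, p)) (B : 'M[R]_(p, m)) (X : 'M[R]_(p, n.+1)) :
  B *m (A *m X) = X -> rsp (A *m X) = rsp X.
Proof.
move=> BA; apply/vspaceP => v; apply/mem_rspP/mem_rspP => -[w ->].
  by exists (w *m A); rewrite mulmxA.
by exists (w *m B); rewrite -mulmxA BA.
Qed.

Lemma rsp_orth m (k : 'M[R]_m) (X : 'M[R]_(m, n.+1)) : stiefel k -> rsp (k *m X) = rsp X.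
Proof.
by move=> k1; apply: (@rsp_mull _ _ _ k^T); rewrite mulmxA stiefel_trl// mul1mx.
Qed.

Lemma dim_rsp m (X : 'M[R]_(m, n.+1)) : stiefel X -> \dim (rsp X) = m.
Proof.
move=> X1; rewrite /rsp limg_dim_eq ?dimvf//=.
  by rewrite /dim/= mul1n.
apply/eqP; rewrite capfv; apply/eqP/vspaceP => v; rewrite memv_ker lfunE/= memv0.
apply/eqP/eqP => [vX|->]; last by rewrite mul0mx.
by rewrite -(mulmx1 v) -X1 mulmxA vX mul0mx.
Qed.

Lemma orth_proj_mem U (v : 'rV[R]_n.+1) : v *m orth_proj U \in U.
Proof.
rewrite /orth_proj !mulmxA basis_mxE; apply: memv_suml => i _; apply: memvZ.
by apply/vbasis_mem/mem_nth; rewrite size_tuple.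
Qed.

Lemma mem_orth_proj U (v : 'rV[R]_n.+1) : (v \in U) = (v *m orth_proj U == v).
Proof.
apply/idP/eqP => [|<-]; [exact: orth_proj_id | exact: orth_proj_mem].
Qed.

Lemma orth_proj_inj : injective (@orth_proj R n).
Proof. by move=> U V UV; apply/vspaceP => v; rewrite !mem_orth_proj UV. Qed.

Lemma eq_mul_rV p q (A B : 'M[R]_(p, q)) : (forall v : 'rV[R]_p, v *m A = v *m B) -> A = B.
Proof. by move=> h; apply/row_matrixP => i; rewrite !rowE h. Qed.

Lemma orth_proj_rsp m (X : 'M[R]_(m, n.+1)) : stiefel X -> orth_proj (rsp X) = X^T *m X.
Proof.
move=> X1; apply: eq_mul_rV => v; pose P := X^T *m X.
have PP : P *m P = P by rewrite /P mulmxA -(mulmxA X^T) X1 mulmx1.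
rewrite -[in LHS](subrK (v *m P) v) mulmxDl orth_proj_orth.
  by rewrite add0r orth_proj_id//; apply/mem_rspP; exists (v *m X^T); rewrite mulmxA.
move=> u /mem_rspP[w ->]; rewrite /dotv trmx_mul mulmxBl mulmxA.
by rewrite /P -!mulmxA (mulmxA X X^T) X1 mul1mx subrr mxE.
Qed.

Lemma rsp_exists T m : \dim T = m -> exists2 X : 'M[R]_(m, n.+1), stiefel X & rsp X = T.
Proof.
move=> Tm; pose B := basis_mx T.
have rB : \rank B = m.
  rewrite -Tm; apply/eqP; rewrite -[_ == _]/(row_free B); apply/row_freeP.
  exists (B^T *m invmx (B *m B^T)); rewrite mulmxA mulmxV//; exact: gram_unit.
have z1 : stiefel (0 : 'M[R]_(0, n.+1)) by apply/matrixP => -[].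
have [||X [X1 _ XB]] := @stiefel_extend _ 0 m _ _ 0 B z1.
- exact: sub0mx.
- by rewrite rB.
exists X => //; apply/eqP; rewrite eqEdim dim_rsp// Tm leqnn andbT.
apply/subvP => v /mem_rspP[w ->]; have /submxP[D ->] := XB.
rewrite mulmxA /B basis_mxE; apply: memv_suml => i _; apply: memvZ.
by apply/vbasis_mem/mem_nth; rewrite size_tuple.
Qed.

Lemma rsp_sub m p (U : 'M[R]_(p, n.+1)) T : stiefel U -> \dim T = m -> (T <= rsp U)%VS ->
  exists2 Y : 'M[R]_(m, p), stiefel Y & T = rsp (Y *m U).
Proof.
move=> U1 /rsp_exists[X X1 <-] /subvP XU.
have XUU : X *m U^T *m U = X.
  apply: eq_mul_rV => v; rewrite !mulmxA -(mulmxA _ U^T) -orth_proj_rsp//.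
  by apply: orth_proj_id; apply: XU; apply/mem_rspP; exists v.
exists (X *m U^T); last by rewrite XUU.
by rewrite /stiefel trmx_mul trmxK mulmxA XUU.
Qed.

Lemma rspM_sub m p (Y : 'M[R]_(m, p)) (U : 'M[R]_(p, n.+1)) : (rsp (Y *m U) <= rsp U)%VS.
Proof.
by apply/subvP => v /mem_rspP[w ->]; apply/mem_rspP; exists (w *m Y); rewrite mulmxA.
Qed.

Definition perp U : subspaces R n := rsp (1%:M - orth_proj U).

Lemma perp_rsp m p (X : 'M[R]_(m, n.+1)) (Z : 'M[R]_(p, n.+1)) :
  stiefel X -> stiefel Z -> Z *m X^T = 0 -> (m + p)%N = n.+1 -> perp (rsp X) = rsp Z.
Proof.
move=> X1 Z1 ZX mp; rewrite /perp orth_proj_rsp//.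
rewrite -(stiefel_resolution X1 Z1 ZX (esym mp)) addrC addKr.
by apply: (@rsp_mull _ _ _ Z); rewrite mulmxA Z1 mul1mx.
Qed.

(** Simultaneous frames of a subspace and of its complement, which reduce the properties of [perp]
    to matrix identities. *)
Lemma perp_spec U : exists m p (X : 'M[R]_(m, n.+1)) (Z : 'M[R]_(p, n.+1)),
  [/\ [/\ stiefel X, stiefel Z & Z *m X^T = 0], (m + p)%N = n.+1, U = rsp X & perp U = rsp Z].
Proof.
have [X X1 XU] := rsp_exists (erefl (\dim U)).
have dU : (\dim U + (n.+1 - \dim U))%N = n.+1 by rewrite subnKC//; exact: stiefel_leq X1.
have [|Z Z1 ZX] := @stiefel_complement _ _ (n.+1 - \dim U) _ X X1; first by rewrite dU.
exists (\dim U), (n.+1 - \dim U)%N, X, Z; split => //.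
by rewrite -{1}XU; apply: perp_rsp.
Qed.

Lemma orth_proj_perp U : orth_proj (perp U) = 1%:M - orth_proj U.
Proof.
have [m [p [X [Z [[X1 Z1 ZX] mp -> ->]]]]] := perp_spec U.
rewrite !orth_proj_rsp// -(stiefel_resolution X1 Z1 ZX (esym mp)).
by rewrite addrC addKr.
Qed.

Lemma perpK : involutive perp.
Proof. by move=> U; apply: orth_proj_inj; rewrite !orth_proj_perp subKr. Qed.

Lemma dim_perp U : (\dim U + \dim (perp U))%N = n.+1.
Proof. by have [m [p [X [Z [[X1 Z1 ZX] mp -> ->]]]]] := perp_spec U; rewrite !dim_rsp. Qed.

Lemma perp_rotate g U : stiefel g -> perp (rotate g U) = rotate g (perp U).
Proof.
move=> g1; have [m [p [X [Z [[X1 Z1 ZX] mp -> ->]]]]] := perp_spec U.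
rewrite !rotate_rsp; apply: perp_rsp => //; try exact: stiefelM.
by rewrite trmx_mul mulmxA -(mulmxA Z) g1 mulmx1.
Qed.

Lemma orth_proj_sym U : (orth_proj U)^T = orth_proj U.
Proof.
have [X X1 <-] := rsp_exists (erefl (\dim U)).
by rewrite orth_proj_rsp// trmx_mul trmxK.
Qed.

Lemma subv_orth_proj U V : (U <= V)%VS = (orth_proj U *m orth_proj V == orth_proj U).
Proof.
apply/subvP/eqP => [UV|UV v].
  by apply: eq_mul_rV => v; rewrite mulmxA orth_proj_id//; apply/UV/orth_proj_mem.
by rewrite !mem_orth_proj => /eqP <-; rewrite -mulmxA UV.
Qed.

Lemma perpS U V : (U <= V)%VS -> (perp V <= perp U)%VS.
Proof.
rewrite !subv_orth_proj !orth_proj_perp => /eqP UV; apply/eqP.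
have VU : orth_proj V *m orth_proj U = orth_proj U.
  by rewrite -{1}(orth_proj_sym U) -{1}(orth_proj_sym V) -trmx_mul UV orth_proj_sym.
rewrite mulmxBr mulmx1 mulmxBl mul1mx VU.
by rewrite subrr subr0.
Qed.

Lemma perpS_iff U V : (perp V <= perp U)%VS = (U <= V)%VS.
Proof. by apply/idP/idP => /perpS; rewrite ?perpK. Qed.

(** The squared distance of the orthogonal projections; by [nbhs_pd] and [pd_nbhs] it induces the
    topology of [subspaces]. *)
Definition pd U V : R := frob2 (orth_proj U - orth_proj V).

Lemma pd_perp U V : pd (perp U) (perp V) = pd U V.
Proof. by rewrite /pd !orth_proj_perp opprB addrC subrKA frob2_subC. Qed.

Lemma orth_proj_rotate g U : stiefel g -> orth_proj (rotate g U) = g^T *m orth_proj U *m g.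
Proof.
move=> g1; have [X X1 <-] := rsp_exists (erefl (\dim U)).
by rewrite rotate_rsp !orth_proj_rsp ?trmx_mul ?mulmxA//; exact: stiefelM.
Qed.

Lemma pd_rotate g U V : stiefel g -> pd (rotate g U) (rotate g V) = pd U V.
Proof.
move=> g1; rewrite /pd !orth_proj_rotate// -mulmxBl -mulmxBr frob2_stiefelr//.
by rewrite frob2_orthl//; exact: stiefel_tr.
Qed.

(* The square of cos |U|, see pole_dist_acos. *)
Definition pole2 U : R := (north_pole *m orth_proj U *m north_pole^T) 0 0.

Lemma pole2_rsp m (X : 'M[R]_(m, n.+1)) : stiefel X -> pole2 (rsp X) = frob2 (X *m north_pole^T).
Proof.
move=> X1; rewrite /pole2 orth_proj_rsp// -(frob2_tr (X *m _)) /frob2 /mxtrace big_ord1.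
by rewrite !trmx_mul !trmxK !mulmxA.
Qed.

Lemma stiefel_pole : stiefel (north_pole : 'rV[R]_n.+1).
Proof.
apply/matrixP => i j; rewrite !ord1 !mxE (bigD1 ord_max)//= !mxE !eqxx mulr1.
by rewrite big1 ?addr0// => k kn; rewrite !mxE (negbTE kn) mul0r.
Qed.

Lemma pole2_ge0 U : 0 <= pole2 U.
Proof.
by have [X X1 <-] := rsp_exists (erefl (\dim U)); rewrite pole2_rsp// frob2_ge0.
Qed.

Lemma pole2_le1 U : pole2 U <= 1.
Proof.
have [X X1 <-] := rsp_exists (erefl (\dim U)); rewrite pole2_rsp//.
apply: le_trans (frob2_stiefel_le _ X1) _; rewrite frob2_tr.
by rewrite (stiefel_row1 _).1//; exact: stiefel_pole.
Qed.

Lemma pole2_perp U : pole2 (perp U) = 1 - pole2 U.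
Proof.
rewrite /pole2 orth_proj_perp mulmxBr mulmx1 mulmxBl mxE stiefel_pole.
by rewrite !mxE eqxx.
Qed.

Lemma pole2S U V : (U <= V)%VS -> pole2 U <= pole2 V.
Proof.
have [X X1 <-] := rsp_exists (erefl (\dim V)) => /(rsp_sub X1 erefl)[Y Y1 ->].
rewrite !pole2_rsp//; last exact: stiefelM.
by rewrite -mulmxA; exact: frob2_stiefel_le.
Qed.

(** By Cauchy-Schwarz, the largest inner product of the pole with a unit vector of [U] is the length
    of the projection of the pole to [U]. It is attained at the normalized projection or, if the
    projection is 0, at any unit vector of [U]. *)
Lemma pole_dist_acos U : (0 < \dim U)%N -> pole_dist U = acos (Num.sqrt (pole2 U)).
Proof.
have [m mE] : exists m, \dim U = m by exists (\dim U).
rewrite mE => U0; have [X X1 UX] := rsp_exists mE.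
have Xs : forall v : 'rV[R]_n.+1, sphere R n v -> v \in U -> dotv north_pole v <= Num.sqrt (pole2 U).
  move=> v v1; rewrite -UX => /mem_rspP[w vw].
  have w1 : frob2 w = 1.
    rewrite -(frob2_stiefelr w X1) -vw /frob2 /mxtrace big_ord1.
    exact: v1.
  apply: le_trans (ler_norm _) _; rewrite -sqrtr_sqr ler_sqrt ?pole2_ge0//.
  rewrite pole2_rsp// -[leRHS]mulr1 -w1 -(frob2_tr (X *m _)) -(frob2_tr w).
  apply: le_trans (frob2M _ _); apply: le_trans (sqr_entry_le _ 0 0).
  by rewrite /dotv vw trmx_mul trmx_mul trmxK mulmxA.
have Xe : exists2 v : 'rV[R]_n.+1, sphere R n v /\ v \in U & dotv north_pole v = Num.sqrt (pole2 U).
  have key (w : 'M[R]_(1, m)) : stiefel w -> sphere R n (w *m X) /\ w *m X \in U.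
    move=> w1; split; last by rewrite -UX; apply/mem_rspP; exists w.
    by rewrite /sphere /dotv/= (stiefelM w1 X1) mxE eqxx.
  have pE : pole2 U = frob2 (north_pole *m X^T).
    by rewrite -UX pole2_rsp// -frob2_tr trmx_mul trmxK.
  have [z|z] := eqVneq (north_pole *m X^T) 0.
    have [w w1] := @stiefel_exists R 1 m U0; exists (w *m X); first exact: key.
    by rewrite pE z frob2_0 sqrtr0 /dotv trmx_mul mulmxA z mul0mx mxE.
  exists ((Num.sqrt (frob2 (north_pole *m X^T)))^-1 *: (north_pole *m X^T) *m X).
    by apply: key; exact: stiefel_normalize.
  rewrite /dotv pE trmx_mul linearZ/= mulmxA -scalemxAr mxE.
  have -> : (north_pole *m X^T *m (north_pole *m X^T)^T) 0 0 = frob2 (north_pole *m X^T).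
    by rewrite /frob2 /mxtrace big_ord1.
  move: (frob2_ge0 (north_pole *m X^T)); rewrite le_eqVlt => /orP[/eqP <-|f0].
    by rewrite sqrtr0 invr0 mul0r.
  by rewrite -{2}(sqr_sqrtr (ltW f0)) expr2 mulKf// gt_eqF// sqrtr_gt0.
have [v [v1 vU] vE] := Xe.
have range (u : 'rV[R]_n.+1) : sphere R n u -> u \in U -> -1 <= dotv north_pole u <= 1.
  move=> u1 uU; rewrite -ler_norml -sqrtr_sqr -[leRHS]sqrtr1 ler_sqrt//.
  apply: le_trans (sqr_entry_le _ _ _) _; apply: le_trans (frob2M _ _) _.
  rewrite frob2_tr (stiefel_row1 _).1 ?mul1r; last exact: stiefel_pole.
  by rewrite /frob2 /mxtrace big_ord1; move: u1; rewrite /sphere/= /dotv => ->.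
rewrite /pole_dist; set A := [set _ | _ in _].
have lbA : lbound A (acos (Num.sqrt (pole2 U))).
  move=> _ [u [u1 uU] <-]; rewrite /geodist.
  by rewrite ler_acos ?Xs// ?range// -vE range.
have Av : A (acos (Num.sqrt (pole2 U))) by exists v; rewrite // /geodist vE.
apply/eqP; rewrite eq_le; apply/andP; split.
  by apply: ge_inf => //; exists (acos (Num.sqrt (pole2 U))).
by apply: lb_le_inf => //; exists (acos (Num.sqrt (pole2 U))).
Qed.

End row_spaces.

(** * Topology and measurability *)

Section topology.
Variables (R : realType) (n : nat).
Implicit Types (U V : subspaces R n) (A S : set (subspaces R n)).

Lemma nbhs_pd U A : nbhs U A -> exists2 r, 0 < r & forall V, pd V U < r -> A V.
Proof.
move=> [_ [[C oC <-] CU] CA].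
have /nbhs_ballP[e /= e0 eC] : nbhs (orth_proj U) C by exact: open_nbhs_nbhs.
exists (e ^+ 2) => [|V VU]; first by rewrite exprn_gt0.
apply/CA/eC; split => // i j; rewrite /ball/=.
have := le_lt_trans (sqr_entry_le (orth_proj V - orth_proj U) i j) VU.
rewrite !mxE -normrN opprB -[X in X < _]real_normK ?num_real//.
by rewrite ltr_pXn2r// nnegrE ltW.
Qed.

Lemma pd_nbhs U r : 0 < r -> nbhs U [set V | pd V U < r].
Proof.
move=> r0; apply: (@initial_continuous _ _ (@orth_proj R n) U [set M | frob2 (M - orth_proj U) < r]).
pose K := (n.+1 * n.+1)%:R : R; have K0 : 0 < K by rewrite ltr0n.
pose e := Num.min 1 (r / K); have e0 : 0 < e by rewrite lt_min ltr01 divr_gt0.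
have : nbhs (orth_proj U) (ball (orth_proj U) e) by exact: nbhsx_ballx.
apply: filterS => M [_ eM] /=; rewrite frob2E.
apply: (@lt_le_trans _ _ (\sum_(i < n.+1) \sum_(j < n.+1) r / K)); last first.
  by rewrite !sumr_const !card_ord -mulrnA -[_ *+ _]mulr_natl mulrC divfK// gt_eqF.
have ent i j : (M - orth_proj U) i j ^+ 2 < r / K.
  have : `|M i j - orth_proj U i j| < e by rewrite distrC; exact: eM.
  rewrite !mxE -[X in _ -> X < _]real_normK ?num_real//.
  rewrite /e lt_min => /andP[x1 xr]; apply: le_lt_trans xr.
  by rewrite expr2 ler_piMr// ltW.
apply: ltr_sum => [|i _]; first by apply/hasP; exists ord0; rewrite // mem_index_enum.
apply: ltr_sum => [|j _]; first by apply/hasP; exists ord0; rewrite // mem_index_enum.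
exact: ent.
Qed.

Lemma open_pd A : (forall U, A U -> exists2 r, 0 < r & forall V, pd V U < r -> A V) -> open A.
Proof.
move=> h; rewrite openE => U /h[r r0 rA].
by have := pd_nbhs U r0; apply: filterS => V; exact: rA.
Qed.

Lemma measurable_open A : open A -> measurable (A : set (borel_subspaces R n)).
Proof. by move=> oA; apply: sub_sigma_algebra. Qed.

(** Young's inequality with a weight. Balls of the squared distance [pd] are shown to be open by
    taking [t] small, which brings the factor of [frob2 B] close to 1; the factor 2 of [frob2D]
    would be too large. *)
Lemma frob2D_weighted p q (A B : 'M[R]_(p, q)) t : 0 < t ->
  frob2 (A + B) <= (1 + t^-1) * frob2 A + (1 + t) * frob2 B.
Proof.
move=> t0; rewrite !frob2E !mulr_sumr -big_split; apply: ler_sum => i _ /=.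
rewrite !mulr_sumr -big_split; apply: ler_sum => j _ /=; rewrite mxE -subr_ge0.
have -> : (1 + t^-1) * A i j ^+ 2 + (1 + t) * B i j ^+ 2 - (A i j + B i j) ^+ 2 =
  t^-1 * (A i j - t * B i j) ^+ 2 by field; rewrite gt_eqF.
by rewrite mulr_ge0 ?sqr_ge0// invr_ge0 ltW.
Qed.

Lemma pd_open U V d : pd V U < d -> exists2 r, 0 < r & forall W, pd W V < r -> pd W U < d.
Proof.
move=> VU; set v := pd V U in VU; have v0 : 0 <= v by exact: frob2_ge0.
have dv : 0 < d - v by rewrite subr_gt0.
have v1 : 0 < v + 1 by rewrite ltr_wpDl.
pose t := (d - v) / (2 * (v + 1)); have t0 : 0 < t by rewrite divr_gt0// mulr_gt0.
have t1 : 0 < 1 + t^-1 by rewrite addr_gt0// invr_gt0.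
exists ((d - v) / 2 / (1 + t^-1)) => [|W WV]; first by rewrite !divr_gt0.
have := frob2D_weighted (orth_proj W - orth_proj V) (orth_proj V - orth_proj U) t0.
rewrite subrKA -/(pd W U) -/(pd W V) -/(pd V U) -/v => /le_lt_trans; apply.
move: WV; rewrite ltr_pdivlMr// mulrC => WV.
have tv : t * v <= (d - v) / 2.
  rewrite /t mulrAC ler_pdivrMr ?mulr_gt0//.
  have -> : (d - v) / 2 * (2 * (v + 1)) = (d - v) * (v + 1) by field.
  by rewrite ler_wpM2l ?(ltW dv)// lerDl.
by move: WV tv; rewrite [(1 + t) * v]mulrDl mul1r; lra.
Qed.

Definition pdcont S (f : subspaces R n -> R) := forall U eta, S U -> 0 < eta ->
  exists2 d, 0 < d & forall V, S V -> pd V U < d -> `|f V - f U| <= eta.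

Lemma pdcont_measurable S f : pdcont S f -> measurable (S : set (borel_subspaces R n)) ->
  measurable_fun (S : set (borel_subspaces R n)) f.
Proof.
move=> fc mS _; apply: (measurability _ (RGenOInfty.measurableE R)) => //.
move=> /= _ [_ [a ->] <-]; rewrite preimage_itvoy.
(* The union of the balls on which [f] exceeds [a] at the points of [S]: an open set whose trace on
   [S] is the superlevel set. *)
pose O := [set V | exists U d, [/\ S U, 0 < d, pd V U < d &
  forall W, S W -> pd W U < d -> a < f W]].
have -> : S `&` [set x | a < f x] = S `&` O.
  apply/seteqP; split=> V [SV].
    move=> /= aV; split => //; have e0 : 0 < (f V - a) / 2 by rewrite divr_gt0// subr_gt0.
    have [d d0 h] := fc V _ SV e0; exists V, d; split => //.
      by rewrite /pd subrr frob2_0.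
    move=> W SW /(h W SW); rewrite ler_norml => /andP[h1 _]; move: e0 h1.
    by move: (f V) (f W) => x y; lra.
  by move=> [U [d [SU d0 VU h]]]; split => //; exact: h.
apply: measurableI => //; apply: measurable_open; apply: open_pd => V [U [d [SU d0 VU h]]].
have [r r0 hr] := pd_open VU.
exists r => // W WV; exists U, d; split => //; exact: hr.
Qed.

Lemma pdcont_sub S S' f : S' `<=` S -> pdcont S f -> pdcont S' f.
Proof.
move=> SS fc U eta SU eta0; have [d d0 h] := fc U eta (SS _ SU) eta0.
by exists d => // V SV; apply: h; exact: SS.
Qed.

Lemma pdcont_entry (i j : 'I_n.+1) : pdcont setT (fun U => orth_proj U i j).
Proof.
move=> U eta _ eta0; exists (eta ^+ 2) => [|V _ VU]; first by rewrite exprn_gt0.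
have := le_trans (sqr_entry_le (orth_proj V - orth_proj U) i j) (ltW VU).
rewrite !mxE -[X in X <= _]real_normK ?num_real//.
by rewrite ler_pXn2r// nnegrE ltW.
Qed.

Lemma measurable_orth_proj (i j : 'I_n.+1) :
  measurable_fun [set: borel_subspaces R n] (fun U => orth_proj (U : subspaces R n) i j).
Proof. exact: pdcont_measurable (pdcont_entry i j) measurableT. Qed.

Lemma measurable_mul_orth_proj p q (A : 'M[R]_(p, n.+1)) (B : 'M[R]_(n.+1, q)) i j :
  measurable_fun [set: borel_subspaces R n]
    (fun U => (A *m orth_proj (U : subspaces R n) *m B) i j).
Proof.
under eq_fun => U do rewrite mxE; apply: measurable_sum => k.
apply: measurable_funM => //; under eq_fun => U do rewrite mxE.
by apply: measurable_sum => l; apply: measurable_funM => //; exact: measurable_orth_proj.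
Qed.

Lemma measurable_pole2 : measurable_fun [set: borel_subspaces R n]
  (fun U => pole2 (U : subspaces R n)).
Proof. exact: measurable_mul_orth_proj. Qed.

Lemma measurable_pd_isometry (k : subspaces R n -> subspaces R n) :
  (forall U V, pd (k U) (k V) = pd U V) ->
  measurable_fun [set: borel_subspaces R n] (k : borel_subspaces R n -> borel_subspaces R n).
Proof.
move=> kpd; apply: (@measurability _ _ (borel_subspaces R n) (borel_subspaces R n) setT k
  (@open (subspaces R n))) => // _ [A oA <-].
rewrite setTI.
apply: measurable_open; apply: open_pd => U /= AU.
have [|r r0 rA] := @nbhs_pd (k U) A; first exact: open_nbhs_nbhs.
by exists r => // V VU; apply: rA; rewrite kpd.
Qed.

Lemma trace_orth_proj U : \tr (orth_proj U) = (\dim U)%:R.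
Proof.
have [X X1 XU] := rsp_exists (erefl (\dim U)).
by rewrite -{1}XU orth_proj_rsp// mxtrace_mulC X1 mxtrace1.
Qed.

(** The dimension is the trace of the projection, and inclusion in [V] is an identity between
    projections, checked entry by entry. The factor [1%:M] gives these entries the shape of
    [measurable_mul_orth_proj]. *)
Lemma measurable_subspaces_in j V : measurable (subspaces_in j V : set (borel_subspaces R n)).
Proof.
have -> : subspaces_in j V = (fun U => \tr (orth_proj U)) @^-1` [set j.+1%:R] `&`
   \bigcap_(ij in [set: 'I_n.+1 * 'I_n.+1])
     (fun U => (1%:M *m orth_proj U *m (orth_proj V - 1%:M)) ij.1 ij.2) @^-1` [set 0].
  apply/seteqP; split=> U; rewrite /subspaces_in /Grass/=.
    move=> [dU]; rewrite subv_orth_proj => /eqP UV; split; first by rewrite trace_orth_proj dU.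
    by move=> [i j'] _ /=; rewrite mul1mx mulmxBr mulmx1 UV subrr mxE.
  move=> [/eqP]; rewrite trace_orth_proj eqr_nat => /eqP dU UV; split => //.
  rewrite subv_orth_proj -subr_eq0; apply/eqP/matrixP => i j'.
  by have := UV (i, j') I; rewrite /= mul1mx mulmxBr mulmx1 !mxE.
apply: measurableI.
  rewrite -[X in measurable X]setTI.
  have mt : measurable_fun [set: borel_subspaces R n] (fun U => \tr (orth_proj (U : subspaces R n))).
    by rewrite /mxtrace; apply: measurable_sum => i; exact: measurable_orth_proj.
  by apply: mt => //; exact: measurable_set1.
apply: fin_bigcap_measurable => [|ij _]; first exact: finite_finset.
rewrite -[X in measurable X]setTI.
by apply: measurable_mul_orth_proj => //; exact: measurable_set1.
Qed.

End topology.

Section rsp_continuity.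
Variables (R : realType) (n : nat).

Lemma pd_rsp_le m (A B : 'M[R]_(m, n.+1)) : stiefel A -> stiefel B ->
  pd (rsp A) (rsp B) <= 4 * m%:R * frob2 (A - B).
Proof.
move=> A1 B1; rewrite /pd !orth_proj_rsp//.
have -> : A^T *m A - B^T *m B = A^T *m (A - B) + (A - B)^T *m B.
  by rewrite mulmxBr linearB/= mulmxBl addrA subrK.
apply: le_trans (frob2D _ _) _.
have := frob2M A^T (A - B); have := frob2M (A - B)^T B.
by rewrite !frob2_tr (frob2_stiefel A1) (frob2_stiefel B1); lra.
Qed.

Lemma ucont_rsp p q (S : set (subspaces R n)) f (Y : 'M[R]_(p, q)) (W : 'M[R]_(q, n.+1)) :
  pdcont S f -> stiefel Y -> stiefel W ->
  (forall g, stiefel g -> S (rsp (Y *m g *m W))) ->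
  ucont (fun g => f (rsp (Y *m g *m W))).
Proof.
move=> fc Y1 W1 SY; apply: ucont_of_cont => g eta g1 eta0.
have [d d0 h] := fc _ eta (SY g g1) eta0.
pose K := 4 * p%:R * p%:R + 1 : R.
have K0 : 0 < K by rewrite ltr_wpDl// !mulr_ge0.
exists (d / K) => [|g' g'1]; first by rewrite divr_gt0.
rewrite ltr_pdivlMr// => gg; apply: h; first exact: SY.
apply: le_lt_trans gg.
have S1 k : stiefel k -> stiefel (Y *m k *m W) by move=> k1; do !apply: stiefelM.
apply: le_trans (pd_rsp_le (S1 _ g'1) (S1 _ g1)) _.
rewrite -mulmxBl frob2_stiefelr// -mulmxBr.
have := frob2M Y (g' - g); rewrite (frob2_stiefel Y1) /K => h1.
have := frob2_ge0 (g' - g); have : 0 <= p%:R :> R by [].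
by move: h1; move: (frob2 _) (frob2 _) p%:R => x y z; nra.
Qed.

Lemma rotateK (g : 'M[R]_n.+1) : stiefel g -> cancel (@rotate R n g) (rotate g^T).
Proof.
move=> g1 T; have [X X1 <-] := rsp_exists (erefl (\dim T)).
by rewrite !rotate_rsp -mulmxA g1 mulmx1.
Qed.

Lemma subspaces_in_rsp j b (Y : 'M[R]_(j.+1, b)) (U : 'M[R]_(b, n.+1)) :
  stiefel Y -> stiefel U -> subspaces_in j (rsp U) (rsp (Y *m U)).
Proof.
by move=> Y1 U1; split; [rewrite /Grass/= dim_rsp//; exact: stiefelM | exact: rspM_sub].
Qed.

Lemma subspaces_in_ext j b (U : 'M[R]_(b, n.+1)) h T : stiefel U -> stiefel h ->
  subspaces_in j (rsp U) T -> subspaces_in j (rsp U) (rotate (ext U h) T).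
Proof.
move=> U1 h1 [dT /(rsp_sub U1 dT)[Y Y1 ->]].
by rewrite rotate_rsp -mulmxA mul_ext// mulmxA; apply: subspaces_in_rsp => //; exact: stiefelM.
Qed.

End rsp_continuity.

(** * Invariant probabilities and the Haar mean *)

Section bounded_integrals.
Context d (T : measurableType d) (R : realType) (P : probability T R).

Lemma bounded_integrable (D : set T) (f : T -> R) M : measurable D -> measurable_fun D f ->
  (forall x, D x -> `|f x| <= M) -> P.-integrable D (EFin \o f).
Proof.
move=> mD mf fM; apply: measurable_bounded_integrable => //.
  by apply: le_lt_trans (probability_le1 P mD) _; rewrite ltry.
exists M; split=> [|y My x Dx]; first exact: num_real.
by apply: le_trans (ltW My); exact: fM.
Qed.

Lemma measurable_sum_seq (D : set T) (I : eqType) (s : seq I) (F : I -> T -> R) :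
  (forall i, i \in s -> measurable_fun D (F i)) ->
  measurable_fun D (fun x => \sum_(i <- s) F i x).
Proof.
elim: s => [|i s IH] mF.
  by under eq_fun do rewrite big_nil; exact: measurable_cst.
under eq_fun do rewrite big_cons; apply: measurable_funD.
  by apply: mF; rewrite mem_head.
by apply: IH => k ks; apply: mF; rewrite inE ks orbT.
Qed.

Lemma Rintegral_sum (D : set T) (I : eqType) (s : seq I) (F : I -> T -> R) M : measurable D ->
  (forall i, i \in s -> measurable_fun D (F i)) ->
  (forall i x, i \in s -> D x -> `|F i x| <= M) ->
  \int[P]_(x in D) (\sum_(i <- s) F i x) = \sum_(i <- s) \int[P]_(x in D) F i x.
Proof.
move=> mD; elim: s => [|i s IH] mF FM.
  under eq_fun do rewrite big_nil.
  by rewrite big_nil Rintegral_cst// mul0r.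
have ms k : k \in s -> measurable_fun D (F k) by move=> ks; apply: mF; rewrite inE ks orbT.
have bs k x : k \in s -> D x -> `|F k x| <= M by move=> ks; apply: FM; rewrite inE ks orbT.
under eq_fun do rewrite big_cons.
rewrite RintegralD ?IH ?big_cons//.
  by apply: (@bounded_integrable _ _ M) => // [|x]; [apply: mF|apply: FM]; rewrite mem_head.
apply: (@bounded_integrable _ _ (\sum_(k <- s) M)) => //.
  exact: measurable_sum_seq.
move=> x Dx; apply: le_trans (ler_norm_sum _ _ _) _.
by rewrite big_seq [leRHS]big_seq; apply: ler_sum => k ks; exact: bs.
Qed.

Lemma Rintegral_invariant (theta : T -> T) (f : T -> R) M : measurable_fun setT theta ->
  (forall A, measurable A -> P (theta @^-1` A) = P A) ->
  measurable_fun setT f -> (forall x, `|f x| <= M) ->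
  \int[P]_x f (theta x) = \int[P]_x f x.
Proof.
move=> mt Pt mf fM; rewrite /Rintegral; congr fine.
pose th : {mfun T >-> T} := HB.pack theta (isMeasurableFun.Build _ _ _ _ _ mt).
transitivity (\int[pushforward P th]_x (f x)%:E)%E.
  rewrite (@integral_pushforward _ _ _ _ _ _ mt P setT (EFin \o f))//.
    exact/measurable_EFinP.
  rewrite preimage_setT; apply: (@bounded_integrable _ (f \o theta) M) => // [|x _].
    exact: measurableT_comp.
  exact: fM.
have H := @eq_measure_integral _ T R setT P (pushforward P th) (fun x => (f x)%:E).
by apply: (H mt) => A mA _; exact: Pt.
Qed.

End bounded_integrals.

Section invariant_integral.
Variables (R : realType) (n j b : nat).
(* kappa is the identity for the Radon transform and the orthogonal complement for its dual. *)
Variables (P : probability (borel_subspaces R n) R) (kappa : subspaces R n -> subspaces R n).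
Variables (U : 'M[R]_(b, n.+1)) (Y0 : 'M[R]_(j.+1, b)).
Hypotheses (U1 : stiefel U) (Y01 : stiefel Y0).
Hypothesis kappa_pd : forall V W, pd (kappa V) (kappa W) = pd V W.
Hypothesis kappa_rotate : forall g V, stiefel g -> kappa (rotate g V) = rotate g (kappa V).

(** For the complement as [kappa], these are the subspaces containing the complement of [rsp U]
    whose own complement has dimension j + 1. *)
Definition fiber : set (borel_subspaces R n) := kappa @^-1` subspaces_in j (rsp U).
Local Notation S := fiber.

Hypothesis PS : P S = 1%E.
Hypothesis Pinv : forall g, stiefel g -> rotate g (rsp U) = rsp U ->
  forall A : set (borel_subspaces R n), measurable A -> P (rotate g @^-1` A) = P A.

Lemma measurable_fiber : measurable S.
Proof.
rewrite /fiber -[X in measurable X]setTI.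
exact: (measurable_pd_isometry kappa_pd measurableT (measurable_subspaces_in _ _)).
Qed.

Lemma rotate_fiber h V : stiefel h -> S (rotate (ext U h) V) <-> S V.
Proof.
move=> h1; have e1 := stiefel_ext U1 h1; rewrite /fiber /preimage/= kappa_rotate//.
split => [|SV]; last exact: subspaces_in_ext.
move=> /(subspaces_in_ext U1 (stiefel_tr h1)).
by rewrite -tr_ext rotateK.
Qed.

Lemma measurable_fiber_fun (D : set (subspaces R n)) f : pdcont D f ->
  measurable (kappa @^-1` D : set (borel_subspaces R n)) ->
  measurable_fun (kappa @^-1` D : set (borel_subspaces R n)) (f \o kappa).
Proof.
move=> fc; apply: pdcont_measurable => V eta DV eta0.
have [d d0 h] := fc _ eta DV eta0; exists d => // W DW WV.
by apply: h => //; rewrite kappa_pd.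
Qed.

(** Uniqueness of the invariant probability. By invariance the integrand may be replaced by its
    average over finitely many rotations from a net. As the rotations of [rsp U] act transitively on
    its subspaces of a given dimension, this average is at every point uniformly close to the Haar
    mean. *)
Lemma Rintegral_fiber f M : pdcont (subspaces_in j (rsp U)) f ->
  (forall V, subspaces_in j (rsp U) V -> `|f V| <= M) ->
  \int[P]_(x in S) f (kappa x) = mean (fun h => f (rsp (Y0 *m h *m U))).
Proof.
move=> fc fM; pose psi h := f (rsp (Y0 *m h *m U)).
have SY h : stiefel h -> subspaces_in j (rsp U) (rsp (Y0 *m h *m U)).
  by move=> h1; apply: subspaces_in_rsp => //; exact: stiefelM.
have ucpsi : ucont psi by exact: ucont_rsp fc Y01 U1 SY.
have mS := measurable_fiber.
(* Extended by 0 outside the fiber, since the invariance of [P] is used for functions on the whole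
   space. *)
pose phi : borel_subspaces R n -> R := (f \o kappa) \_ S.
pose rot h : borel_subspaces R n -> borel_subspaces R n := rotate (ext U h).
have mphi : measurable_fun setT phi.
  apply/(measurable_restrictT _ mS); exact: measurable_fiber_fun.
have phiM x : `|phi x| <= `|M|.
  rewrite /phi patchE; case: ifPn => [|_]; last by rewrite normr0.
  by rewrite inE => Sx; apply: le_trans (ler_norm M); exact: fM.
have mrot h : stiefel h -> measurable_fun setT (rot h).
  move=> h1; apply: measurable_pd_isometry => V W; apply: pd_rotate.
  exact: stiefel_ext.
have mphirot h : stiefel h -> measurable_fun setT (phi \o rot h).
  by move=> h1; apply: measurableT_comp => //; exact: mrot.
apply/eqP; rewrite -subr_eq0 -normr_le0.
apply/ler_addgt0Pl => e e0; rewrite addr0.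
have e2 : 0 < e / 2 by rewrite divr_gt0.
have [d d0 osc] := ucpsi _ e2; have [X netX hX] := mean_net b (e / 2) d0.
have invphi h : h \in X -> \int[P]_(x in S) phi (rot h x) = \int[P]_(x in S) f (kappa x).
  move=> /netX.1 h1; have e1 := stiefel_ext U1 h1.
  have rotU : rotate (ext U h) (rsp U) = rsp U.
    by rewrite rotate_rsp mul_ext// rsp_orth.
  rewrite [RHS]Rintegral_mkcond -/phi [LHS]Rintegral_mkcond.
  have -> : ((fun x => phi (rot h x)) \_ S) = phi \o rot h.
    apply/funext => x; rewrite patchE; case: ifPn => //; rewrite notin_setE => nSx /=.
    rewrite /phi patchE memNset// => Sx; apply: nSx.
    exact: (rotate_fiber x h1).1.
  by apply: (Rintegral_invariant (mrot h h1)) phiM => // A mA; exact: Pinv e1 rotU A mA.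
have mX h : h \in X -> measurable_fun S (phi \o rot h).
  by move=> /netX.1 h1; apply: measurable_funTS; exact: mphirot.
have iavg : P.-integrable S (EFin \o (fun x => avg X (fun h => phi (rot h x)))).
  apply: (@bounded_integrable _ _ _ P _ _ `|M|) => // [|x Sx].
    apply: measurable_funM => //; exact: measurable_sum_seq.
  apply: le_trans (avg_norm _ _) _; rewrite -[leRHS](avg_cst `|M| netX).
  by apply: avg_le => h _.
have avgE : \int[P]_(x in S) f (kappa x) = \int[P]_(x in S) avg X (fun h => phi (rot h x)).
  rewrite /avg RintegralZl//; last first.
    apply: (@bounded_integrable _ _ _ P _ _ (\sum_(h <- X) `|M|)) => // [|x Sx].
      exact: measurable_sum_seq.
    by apply: le_trans (ler_norm_sum _ _ _) _; apply: ler_sum.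
  rewrite (@Rintegral_sum _ _ _ P S _ X _ `|M|)//.
  rewrite (eq_big_seq _ invphi).
  by have := avg_cst (\int[P]_(x in S) f (kappa x)) netX; rewrite /avg => ->.
have cstE : \int[P]_(x in S) (cst (mean psi)) x = mean psi.
  by transitivity (mean psi * fine (P S)); [exact: Rintegral_cst | rewrite PS mulr1].
have icst : P.-integrable S (EFin \o cst (mean psi)).
  by apply: (@bounded_integrable _ _ _ P _ _ `|mean psi|).
rewrite avgE -[X in _ - X]cstE -RintegralB//.
have idiff := integrableB mS iavg icst.
apply: le_trans (le_normr_Rintegral mS idiff) _.
have e1 : e = \int[P]_(x in S) (cst e) x.
  transitivity (e * fine (P S)); first by rewrite PS mulr1.
  by apply/esym; exact: Rintegral_cst.
rewrite [leRHS]e1; apply: le_Rintegral => //.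
- exact: (integrable_norm idiff).
- by apply: (@bounded_integrable _ _ _ P _ _ `|e|).
move=> x Sx /=.
have [dx /(rsp_sub U1 dx)[Y Y1 xE]] := Sx.
have [k k1 Yk] := stiefel_trans Y01 Y1.
rewrite (eq_avg (phi := fun h => psi (k *m h))) => [|h hX'].
  rewrite -(mean_mull k1 ucpsi) (_ : e = 2 * (e / 2)); last by field.
  apply: hX; first exact: ucont_mull.
  move=> g h g1 h1 gh; apply: osc; [exact: stiefelM | exact: stiefelM |].
  by rewrite -mulmxBr frob2_orthl.
have h1 := netX.1 _ hX'; rewrite /phi patchE mem_set; last first.
  by apply/(rotate_fiber x h1).2.
rewrite /= /rot kappa_rotate; last exact: stiefel_ext.
by rewrite xE rotate_rsp -mulmxA mul_ext// -Yk /psi !mulmxA.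
Qed.

End invariant_integral.

(** * Truncation *)

Section truncation.
Variables (R : realType) (n : nat).
Implicit Types (V W : subspaces R n) (F : subspaces R n -> R) (l u v : R).

Definition cut l u : R := Num.min 1 (Num.max 0 (l * u - 1)).

Lemma cut_ge0 l u : 0 <= cut l u.
Proof. by rewrite /cut le_min ler01 le_max lexx. Qed.

Lemma cut_le1 l u : cut l u <= 1.
Proof. by rewrite /cut ge_min lexx. Qed.

Lemma cut0 l u : l * u <= 1 -> cut l u = 0.
Proof.
move=> lu; rewrite /cut; have /max_idPl -> : l * u - 1 <= 0 by rewrite subr_le0.
by apply/min_idPr.
Qed.

Lemma cut1 l u : 2 <= l * u -> cut l u = 1.
Proof.
move=> lu; rewrite /cut; apply/min_idPl; rewrite le_max; apply/orP; right.
by rewrite lerBrDr; move: lu; lra.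
Qed.

Lemma cut_lip l u v : 0 <= l -> `|cut l u - cut l v| <= l * `|u - v|.
Proof.
move=> l0; have lu : `|l * u - l * v| = l * `|u - v| by rewrite -mulrBr normrM ger0_norm.
rewrite -lu /cut; move: (l * u) (l * v) => x y.
by rewrite /Num.min /Num.max; do ![case: ifPn]; rewrite -?leNgt; move=> *;
  rewrite ler_norml; have := ler_norm (x - y); have := ler_normr (x - y) 0;
  have := ler_norm (y - x); rewrite distrC => *; apply/andP; split; lra.
Qed.

(* Zero where pole2 V <= 1 / l, and F V where pole2 V >= 2 / l. *)
Definition trunc l F V : R := F V * cut l (pole2 V).

Lemma pole2_dist V W : `|pole2 V - pole2 W| ^+ 2 <= pd V W.
Proof.
rewrite real_normK ?num_real// /pole2 /pd.
have -> (A B : 'M[R]_1) : A 0 0 - B 0 0 = (A - B) 0 0 by rewrite !mxE.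
rewrite -mulmxBl -mulmxBr; apply: le_trans (sqr_entry_le _ _ _) _.
have N1 := stiefel_pole R n; have /stiefel_row1 fN := N1.
apply: le_trans (frob2M _ _) _; rewrite frob2_tr fN mulr1.
by apply: le_trans (frob2M _ _) _; rewrite fN mul1r.
Qed.

Lemma pole2_pdcont : pdcont setT (@pole2 R n).
Proof.
move=> U eta _ eta0; exists (eta ^+ 2) => [|V _ VU]; first by rewrite exprn_gt0.
have := le_trans (pole2_dist V U) (ltW VU).
by rewrite ler_pXn2r// nnegrE ltW.
Qed.

(** Where [pole2] vanishes, the truncation is 0 in a whole neighbourhood; elsewhere it is a product
    of continuous functions. *)
Lemma trunc_pdcont l F (S : set (subspaces R n)) : 0 < l ->
  pdcont (S `&` [set V | 0 < pole2 V]) F -> pdcont S (trunc l F).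
Proof.
move=> l0 Fc V eta SV eta0.
have [V0|V0] := ltP 0 (pole2 V); last first.
  have pV : pole2 V = 0 by apply/eqP; rewrite eq_le V0 pole2_ge0.
  have [|d d0 h] := @pole2_pdcont V l^-1 I; first by rewrite invr_gt0.
  exists d => // W SW WV.
  have cV : cut l (pole2 V) = 0 by rewrite cut0// pV mulr0.
  have cW : cut l (pole2 W) = 0.
    apply: cut0; have := h W I WV; rewrite pV subr0 ger0_norm ?pole2_ge0// => h1.
    by rewrite -(divff (lt0r_neq0 l0)) ler_pM2l.
  by rewrite /trunc cV cW !mulr0 subrr normr0 ltW.
have e2 : 0 < eta / 2 by rewrite divr_gt0.
have [d1 d10 h1] := Fc V _ (conj SV V0) e2.
have K0 : 0 < l * (`|F V| + 1) by rewrite mulr_gt0// ltr_wpDl.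
have e3 : 0 < Num.min (pole2 V / 2) (eta / 2 / (l * (`|F V| + 1))).
  by rewrite lt_min !divr_gt0.
have [d2 d20 h2] := @pole2_pdcont V _ I e3.
exists (Num.min d1 d2) => [|W SW]; first by rewrite lt_min d10.
rewrite lt_min => /andP[/[dup] W1 _ W2].
have := h2 W I W2; rewrite le_min => /andP[a1 a2].
have W0 : 0 < pole2 W.
  by move: a1; rewrite ler_norml => /andP[a1 _]; move: a1 V0; lra.
have b1 := h1 W (conj SW W0) W1.
have b2 := cut_lip (pole2 W) (pole2 V) (ltW l0).
rewrite /trunc.
have -> : F W * cut l (pole2 W) - F V * cut l (pole2 V) =
  (F W - F V) * cut l (pole2 W) + F V * (cut l (pole2 W) - cut l (pole2 V)) by ring.
apply: le_trans (ler_normD _ _) _; rewrite !normrM (ger0_norm (cut_ge0 _ _)).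
have -> : eta = eta / 2 + eta / 2 by field.
apply: lerD; first by apply: le_trans b1; rewrite ler_piMr// cut_le1.
apply: le_trans (ler_wpM2l (normr_ge0 _) b2) _.
move: a2; rewrite ler_pdivlMr// => a2; apply: le_trans a2.
rewrite mulrC -mulrA [leRHS]mulrC -mulrA ler_wpM2l ?(ltW l0)// mulrC ler_wpM2r//.
by rewrite lerDl.
Qed.

Lemma trunc_bound l F C r V : 0 < l -> 0 <= r -> 0 <= C ->
  (0 < pole2 V -> `|F V| <= C * pole2 V `^ (- r)) -> `|trunc l F V| <= C * l^-1 `^ (- r).
Proof.
move=> l0 r0 C0 FC; rewrite /trunc normrM (ger0_norm (cut_ge0 _ _)).
have li : 0 < l^-1 by rewrite invr_gt0.
have [h|h] := leP (l * pole2 V) 1.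
  by rewrite cut0// mulr0 mulr_ge0// powR_ge0.
have lV : l^-1 < pole2 V by rewrite -ltr_pdivrMl ?mulr1// in h.
have V0 := lt_trans li lV.
apply: (@le_trans _ _ `|F V|); first by rewrite ler_piMr// cut_le1.
apply: le_trans (FC V0) _; rewrite ler_wpM2l//.
by apply: ler_powRN => //; exact: ltW.
Qed.

(** The truncation changes [F] only where [pole2 V] is below 2 / l. There part of the power, with
    exponent s - r, is traded for a factor that tends to 0 as [l] grows, at the price of the
    stronger singularity with exponent [s]. *)
Lemma trunc_error l F C r s V : 0 < l -> 0 <= r -> r < s -> 0 <= C -> 0 < pole2 V ->
  `|F V| <= C * pole2 V `^ (- r) ->
  `|trunc l F V - F V| <= C * (2 / l) `^ (s - r) * pole2 V `^ (- s).
Proof.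
move=> l0 r0 rs C0 V0 FC; rewrite /trunc -{2}(mulr1 (F V)) -mulrBr normrM.
have [h|h] := leP 2 (l * pole2 V).
  by rewrite cut1// subrr normr0 mulr0 mulr_ge0 ?powR_ge0// mulr_ge0 ?powR_ge0.
apply: (@le_trans _ _ `|F V|).
  rewrite ler_piMr// ler_norml; have := cut_ge0 l (pole2 V); have := cut_le1 l (pole2 V).
  by move=> a b; apply/andP; split; lra.
apply: le_trans FC _; rewrite -mulrA ler_wpM2l//.
have -> : pole2 V `^ (- r) = pole2 V `^ (s - r) * pole2 V `^ (- s).
  rewrite -powRD; last by rewrite (gt_eqF V0) implybT.
  by congr (_ `^ _); ring.
apply: ler_wpM2r; first exact: powR_ge0.
have sr : 0 <= s - r by rewrite subr_ge0 ltW.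
have l2 : 0 < 2 / l by rewrite divr_gt0.
apply: (ge0_ler_powR sr); rewrite ?nnegrE ?(ltW V0) ?(ltW l2)//.
by rewrite ler_pdivlMr// mulrC ltW.
Qed.

End truncation.

(** * Means of truncations *)

Section truncated_mean.
Variables (R : realType) (n j b : nat).
Variables (P : probability (borel_subspaces R n) R) (kappa : subspaces R n -> subspaces R n).
Variables (U : 'M[R]_(b, n.+1)) (Y0 : 'M[R]_(j.+1, b)).
Hypotheses (U1 : stiefel U) (Y01 : stiefel Y0).
Hypothesis kappa_pd : forall V W, pd (kappa V) (kappa W) = pd V W.
Hypothesis kappa_rotate : forall g V, stiefel g -> kappa (rotate g V) = rotate g (kappa V).

Local Notation S := (fiber j kappa U).

Hypothesis PS : P S = 1%E.
Hypothesis Pinv : forall g, stiefel g -> rotate g (rsp U) = rsp U ->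
  forall A : set (borel_subspaces R n), measurable A -> P (rotate g @^-1` A) = P A.

Let D0 : set (subspaces R n) := subspaces_in j (rsp U) `&` [set V | 0 < pole2 V].
Let D : set (borel_subspaces R n) := kappa @^-1` D0.

Let p2 (x : borel_subspaces R n) : R := pole2 (kappa x).

Let mp2 : measurable_fun setT p2.
Proof.
apply: (measurableT_comp (@measurable_pole2 R n)); exact: measurable_pd_isometry.
Qed.

Let mS : measurable S. Proof. exact: measurable_fiber. Qed.

Let DE : D = S `&` p2 @^-1` `]0, +oo[%classic.
Proof.
apply/seteqP; split=> x; rewrite /D /D0 /fiber /preimage/= in_itv/= andbT.
  by move=> [].
by move=> [].
Qed.

Let mD : measurable D.
Proof.
rewrite DE; apply: measurableI; first exact: mS.
by rewrite -[X in measurable X]setTI; apply: mp2 => //; exact: measurable_itv.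
Qed.

Variables (s : R) (K : R).
Hypotheses (s0 : 0 < s).
Hypothesis hK : forall (x : 'M[R]_(b, 1)) d, 0 < frob2 x -> 0 < d ->
    mean (fun g => (frob2 (Y0 *m g *m x) + d) `^ (- s)) <= K * frob2 x `^ (- s).
Hypothesis U0 : 0 < pole2 (rsp U).

(** The shifted powers are continuous, so their integrals are Haar means, bounded by [hK] uniformly
    in the shift. Monotone convergence lets the shift 1 / (m + 1) tend to 0. *)
Lemma negative_power_integral :
  (\int[P]_(x in D) (p2 x `^ (- s))%:E <= (K * pole2 (rsp U) `^ (- s))%:E)%E.
Proof.
pose h m (V : subspaces R n) : R := (pole2 V + m.+1%:R^-1) `^ (- s).
have m0 m : 0 < m.+1%:R^-1 :> R by rewrite invr_gt0 ltr0n.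
have hc m : pdcont (subspaces_in j (rsp U)) (h m).
  move=> V eta _ eta0.
  have := @powR_shift_continuous R (- s) m.+1%:R^-1 (pole2 V) (m0 m) (pole2_ge0 V).
  move=> /cvgr_dist_le/(_ _ eta0)[r /= r0 hr].
  have r2 : 0 < r / 2 by rewrite divr_gt0.
  have [d d0 hd] := @pole2_pdcont R n V _ I r2.
  exists d => // W _ WV; rewrite distrC; apply: hr => /=.
  rewrite distrC; apply: le_lt_trans (hd W I WV) _.
  by rewrite ltr_pdivrMr// ltr_pMr// ltr1n.
have hM m V : subspaces_in j (rsp U) V -> `|h m V| <= m.+1%:R^-1 `^ (- s).
  move=> _; rewrite ger0_norm ?powR_ge0//; apply: ler_powRN => //; first exact: ltW.
  by rewrite lerDr pole2_ge0.
have hm m : measurable_fun S (h m \o kappa).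
  by apply: measurable_fiber_fun => //; exact: hc.
have hint m : P.-integrable S (EFin \o (h m \o kappa)).
  apply: (@bounded_integrable _ _ _ P _ _ (m.+1%:R^-1 `^ (- s))) => // x Sx.
  exact: hM.
have hle m : (\int[P]_(x in D) (h m (kappa x))%:E <= (K * pole2 (rsp U) `^ (- s))%:E)%E.
  apply: (@le_trans _ _ (\int[P]_(x in S) (h m (kappa x))%:E)%E).
    apply: ge0_subset_integral => //.
    - by apply/measurable_EFinP; exact: hm.
    - by move=> x _; rewrite lee_fin powR_ge0.
    - by rewrite DE; exact: subIsetl.
  have fin := integrable_fin_num mS (hint m).
  rewrite -(fineK fin) lee_fin.
  rewrite -[fine _]/(\int[P]_(x in S) (h m (kappa x))).
  rewrite (Rintegral_fiber U1 Y01 kappa_pd kappa_rotate PS Pinv (hc m) (hM m)).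
  have -> : mean (fun g => h m (rsp (Y0 *m g *m U))) =
    mean (fun g => (frob2 (Y0 *m g *m (U *m north_pole^T)) + m.+1%:R^-1) `^ (- s)).
    apply: eq_mean => g g1; rewrite /h pole2_rsp ?mulmxA//.
    by do !apply: stiefelM.
  rewrite pole2_rsp//; apply: hK => //.
  by rewrite -pole2_rsp.
have mhD m : measurable_fun D (EFin \o (h m \o kappa)).
  apply/measurable_EFinP; apply: measurable_funS (hm m) => //.
  by rewrite DE; exact: subIsetl.
have hlim x : D x -> limn (fun m => (h m (kappa x))%:E) = (p2 x `^ (- s))%:E.
  move=> [_ /= x0]; apply/cvg_lim => //; apply: cvg_EFin; first exact: nearW.
  rewrite /comp /h /=.
  have -> : (fun m => fine (h m (kappa x))%:E) =
      (fun y => y `^ (- s)) \o (fun m => pole2 (kappa x) + m.+1%:R^-1) by [].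
  have c1 : (fun m => pole2 (kappa x) + m.+1%:R^-1) @ \oo --> pole2 (kappa x).
    rewrite -[X in _ --> X]addr0; apply: cvgD; first exact: cvg_cst.
    exact: cvg_harmonic.
  exact: (cvg_comp _ _ c1 (powR_continuous (s := - s) x0)).
have nd x : D x -> nondecreasing_seq (fun m => (h m (kappa x))%:E).
  move=> [_ /= x0] m m' mm; rewrite lee_fin; apply: ler_powRN; first exact: ltW.
    by rewrite addr_gt0.
  by rewrite lerD2l lef_pV2 ?posrE ?ltr0n// ler_nat.
have hge0 m x : D x -> (0 <= (h m (kappa x))%:E)%E.
  by move=> _; rewrite lee_fin powR_ge0.
have cvgh := @cvg_monotone_convergence _ _ _ P D mD _ mhD hge0 nd.
rewrite (eq_integral (fun x : borel_subspaces R n => limn (fun m => (h m (kappa x))%:E))); last first.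
  by move=> x; rewrite inE => /hlim.
rewrite -(cvg_lim _ cvgh)//; apply: lime_le; last exact: nearW.
by apply/cvg_ex; eexists; exact: cvgh.
Qed.

Variables (F : subspaces R n -> R) (C r : R).
Hypotheses (r0 : 0 <= r) (rs : r < s) (C0 : 0 <= C).
Hypothesis Fc : pdcont D0 F.
Hypothesis FC : forall V, D0 V -> `|F V| <= C * pole2 V `^ (- r).
Hypothesis F0 : \int[P]_(x in D) F (kappa x) = 0.

(** Since the integral of [F] vanishes, the mean of the truncation is the integral of the truncation
    error, which [trunc_error] and [negative_power_integral] bound. *)
Lemma truncated_mean_le l : 0 < l ->
  `|mean (fun h => trunc l F (rsp (Y0 *m h *m U)))| <=
  C * (2 / l) `^ (s - r) * (K * pole2 (rsp U) `^ (- s)).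
Proof.
move=> l0; have tc := trunc_pdcont l0 Fc.
have tM V : subspaces_in j (rsp U) V -> `|trunc l F V| <= C * l^-1 `^ (- r).
  by move=> SV; apply: (@trunc_bound R n l F C r V) => // V0; apply: FC.
rewrite -(Rintegral_fiber U1 Y01 kappa_pd kappa_rotate PS Pinv tc tM).
have -> : \int[P]_(x in S) trunc l F (kappa x) = \int[P]_(x in D) trunc l F (kappa x).
  rewrite Rintegral_mkcond [RHS]Rintegral_mkcond; apply: eq_Rintegral => x _.
  rewrite !patchE; have [Dx|Dx] := pselect (D x).
    by have [Sx _] := Dx; rewrite (mem_set Dx) (mem_set (Sx : S x)).
  rewrite (memNset Dx); have [Sx|Sx] := pselect (S x); last by rewrite (memNset Sx).
  rewrite (mem_set Sx); suff c0 : l * pole2 (kappa x) <= 1 by rewrite /trunc cut0 ?mulr0.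
  apply: (le_trans _ ler01); rewrite pmulr_rle0// leNgt; apply/negP => x1; exact: Dx (conj Sx x1).
have cE : \int[P]_(x in D) (p2 x `^ (- s)) <= K * pole2 (rsp U) `^ (- s) /\
    P.-integrable D (EFin \o (fun x => p2 x `^ (- s))).
  have le := negative_power_integral.
  have mp : measurable_fun D (fun x => p2 x `^ (- s)).
    apply: (measurableT_comp (measurable_powR (- s))).
    exact: measurable_funS mp2.
  have ge : (0 <= \int[P]_(x in D) (p2 x `^ (- s))%:E)%E.
    by apply: integral_ge0 => x _; rewrite lee_fin powR_ge0.
  split.
    by rewrite -lee_fin fineK// ge0_fin_numE// (le_lt_trans le)// ltry.
  apply/integrableP; split; first exact/measurable_EFinP.
  under eq_integral do rewrite /= ger0_norm ?powR_ge0//.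
  by apply: le_lt_trans le _; rewrite ltry.
have [cle cint] := cE.
have mF : measurable_fun D (F \o kappa) by exact: measurable_fiber_fun.
have mt : measurable_fun D (trunc l F \o kappa).
  apply: measurable_funS (measurable_fiber_fun kappa_pd tc mS) => //.
  by rewrite DE; exact: subIsetl.
have iF : P.-integrable D (EFin \o (F \o kappa)).
  apply: (@le_integrable _ _ _ P D mD _ (EFin \o (fun x => C * p2 x `^ (- s)))).
  - exact/measurable_EFinP.
  - move=> x Dx; rewrite /= lee_fin; apply: le_trans (FC Dx) _.
    rewrite ger0_norm ?mulr_ge0 ?powR_ge0//; apply: ler_wpM2l => //.
    have [_ x0] := Dx.
    by apply: ger_powR; rewrite ?pole2_le1 ?x0// lerN2 ltW.
  - exact: (integrableZl mD _ cint).
have it : P.-integrable D (EFin \o (trunc l F \o kappa)).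
  apply: (@bounded_integrable _ _ _ P _ _ (C * l^-1 `^ (- r))) => // x [Sx _].
  exact: tM.
rewrite -[X in `|X|]subr0 -F0 -RintegralB//.
have idiff := integrableB mD it iF.
apply: le_trans (le_normr_Rintegral mD idiff) _.
apply: (@le_trans _ _ (\int[P]_(x in D) (C * (2 / l) `^ (s - r) * p2 x `^ (- s)))).
  apply: le_Rintegral => //.
  - exact: (integrable_norm idiff).
  - exact: (integrableZl mD _ cint).
  - move=> x Dx; apply: trunc_error => //; first by have [] := Dx.
    exact: FC.
rewrite RintegralZl//; apply: ler_wpM2l => //.
by rewrite mulr_ge0 ?powR_ge0.
Qed.

End truncated_mean.

(** * The support theorem *)

(** Split [v] into its projection to the span of [Z] and a rest of squared length 1 -
    [frob2 (Z *m v^T)]. With the pole as [A], a plane that nearly contains [v] cannot be nearly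
    orthogonal to the pole. *)
Lemma frob2_row_le (R : realType) m q r (v : 'rV[R]_q) (Z : 'M[R]_(m, q)) (A : 'M[R]_(q, r)) :
  stiefel Z -> stiefel v ->
  frob2 (v *m A) <= 2 * frob2 (Z *m A) + 2 * ((1 - frob2 (Z *m v^T)) * frob2 A).
Proof.
move=> Z1 v1; have mq := stiefel_leq Z1.
have [|Y Y1 YZ] := @stiefel_complement R m (q - m) q Z Z1; first by rewrite subnKC.
have ZY : Z^T *m Z + Y^T *m Y = 1%:M by apply: stiefel_resolution => //; rewrite subnKC.
have := frob2_resolution v^T ZY; rewrite frob2_tr; move: (v1) => /stiefel_row1 -> vZY.
have Zv : frob2 (v *m Z^T) <= 1.
  by rewrite -frob2_tr trmx_mul trmxK -vZY lerDl frob2_ge0.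
have -> : v *m A = v *m Z^T *m (Z *m A) + v *m Y^T *m (Y *m A).
  by rewrite !mulmxA -mulmxDl -!(mulmxA v) -mulmxDr ZY mulmx1.
apply: le_trans (frob2D _ _) _; apply: lerD; rewrite ler_pM2l//.
  by apply: le_trans (frob2M _ _) _; rewrite ler_piMl// frob2_ge0.
apply: le_trans (frob2M _ _) _.
have -> : frob2 (v *m Y^T) = 1 - frob2 (Z *m v^T).
  by rewrite -vZY -frob2_tr trmx_mul trmxK addrC addKr.
by rewrite ler_wpM2l ?frob2_stiefel_le// -vZY addrC addKr frob2_ge0.
Qed.

(** Introduces the shift [d] under which the negative moment bounds are available. *)
Lemma half_powR (R : realType) (c d t : R) : 0 <= t -> 0 < d -> d <= c ->
  c `^ (- t) <= 2^-1 `^ (- t) * (c + d) `^ (- t).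
Proof.
move=> t0 d0 dc; rewrite -powRM ?invr_ge0//; last by rewrite addr_ge0// ltW// (lt_le_trans d0).
have c0 := lt_le_trans d0 dc.
apply: ler_powRN => //; first by rewrite mulr_gt0 ?invr_gt0 ?addr_gt0.
by move: dc; lra.
Qed.

Section real_support.
Variables (R : realType) (n p b : nat) (kappa : subspaces R n -> subspaces R n).
Variables (W : 'M[R]_(1 + (p + b), n.+1)) (F : subspaces R n -> R) (C r : R).
Hypothesis kappa_pd : forall V V', pd (kappa V) (kappa V') = pd V V'.
Hypothesis kappa_rotate : forall g V, stiefel g -> kappa (rotate g V) = rotate g (kappa V).
Hypotheses (W1 : stiefel W) (pb : (1 + p <= b)%N).
Hypotheses (r0 : 0 <= r) (rp : 2 * r < p.+1%:R) (C0 : 0 <= C).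

Let D1 : set (subspaces R n) := subspaces_in p (rsp W) `&` [set V | 0 < pole2 V].

Hypothesis Fc : pdcont D1 F.
Hypothesis FC : forall V, D1 V -> `|F V| <= C * pole2 V `^ (- r).
Hypothesis F0 : forall U : 'M[R]_(b, n.+1), stiefel U -> (rsp U <= rsp W)%VS ->
  0 < pole2 (rsp U) -> exists P : probability (borel_subspaces R n) R,
  [/\ P (fiber p kappa U) = 1%E,
      forall g, stiefel g -> rotate g (rsp U) = rsp U ->
        forall A : set (borel_subspaces R n), measurable A -> P (rotate g @^-1` A) = P A &
      \int[P]_(x in kappa @^-1` (subspaces_in p (rsp U) `&` [set V | 0 < pole2 V]))
        F (kappa x) = 0].

(** The midpoint of [r] and (p + 1) / 2: the margin above [r] makes truncation errors small, the
    margin below (p + 1) / 2 keeps the negative moments finite. *)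
Let s : R := (r + p.+1%:R / 2) / 2.

Let rs : r < s. Proof. by rewrite /s; move: rp; lra. Qed.
Let s0 : 0 < s. Proof. exact: le_lt_trans r0 rs. Qed.
Let sp : 2 * s < p.+1%:R. Proof. by rewrite /s; move: rp; lra. Qed.

Let N : 'cV[R]_(1 + (p + b)) := W *m north_pole^T.

Let f l (X : 'M[R]_(1 + p, 1 + (p + b))) : R := trunc l.+1%:R F (rsp (X *m W)).

Let l_gt0 (l : nat) : 0 < l.+1%:R :> R. Proof. by rewrite ltr0n. Qed.

Let poleE m (X : 'M[R]_(m, 1 + (p + b))) : stiefel X ->
  pole2 (rsp (X *m W)) = frob2 (X *m N).
Proof. by move=> X1; rewrite pole2_rsp ?mulmxA//; exact: stiefelM. Qed.

Let SX (X : 'M[R]_(1 + p, 1 + (p + b))) : stiefel X -> subspaces_in p (rsp W) (rsp (X *m W)).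
Proof. by move=> X1; exact: (@subspaces_in_rsp R n p). Qed.

Let f_le l X : stiefel X ->
  `|f l X| <= C * 2^-1 `^ (- s) * (frob2 (X *m N) + l.+1%:R^-1) `^ (- s).
Proof.
move=> X1; rewrite -poleE// /f; set V := rsp _.
have li : 0 < l.+1%:R^-1 :> R by rewrite invr_gt0.
have [h|h] := leP (l.+1%:R * pole2 V) 1.
  by rewrite /trunc cut0// mulr0 normr0 !mulr_ge0 ?powR_ge0.
have lV : l.+1%:R^-1 < pole2 V by rewrite -ltr_pdivrMl ?mulr1// in h.
have V0 := lt_trans li lV.
rewrite /trunc normrM (ger0_norm (cut_ge0 _ _)) -mulrA.
apply: (@le_trans _ _ `|F V|); first by rewrite ler_piMr// cut_le1.
have DV : D1 V by split => //; exact: SX.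
apply: le_trans (FC DV) _; rewrite ler_wpM2l//.
apply: le_trans (half_powR (ltW s0) li (ltW lV)).
by apply: ger_powR; rewrite ?V0 ?pole2_le1// lerN2 ltW.
Qed.

Let f_stcont l : stcont (f l).
Proof.
move=> X X1; apply: (ucont_rsp (trunc_pdcont (l_gt0 l) Fc) X1 W1) => g g1.
by apply: SX; exact: stiefelM.
Qed.

Let f_orth l k X : stiefel k -> stiefel X -> f l (k *m X) = f l X.
Proof. by move=> k1 _; rewrite /f -mulmxA rsp_orth. Qed.

Let f_zero l X : stiefel X -> frob2 (X *m N) <= l.+1%:R^-1 -> f l X = 0.
Proof.
move=> X1 h; rewrite /f /trunc cut0 ?mulr0// poleE//.
by move: h; rewrite -(ler_pM2l (l_gt0 l)) divff// lt0r_neq0.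
Qed.

Let frob_zero q (Z : 'M[R]_(1 + q, 1 + (p + b))) : ~~ (0 < frob2 (Z *m N)) -> Z *m N = 0.
Proof. by rewrite lt0r frob2_ge0 andbT negbK => /eqP /frob2_eq0. Qed.

(** If the span of [Z] is orthogonal to the pole, all truncations vanish on it. Otherwise [f_le]
    bounds them by a negative power whose mean is bounded uniformly in the shift, hence in [l]. *)
Let f_bounded (Y : 'M[R]_(1 + p, b)) (U : 'M[R]_(b, 1 + b)) : stiefel Y -> stiefel U ->
  forall Z : 'M[R]_(1 + b, 1 + (p + b)), stiefel Z -> exists M, forall l,
    mean (fun g => `|f l (Y *m U *m g *m Z)|) <= M.
Proof.
move=> Y1 U1 Z Z1; have YU1 := stiefelM Y1 U1.
have ucf l : ucont (fun g => f l (Y *m U *m g *m Z)).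
  exact: (stcont_mulr Z1 (@f_stcont l) YU1).
have [x0|/frob_zero ZN] := boolP (0 < frob2 (Z *m N)); last first.
  exists 0 => l; rewrite -(mean_cst (1 + b) 0); apply: mean_le.
  - exact: ucont_norm.
  - exact: ucont_cst.
  - move=> g g1; rewrite f_zero ?normr0//; first by do !apply: stiefelM.
    by rewrite -mulmxA ZN mulmx0 frob2_0 invr_ge0 ltW.
have [K K0 hK] := negative_moment_scaled YU1 s0 sp.
exists (C * 2^-1 `^ (- s) * (K * frob2 (Z *m N) `^ (- s))) => l.
have li : 0 < l.+1%:R^-1 :> R by rewrite invr_gt0.
apply: le_trans (ler_wpM2l _ (hK _ _ x0 li)); last by rewrite mulr_ge0 ?powR_ge0.
have ucp := ucont_powR (Y *m U) (Z *m N) (- s) li.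
rewrite -meanZ//; apply: mean_le; [exact: ucont_norm|exact: ucontZ|] => g g1.
apply: le_trans (f_le l _) _; first by do !apply: stiefelM.
by rewrite !mulmxA.
Qed.

(** If the pole component of the b-plane is at most 1 / (l + 1), the truncation vanishes on all its
    subspaces; otherwise [truncated_mean_le] applies. The bound keeps a negative power of that
    component, to be averaged over b-planes in [f_small]. *)
Let inner_le (Y : 'M[R]_(1 + p, b)) (U : 'M[R]_(b, 1 + (p + b))) K l : stiefel Y ->
  stiefel U -> 0 <= K ->
  (forall (x : 'cV[R]_b) d, 0 < frob2 x -> 0 < d ->
    mean (fun g => (frob2 (Y *m g *m x) + d) `^ (- s)) <= K * frob2 x `^ (- s)) ->
  `|mean (fun h => f l (Y *m h *m U))| <=
  C * (2 / l.+1%:R) `^ (s - r) * (K * 2^-1 `^ (- s)) *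
  (frob2 (U *m N) + l.+1%:R^-1) `^ (- s).
Proof.
move=> Y1 U1 K0 hK; have UW1 := stiefelM U1 W1.
have li : 0 < l.+1%:R^-1 :> R by rewrite invr_gt0.
have Q0 : 0 <= C * (2 / l.+1%:R) `^ (s - r) by rewrite mulr_ge0 ?powR_ge0.
have [h|h] := leP (frob2 (U *m N)) l.+1%:R^-1.
  have -> : mean (fun h => f l (Y *m h *m U)) = 0.
    rewrite -[RHS](mean_cst b); apply: eq_mean => k k1; apply: f_zero.
      by do !apply: stiefelM.
    by apply: le_trans h; rewrite -mulmxA; apply: frob2_stiefel_le; exact: stiefelM.
  by rewrite normr0 !mulr_ge0 ?powR_ge0.
have U0 : 0 < pole2 (rsp (U *m W)) by rewrite poleE//; exact: lt_trans h.
have sub : (rsp (U *m W) <= rsp W)%VS by exact: rspM_sub.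
have sD V : (subspaces_in p (rsp (U *m W)) `&` [set V | 0 < pole2 V]) V -> D1 V.
  by move=> [[dV VU] V0]; split => //; split => //; exact: subv_trans VU sub.
have [P [PS Pinv PF]] := F0 UW1 sub U0.
have key := truncated_mean_le UW1 Y1 kappa_pd kappa_rotate PS Pinv s0 hK U0 r0 rs C0
  (pdcont_sub sD Fc) (fun V DV => FC (sD V DV)) PF (l_gt0 l).
have -> : mean (fun h => f l (Y *m h *m U)) =
    mean (fun h => trunc l.+1%:R F (rsp (Y *m h *m (U *m W)))).
  by apply: eq_mean => k _; rewrite /f mulmxA.
apply: le_trans key _; rewrite -[leRHS]mulrA ler_wpM2l// -[leRHS]mulrA ler_wpM2l//.
by rewrite poleE//; apply: half_powR => //; exact: ltW.
Qed.

Let f_small (Y : 'M[R]_(1 + p, b)) (U : 'M[R]_(b, 1 + b)) : stiefel Y -> stiefel U ->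
  forall Z : 'M[R]_(1 + b, 1 + (p + b)), stiefel Z -> forall eps, 0 < eps ->
  exists L, forall l, (L <= l)%N ->
    mean (fun g => `|mean (fun h => f l (Y *m h *m U *m g *m Z))|) <= eps.
Proof.
move=> Y1 U1 Z Z1 eps eps0.
have YU1 := stiefelM Y1 U1.
have innerE l g : mean (fun h => f l (Y *m h *m U *m g *m Z)) =
    mean (fun h => f l (Y *m h *m (U *m g *m Z))).
  by apply: eq_mean => h _; rewrite !mulmxA.
have ucf l : ucont (fun g => f l (Y *m U *m g *m Z)).
  exact: (stcont_mulr Z1 (@f_stcont l) YU1).
have uci l : ucont (fun g => `|mean (fun h => f l (Y *m h *m U *m g *m Z))|).
  apply: ucont_norm; apply: (eq_ucont _ (ucont_mean (jucont_ext_mul U1 (ucf l)))) => g g1.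
  by apply: eq_mean => h h1; rewrite !mulmxA -(mulmxA Y U) mul_ext// !mulmxA.
have [x0|/frob_zero ZN] := boolP (0 < frob2 (Z *m N)); last first.
  exists 0%N => l _; rewrite -(mean_cst (1 + b) eps).
  apply: mean_le => [//||g g1]; first exact: ucont_cst.
  rewrite (_ : mean _ = 0) ?normr0 ?ltW// -[RHS](mean_cst b); apply: eq_mean => h h1.
  rewrite f_zero//; first by do !apply: stiefelM.
  by rewrite -mulmxA ZN mulmx0 frob2_0 invr_ge0 ltW.
have [K K0 hK] := negative_moment_scaled Y1 s0 sp.
(* A second negative moment, for b-planes in the (1 + b)-dimensional space; it is finite because 2 s
   < p + 1 <= b. *)
have [K' K'0 hK'] : exists2 K', 0 < K' & forall (x : 'cV[R]_(1 + b)) d, 0 < frob2 x -> 0 < d ->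
    mean (fun g => (frob2 (U *m g *m x) + d) `^ (- s)) <= K' * frob2 x `^ (- s).
  by apply: (negative_moment_scaled U1 s0); apply: lt_le_trans sp _; rewrite ler_nat.
pose Q := C * (K * 2^-1 `^ (- s)) * (K' * frob2 (Z *m N) `^ (- s)).
have Q0 : 0 <= Q by rewrite /Q !mulr_ge0 ?powR_ge0 ?(ltW K0) ?(ltW K'0).
have sr : 0 < s - r by rewrite subr_gt0.
(* Chosen so that Q e ^ (s - r) is at most [eps]. *)
pose e := (eps / (Q + 1)) `^ (s - r)^-1.
have Q1 : 0 < Q + 1 by rewrite ltr_wpDl.
have e0 : 0 < e by rewrite powR_gt0// divr_gt0.
exists (Num.truncn (2 / e)) => l Ll.
have li : 0 < l.+1%:R^-1 :> R by rewrite invr_gt0.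
have small : 2 / l.+1%:R <= e.
  rewrite ler_pdivrMr// mulrC -ler_pdivrMr//; apply: le_trans (ltW (truncnS_gt _)) _.
  by rewrite ler_nat.
have Ql : Q * (2 / l.+1%:R) `^ (s - r) <= eps.
  apply: (@le_trans _ _ (Q * e `^ (s - r))).
    apply: ler_wpM2l => //; apply: (ge0_ler_powR (ltW sr)) => //; rewrite nnegrE ?(ltW e0)//.
  rewrite /e -powRrM mulVf ?gt_eqF// powRr1 ?divr_ge0 ?(ltW eps0) ?(ltW Q1)//.
  by rewrite mulrC mulrAC ler_pdivrMr// ler_pM2l// lerDl.
apply: le_trans Ql; rewrite /Q.
set B := C * (2 / l.+1%:R) `^ (s - r) * (K * 2^-1 `^ (- s)).
have B0 : 0 <= B by rewrite /B !mulr_ge0 ?powR_ge0// ltW.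
have -> : C * (K * 2^-1 `^ (- s)) * (K' * frob2 (Z *m N) `^ (- s)) *
    (2 / l.+1%:R) `^ (s - r) = B * (K' * frob2 (Z *m N) `^ (- s)) by rewrite /B; ring.
apply: le_trans (ler_wpM2l B0 (hK' _ _ x0 li)).
have ucp := ucont_powR U (Z *m N) (- s) li.
rewrite -meanZ//; apply: mean_le; [exact: uci|exact: ucontZ|] => g g1.
rewrite innerE; have UZ1 : stiefel (U *m g *m Z) by do !apply: stiefelM.
by apply: le_trans (inner_le l Y1 UZ1 (ltW K0) hK) _; rewrite -/B mulmxA.
Qed.

(** Some vector of the frame has a nonzero pole component. A rotation of the frame makes it the
    first vector [v], and [means_determine_step] is applied to the truncations. *)
Lemma real_support (X : 'M[R]_(1 + p, 1 + (p + b))) : stiefel X ->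
  0 < pole2 (rsp (X *m W)) -> F (rsp (X *m W)) = 0.
Proof.
move=> X1 pX; have c0 : 0 < frob2 (X *m N) by rewrite -poleE.
have [i xi] : exists i, (X *m N) i 0 != 0.
  apply/existsP; apply: contraLR c0; rewrite negb_exists => /forallP h.
  rewrite -leNgt (_ : X *m N = 0) ?frob2_0//; apply/matrixP => i j.
  by rewrite ord1 [RHS]mxE; apply/eqP; have := h i; rewrite negbK.
pose e : 'rV[R]_(1 + p) := delta_mx 0 i.
have e1 : stiefel e.
  rewrite /stiefel trmx_delta mul_delta_mx; apply/matrixP => a c.
  by rewrite !ord1 !mxE.
have [|Y Y1 Ye] := @stiefel_complement _ 1 p (1 + p) e e1; first by [].
have k1 : stiefel (col_mx e Y) by exact/stiefel_col.
have kX1 := stiefelM k1 X1.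
have kXE : col_mx e Y *m X = col_mx (e *m X) (Y *m X) by rewrite mul_col_mx.
set v := e *m X in kXE; have v1 : stiefel v by exact: stiefelM.
have c1 : 0 < frob2 (v *m N).
  rewrite /v -mulmxA -rowE lt0r frob2_ge0 andbT; apply: contra xi => /eqP/frob2_eq0/matrixP/(_ 0 0).
  by rewrite !mxE => ->.
have N1 : frob2 N <= 1.
  apply: le_trans (frob2_stiefel_le _ W1) _; rewrite frob2_tr.
  by have /stiefel_row1 -> := stiefel_pole R n.
(* With a quarter, [frob2_row_le] reads 4 d0 <= 2 [frob2 (Z *m N)] + 2 d0 for planes within [d0] of
   containing [v], so their pole component is at least [d0]. *)
pose d0 := frob2 (v *m N) / 4.
have d0_gt0 : 0 < d0 by rewrite divr_gt0.
have near (Z : 'M[R]_(1 + p, 1 + (p + b))) : stiefel Z -> 1 - d0 <= frob2 (Z *m v^T) ->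
    d0 <= frob2 (Z *m N).
  move=> Z1 Zv; have := frob2_row_le N Z1 v1; move: Zv N1 (frob2_ge0 N).
  by rewrite /d0; nra.
(* The minimum ensures that from [l0] on neither the planes near [v] nor the plane of [X] itself is
   affected by the truncation. *)
pose c := Num.min d0 (frob2 (X *m N)).
have cgt : 0 < c by rewrite lt_min d0_gt0.
pose l0 := Num.truncn (2 / c).
have big l : (l0 <= l)%N -> 2 <= l.+1%:R * c.
  move=> ll; rewrite -ler_pdivrMr//; apply: le_trans (ltW (truncnS_gt _)) _.
  by rewrite ler_nat.
have fF l Z : (l0 <= l)%N -> stiefel Z -> c <= frob2 (Z *m N) -> f l Z = F (rsp (Z *m W)).
  move=> /big ll Z1 cZ; rewrite /f /trunc cut1 ?mulr1// poleE//.
  by apply: le_trans ll _; rewrite ler_pM2l.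
have [U U1] := @stiefel_exists R b (1 + b) (leq_addl _ _).
have [Y' Y'1] := @stiefel_exists R (1 + p) b pb.
have kX2 : stiefel (col_mx v (Y *m X)) by rewrite -kXE.
have := means_determine_step (means_determineP (ltnW pb)) pb Y'1 U1 kX2 f_stcont
  f_orth (f_small Y'1 U1) (f_bounded Y'1 U1) d0_gt0 (l0 := l0).
rewrite -kXE f_orth// fF//; last by rewrite ge_min lexx orbT.
apply => l Z ll Z1 /(near _ Z1) Zd.
by rewrite !fF// ge_min Zd.
Qed.

End real_support.

Lemma frob2_col (R : realType) m1 m2 q (A : 'M[R]_(m1, q)) (B : 'M[R]_(m2, q)) :
  frob2 (col_mx A B) = frob2 A + frob2 B.
Proof.
rewrite -frob2_tr tr_col_mx /frob2 tr_row_mx !trmxK mul_row_col linearD/=.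
by rewrite -/(frob2 A) -/(frob2 B) -(frob2_tr A) -(frob2_tr B) /frob2 !trmxK.
Qed.

Section grassmann_support.
Variables (R : realType) (n p b : nat) (kappa : subspaces R n -> subspaces R n).
Hypothesis kappa_pd : forall V V', pd (kappa V) (kappa V') = pd V V'.
Hypothesis kappa_rotate : forall g V, stiefel g -> kappa (rotate g V) = rotate g (kappa V).
Hypotheses (pb : (p < b)%N) (pbn : (p + b < n)%N).

Definition proper_subspaces d : set (subspaces R n) :=
  [set V | \dim V = d.+1 /\ 0 < pole2 V < 1].

Lemma subspace_support (F : subspaces R n -> R) (C r : R) tau :
  0 <= r -> 2 * r < p.+1%:R -> 0 <= C -> pdcont (proper_subspaces p) F ->
  (forall V, proper_subspaces p V -> `|F V| <= C * pole2 V `^ (- r)) ->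
  proper_subspaces p tau ->
  (forall zeta, \dim zeta = b -> 0 < pole2 zeta -> pole2 zeta <= pole2 tau ->
    exists P : probability (borel_subspaces R n) R,
    [/\ P (kappa @^-1` subspaces_in p zeta) = 1%E,
        forall g, stiefel g -> rotate g zeta = zeta ->
          forall A : set (borel_subspaces R n), measurable A -> P (rotate g @^-1` A) = P A &
        \int[P]_(x in kappa @^-1` (subspaces_in p zeta `&` proper_subspaces p))
          F (kappa x) = 0]) ->
  F tau = 0.
Proof.
move=> r0 rp C0 Fc FC [dtau /andP[tau0 tau1]] F0.
have [X X1 XT] := rsp_exists dtau; pose N : 'rV[R]_n.+1 := north_pole.
have N1 : stiefel N := stiefel_pole R n.
(* The part of the pole orthogonal to [tau], nonzero because [pole2 tau] < 1. Vectors orthogonal to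
   [tau] and to [x] are orthogonal to the pole; [b] orthonormal ones exist since (p + 1) + 1 + b <=
   n + 1. *)
pose x := N - N *m X^T *m X.
have xX : x *m X^T = 0 by rewrite mulmxBl -!mulmxA X1 mulmx1 subrr.
have x0 : x != 0.
  apply: contraTneq tau1 => x0; rewrite -leNgt -XT pole2_rsp// -frob2_tr trmx_mul trmxK.
  have NX : N = N *m X^T *m X by apply/eqP; rewrite -subr_eq0; apply/eqP.
  by rewrite -(frob2_stiefelr (N *m X^T) X1) -NX (stiefel_row1 N).1.
have e1 := stiefel_normalize x0; set e := _ *: x in e1.
have eX : e *m X^T = 0 by rewrite -scalemxAl xX scaler0.
have Xe1 : stiefel (col_mx X e) by exact/stiefel_col.
have [|Y Y1] := @stiefel_complement R _ b _ _ Xe1; first by rewrite addn1; lia.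
rewrite tr_col_mx mul_mx_row => /eqP; rewrite -(@row_mx0 _ _ p.+1 1) => /eqP/eq_row_mx[YX Ye].
have Yx : Y *m x^T = 0.
  move: Ye; rewrite linearZ/= -scalemxAr => /eqP; rewrite scaler_eq0 invr_eq0.
  case/orP => [|/eqP//]; rewrite sqrtr_eq0 => x00.
  have /frob2_eq0/eqP : frob2 x = 0 by apply/le_anti; rewrite x00 frob2_ge0.
  by rewrite (negbTE x0).
have YN : Y *m N^T = 0.
  rewrite -[N](subrK (N *m X^T *m X)) -/x linearD/= mulmxDr Yx add0r.
  by rewrite trmx_mul mulmxA YX mul0mx.
have XY1 : stiefel (col_mx X Y) by exact/stiefel_col.
pose W : 'M[R]_(1 + (p + b), n.+1) := col_mx X Y; have W1 : stiefel W := XY1.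
have pW : pole2 (rsp W) = pole2 tau.
  rewrite -[LHS]/(pole2 (rsp (col_mx X Y))).
  by rewrite pole2_rsp// -XT pole2_rsp// mul_col_mx YN frob2_col frob2_0 addr0.
(* The coordinates of [X] in [W]; [Z] is the same matrix with the dimensions bracketed as
   [real_support] has them. *)
pose I0 : 'M[R]_(p.+1, p.+1 + b) := row_mx 1%:M 0.
pose Z : 'M[R]_(1 + p, 1 + (p + b)) := I0.
have ZW : Z *m W = X.
  by rewrite -[LHS]/(I0 *m col_mx X Y) mul_row_col mul1mx mul0mx addr0.
have Z1 : stiefel Z.
  by rewrite -[stiefel Z]/(stiefel I0) /stiefel tr_row_mx mul_row_col trmx1 mulmx1 mul0mx addr0.
have small V : (V <= rsp W)%VS -> pole2 V < 1.
  by move=> /pole2S VW; apply: le_lt_trans VW _; rewrite pW.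
have DG : subspaces_in p (rsp W) `&` [set V | 0 < pole2 V] `<=` proper_subspaces p.
  by move=> V [[dV VW] V0]; split => //; rewrite V0 small.
have := @real_support R n p b kappa W F C r kappa_pd kappa_rotate W1 pb r0 rp C0
  (pdcont_sub DG Fc) (fun V DV => FC V (DG V DV)) _ Z Z1.
rewrite ZW XT; apply=> // U U1 UW U0.
have [|P [PS Pinv PF]] := F0 _ (dim_rsp U1) U0; first by rewrite -pW; exact: pole2S.
exists P; split => //; rewrite -[RHS]PF; congr (\int[P]_(x in kappa @^-1` _) _).
apply/seteqP; split => V [SV] /=; last by case=> _ /andP[].
move=> V0; split => //; split; first by have [] := SV.
by rewrite V0 small//; exact: subv_trans SV.2 UW.
Qed.

End grassmann_support.

Local Open Scope complex_scope.

(** * The distance to the pole *)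

Section pole_distance.
Variables (R : realType) (n : nat).
Implicit Types U V : subspaces R n.

Lemma sqrt_pole2_in U : -1 <= Num.sqrt (pole2 U) <= 1.
Proof.
rewrite (le_trans _ (sqrtr_ge0 _)) ?lerN10//=.
by rewrite -[leRHS]sqrtr1 ler_sqrt ?pole2_le1.
Qed.

Lemma pole_dist_le U V : (0 < \dim U)%N -> (0 < \dim V)%N ->
  (pole_dist U <= pole_dist V) = (pole2 V <= pole2 U).
Proof.
move=> U0 V0; rewrite !pole_dist_acos// ler_acos ?sqrt_pole2_in//.
by rewrite ler_sqrt ?pole2_ge0.
Qed.

Lemma pole_dist_gt0 U : (0 < \dim U)%N -> (0 < pole_dist U) = (pole2 U < 1).
Proof.
move=> U0; rewrite pole_dist_acos// -(acos1 R) !ltNge ler_acos ?sqrt_pole2_in//.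
  by rewrite -{1}(sqrtr1 R) ler_sqrt ?pole2_ge0.
by rewrite lexx andbT (le_trans (lerN10 R)).
Qed.

Lemma pole_dist_lt_pihalf U : (0 < \dim U)%N -> (pole_dist U < pi / 2) = (0 < pole2 U).
Proof.
move=> U0; rewrite pole_dist_acos// -(acos0 R) !ltNge ler_acos ?sqrt_pole2_in//.
  by rewrite -(sqrtr_eq0 (pole2 U)) eq_le sqrtr_ge0 andbT.
by rewrite ler01 andbT lerN10.
Qed.

Lemma Grass_tildeE d : Grass_tilde R n d = @proper_subspaces R n d.
Proof.
apply/seteqP; split => V [dV]; rewrite /Grass_tilde /proper_subspaces /Grass/=.
  by rewrite pole_dist_gt0 ?pole_dist_lt_pihalf ?dV// andbC.
by rewrite pole_dist_gt0 ?pole_dist_lt_pihalf ?dV// andbC.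
Qed.

Lemma cos_pole_dist U : (0 < \dim U)%N -> cos (pole_dist U) = Num.sqrt (pole2 U).
Proof. by move=> U0; rewrite pole_dist_acos// acosK// in_itv/= sqrt_pole2_in. Qed.

Lemma sin_pole_dist U : (0 < \dim U)%N -> sin (pole_dist U) = Num.sqrt (1 - pole2 U).
Proof.
by move=> U0; rewrite pole_dist_acos// sin_acos ?sqrt_pole2_in// sqr_sqrtr ?pole2_ge0.
Qed.

End pole_distance.

(** * Complex-valued functions *)

Section complex_valued.
Variables (R : realType) (n : nat).
Local Notation subsp := (subspaces R n).

Definition ccont (D : set subsp) (F : subsp -> R[i]) :=
  forall U (eta : R), D U -> 0 < eta ->
    exists2 d, 0 < d & forall V, D V -> pd V U < d -> Normc.normc (F V - F U) <= eta.

Lemma within_ccont D (F : subsp -> R[i]) :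
  {within D, continuous (F : subsp -> R[i]^o)} -> ccont D F.
Proof.
move=> /subspace_continuousP Fc U eta DU eta0.
have eta0' : 0 < eta%:C by rewrite ltcR.
have /cvgr_dist_le/(_ _ eta0') := Fc U DU.
rewrite /within/= => /nbhs_pd[d d0 h]; exists d => // V DV VU.
by have := h V VU DV; rewrite distrC lecR.
Qed.

Lemma normc_Re (z : R[i]) : `|complex.Re z| <= Normc.normc z.
Proof. by have := normc_ge_Re z; rewrite lecR. Qed.

Lemma normc_Im (z : R[i]) : `|complex.Im z| <= Normc.normc z.
Proof.
by case: z => x y /=; rewrite -sqrtr_sqr ler_sqrt ?lerDr ?sqr_ge0 ?addr_ge0 ?sqr_ge0.
Qed.

(** The cosine is the square root of [pole2], hence the halved exponent. As [u] is at most 1, a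
    negative [p] may be raised to 0, so that the exponent [r] of the real case is nonnegative. *)
Lemma powR_ubound (u x M p : R) : 0 < u -> u <= 1 -> 0 <= x ->
  Num.sqrt u `^ p * x <= M -> x <= `|M| * u `^ (- (Num.max p 0 / 2)).
Proof.
move=> u0 u1 x0 xM; have su : 0 < Num.sqrt u by rewrite sqrtr_gt0.
have su1 : Num.sqrt u <= 1 by rewrite -[leRHS]sqrtr1 ler_sqrt.
rewrite powRN ler_pdivlMr ?powR_gt0//.
have -> : u `^ (Num.max p 0 / 2) = Num.sqrt u `^ Num.max p 0.
  by rewrite -powR12_sqrt ?ltW// -powRrM mulrC.
rewrite mulrC; apply: le_trans (ler_norm M); apply: le_trans xM.
rewrite ler_wpM2r//; apply: ger_powR; rewrite ?su//.
by rewrite le_max lexx.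
Qed.

Lemma complex_support (p b : nat) (kappa : subsp -> subsp) (F : subsp -> R[i]) M q tau :
  (forall V V', pd (kappa V) (kappa V') = pd V V') ->
  (forall g V, stiefel g -> kappa (rotate g V) = rotate g (kappa V)) ->
  (p < b)%N -> (p + b < n)%N -> q < p.+1%:R -> ccont (@proper_subspaces R n p) F ->
  (forall V, @proper_subspaces R n p V ->
    Num.sqrt (pole2 V) `^ q * Normc.normc (F V) <= M) ->
  @proper_subspaces R n p tau ->
  (forall zeta, \dim zeta = b -> 0 < pole2 zeta -> pole2 zeta <= pole2 tau ->
    exists P : probability (borel_subspaces R n) R,
    [/\ P (kappa @^-1` subspaces_in p zeta) = 1%E,
        forall g, stiefel g -> rotate g zeta = zeta ->
          forall A : set (borel_subspaces R n), measurable A -> P (rotate g @^-1` A) = P A &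
        cintegral P (kappa @^-1` (subspaces_in p zeta `&` @proper_subspaces R n p))
          (F \o kappa) = 0]) ->
  F tau = 0.
Proof.
move=> kpd krot pb pbn qp Fc FM tauD F0.
pose r := Num.max q 0 / 2.
have r0 : 0 <= r by rewrite divr_ge0// le_max lexx orbT.
have rp : 2 * r < p.+1%:R by rewrite mulrCA divff// mulr1 gt_max qp ltr0n.
have FC V : @proper_subspaces R n p V -> Normc.normc (F V) <= `|M| * pole2 V `^ (- r).
  move=> DV; have [_ /andP[V0 V1]] := DV.
  apply: powR_ubound (FM V DV) => //; first exact: ltW.
  exact: le_trans (normc_Re _).
have support (part : R[i] -> R) : (forall z z', part (z - z') = part z - part z') ->
    (forall z, `|part z| <= Normc.normc z) ->
    (forall (P : probability (borel_subspaces R n) R) (D : set (borel_subspaces R n)) G,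
      cintegral P D G = 0 -> \int[P]_(x in D) part (G x) = 0) ->
    part (F tau) = 0.
  move=> partB part_le part0.
  apply: (@subspace_support R n p b kappa kpd krot pb pbn (part \o F) `|M| r) => //.
  - move=> U eta DU eta0; have [d d0 h] := Fc U eta DU eta0.
    exists d => // V DV VU; rewrite /= -partB; apply: le_trans (part_le _) _.
    exact: h.
  - by move=> V DV; apply: le_trans (part_le _) _; exact: FC.
  - move=> zeta dz z0 zt; have [P [PS Pinv PF]] := F0 zeta dz z0 zt.
    by exists P; split => //; have := part0 _ _ _ PF; exact.
have : complex.Re (F tau) = 0.
  apply: support; [by move=> [? ?] [? ?]|exact: normc_Re|by move=> P D G []].
have : complex.Im (F tau) = 0.
  apply: support; [by move=> [? ?] [? ?]|exact: normc_Im|by move=> P D G []].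
by case: (F tau) => x y /= -> ->.
Qed.

End complex_valued.

(** The complement of a (k + 1)-plane has dimension n - k, which is [(n - k.+1).+1] because k <
    n. *)
Lemma subspaces_above_perp (R : realType) n k (tau V : subspaces R n) :
  (k < n)%N -> subspaces_above k tau V <-> subspaces_in (n - k.+1) (perp tau) (perp V).
Proof.
move=> kn; rewrite /subspaces_above /subspaces_in /Grass/= perpS_iff.
have := dim_perp V; split=> -[dV VU]; split=> //; lia.
Qed.

Lemma proper_perp (R : realType) n k (V : subspaces R n) : (k < n)%N ->
  proper_subspaces k V <-> proper_subspaces (n - k.+1) (perp V).
Proof.
move=> kn; rewrite /proper_subspaces/= pole2_perp subr_gt0 gtrBl andbC.
have := dim_perp V; split=> -[dV ->]; split=> //; lia.
Qed.

Theorem theorem3p7 (R : realType) (n j k : nat) (omega : R) :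
  (2 <= n)%N -> (j < k)%N -> (k <= n - 1)%N -> 0 < omega < pi / 2 ->
  ((j + k <= n - 2)%N ->
    forall (mu : subspaces R n -> probability (borel_subspaces R n) R)
           (F : subspaces R n -> R[i]) (p : R),
      (forall zeta, Grass R n k zeta ->
         invariant_probability zeta (subspaces_in j zeta) (mu zeta)) ->
      {within Grass_tilde R n j, continuous (F : subspaces R n -> R[i]^o)} ->
      p < j.+1%:R ->
      has_ubound [set (cos (pole_dist tau) `^ p) * Normc.normc (F tau)
                 | tau in Grass_tilde R n j] ->
      (forall zeta, Grass_tilde R n k zeta -> omega < pole_dist zeta ->
         Radon j mu F zeta = 0) ->
      forall tau, Grass_tilde R n j tau -> omega < pole_dist tau ->
        F tau = 0) /\
  ((n <= j + k)%N ->
    forall (nu : subspaces R n -> probability (borel_subspaces R n) R)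
           (Phi : subspaces R n -> R[i]) (q : R),
      (forall tau, Grass R n j tau ->
         invariant_probability tau (subspaces_above k tau) (nu tau)) ->
      {within Grass_tilde R n k, continuous (Phi : subspaces R n -> R[i]^o)} ->
      q < n%:R - k%:R ->
      has_ubound [set (sin (pole_dist zeta) `^ q) * Normc.normc (Phi zeta)
                 | zeta in Grass_tilde R n k] ->
      (forall tau, Grass_tilde R n j tau -> pole_dist tau < omega ->
         dual_Radon k nu Phi tau = 0) ->
      forall zeta, Grass_tilde R n k zeta -> pole_dist zeta < omega ->
        Phi zeta = 0).
Proof.
move=> n2 jk kn1 /andP[omega0 omega1]; have kn : (k < n)%N by lia.
have jn : (j < n)%N by lia.
split=> [jkn mu F p mu_inv Fc pj [M FM] RF tau|jkn nu Phi q nu_inv Phic qk [M PhiM] RPhi zeta].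
  rewrite Grass_tildeE => tauD tau_omega; rewrite Grass_tildeE in Fc FM.
  have [dtau /andP[tau0 tau1]] := tauD.
  (* The dimension condition j + (k + 1) < n is j + k <= n - 2. *)
  apply: (@complex_support R n j k.+1 id F M p tau) => //.
  - by lia.
  - by lia.
  - exact: within_ccont Fc.
  - move=> V VD; have [dV _] := VD; rewrite -cos_pole_dist ?dV//.
    by apply: FM; exists V.
  - move=> zeta dzeta zeta0 zt.
    have zD : Grass_tilde R n k zeta.
      by rewrite Grass_tildeE; split; rewrite ?zeta0 ?(le_lt_trans zt).
    exists (mu zeta); have [muS mu_rot] := mu_inv zeta dzeta; split=> //.
    have := RF zeta zD; rewrite /Radon Grass_tildeE; apply.
    by apply: lt_le_trans tau_omega _; rewrite pole_dist_le ?dtau ?dzeta.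
rewrite Grass_tildeE => zetaD zeta_omega; rewrite Grass_tildeE in Phic PhiM.
have [dzeta /andP[zeta0 zeta1]] := zetaD.
rewrite -[zeta]perpK.
(* Complements turn (k + 1)-planes containing a (j + 1)-plane into (n - k)-planes inside an (n -
   j)-plane. The dimension condition (n - k - 1) + (n - j) < n is n <= j + k, and the exponent
   condition becomes q < n - k. *)
apply: (@complex_support R n (n - k.+1) (n - j) (@perp R n) (Phi \o (@perp R n)) M q (perp zeta)).
- exact: pd_perp.
- exact: perp_rotate.
- by lia.
- by lia.
- by apply: lt_le_trans qk _; rewrite -natrB ?ler_nat; lia.
- move=> U eta UD eta0; have [|d d0 h] := within_ccont Phic (U := perp U) _ eta0.
    by apply/proper_perp => //; rewrite perpK.
  exists d => // V VD VU; apply: h; last by rewrite pd_perp.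
  by apply/proper_perp => //; rewrite perpK.
- move=> V VD; have PD : proper_subspaces k (perp V) by apply/proper_perp; rewrite ?perpK.
  have [dV _] := PD; have := pole2_perp V => pV.
  rewrite -[pole2 V](subKr 1) -pV -sin_pole_dist ?dV//.
  by apply: PhiM; exists (perp V).
- exact/(proper_perp _ kn).
- move=> tau' dtau tau'0 tz; pose tau := perp tau'.
  have tauE : tau' = perp tau by rewrite /tau perpK.
  have dimt : \dim tau = j.+1 by have := dim_perp tau'; rewrite dtau -/tau; lia.
  have pt : pole2 tau = 1 - pole2 tau' by rewrite pole2_perp.
  (* Complements replace [pole2] by 1 - [pole2], so the comparison is reversed: |tau| <= |zeta| <
     omega, and the hypothesis on the dual transform applies at [tau]. *)
  have zt : pole2 zeta <= pole2 tau.
    by rewrite pt; move: tz; rewrite pole2_perp; lra.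
  have tD : Grass_tilde R n j tau.
    rewrite Grass_tildeE; split=> //; rewrite (lt_le_trans zeta0 zt)/=.
    by rewrite pt gtrBl.
  have aboveE : subspaces_above k tau = (@perp R n) @^-1` subspaces_in (n - k.+1) tau'.
    by apply/seteqP; split => V; rewrite tauE => /(subspaces_above_perp _ _ kn).
  have properE : @proper_subspaces R n k = (@perp R n) @^-1` proper_subspaces (n - k.+1).
    by apply/seteqP; split => V /(proper_perp _ kn).
  have [nuS nu_rot] := nu_inv tau dimt.
  exists (nu tau); split.
  + by rewrite -aboveE.
  + move=> g g1 gt; apply: nu_rot => //.
    by rewrite /tau -perp_rotate// gt.
  + rewrite (_ : (Phi \o _) \o _ = Phi); last first.
      by apply/funext => V /=; rewrite perpK.
    rewrite preimage_setI -aboveE -properE -Grass_tildeE.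
    apply: RPhi => //; apply: le_lt_trans zeta_omega.
    by rewrite pole_dist_le ?dzeta ?dimt.
Qed.
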